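(* Let $(X,\sigma)$ be a minimal cascade with $X$ compact Hausdorff. The following conditions are equivalent. (1) $(X,\sigma)$ is an infinite, circularly ordered, minimal cascade and $X$ is second countable. (2) $(X,\sigma)$ can be embedded in some $(\mathbb{T},\psi)$, where $\psi$ is a homeomorphism of $\mathbb{T}$ which has no periodic points. (3) $P'\subset\Delta$, $P\setminus\Delta$ is countable, and $X/D$ is homeomorphic to $\mathbb{T}$. (4) There exists an irrational number $\alpha\in\mathbb{R}$ such that $(X,\sigma)\cong\mathrm{Split}(\mathbb{T},R_\alpha;A)$ for some countable, $R_\alpha$-invariant subset $A\subset\mathbb{T}$.
   Context: A cascade $(X,\sigma)$ is a compact Hausdorff space $X$ with a homeomorphism $\sigma$ (generating a $\mathbb{Z}$-action); it is minimal if every orbit $\{\sigma^n x:n\in\mathbb{Z}\}$ is dense. Embedding and isomorphism ($\cong$) of cascades mean equivariant topological embedding, respectively equivariant homeomorphism. $\mathbb{T}=\mathbb{R}/\mathbb{Z}$, and $R_\alpha(t)=t+\alpha \pmod 1$. $\Delta=\{(x,x):x\in X\}$ is the diagonal. $P\subset X\times X$ is the proximal relation of $(X,\sigma)$: $(x,y)\in P$ iff the closure of $\{(\sigma^nx,\sigma^ny):n\in\mathbb{Z}\}$ meets $\Delta$. $P'$ is the set of accumulation points of $P$ in $X\times X$. $D\subset X\times X$ is the distal structure relation: the smallest closed $\sigma$-invariant equivalence relation such that the quotient system $X/D$ is distal (i.e. its proximal relation is the diagonal). A circular order on a set $X$ is a relation $R\subset X^3$ (write $[a,b,c]$ for $(a,b,c)\in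 R$) such that: $[a,b,c]\Rightarrow[b,c,a]$; $[a,b,c]\Rightarrow (a,c,b)\notin R$; $[a,b,c]$ and $[a,c,d]$ imply $[a,b,d]$; if $a,b,c$ are distinct then $[a,b,c]$ or $[a,c,b]$. For $a\ne b$ put $(a,b)_R=\{x:[a,x,b]\}$ and $[a,b]_R=(a,b)_R\cup\{a,b\}$; put $[a,a]_R=\{a\}$. The interval topology $\tau_R$ has the sets $(a,b)_R$ as a base. A map $f$ between circularly ordered sets is c-order preserving (COP) if (i) $[a,b,c]$ and $f(a),f(b),f(c)$ distinct imply $[f(a),f(b),f(c)]$; and (ii) $f(a)=f(c)$ implies $f$ is constant on one of $[a,c]_R$, $[c,a]_R$. A cascade $(X,\sigma)$ is circularly ordered if there is a circular order $R$ on $X$ such that $\tau_R$ is the topology of $X$ and every $\sigma^n$, $n\in\mathbb{Z}$, is COP. The usual circular order on $\mathbb{T}$, identified as a set with $[0,1)$, is $[x,y,z]$ iff $(y-x)(z-y)(z-x)>0$. For an $R_\alpha$-invariant set $A\subset\mathbb{T}$ (i.e. $R_\alpha(A)=A$), $\mathrm{Split}(\mathbb{T},R_\alpha;A)$ is the following cascade. As a set it is $\mathbb{T}_A=(\mathbb{T}\setminus A)\cup\{a^-,a^+:a\in A\}$, with projection $\nu:\mathbb{T}_A\to\mathbb{T}$, $\nu(a^\pm)=a$, $\nu(x)=x$ for $x\notin A$. Its circular order is: $[p,q,r]$ iff either $[\nu(p),\nu(q),\nu(r)]$ holds in $\mathbb{T}$, or some cyclic permutation of $(p,q,r)$ has the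 form $(a^-,a^+,u)$ with $a\in A$, $u\notin\{a^-,a^+\}$. The topology is the interval topology, and the homeomorphism is $a^\pm\mapsto(R_\alpha a)^\pm$ for $a\in A$, $x\mapsto R_\alpha x$ for $x\notin A$. *)

(* Defs.v *)
From HB Require Import structures.
From mathcomp Require Import all_boot all_order all_algebra.
From mathcomp Require Import all_classical all_reals all_analysis.
From mathcomp Require Import lra.

Set Implicit Arguments.
Unset Strict Implicit.
Unset Printing Implicit Defensive.

Import Order.TTheory GRing.Theory Num.Theory.
Import numFieldNormedType.Exports.

Local Open Scope classical_set_scope.
Local Open Scope ring_scope.

Record homeo (X Y : topologicalType) := Homeo {
  hfun :> X -> Y;
  hinv : Y -> X;
  hfunK : cancel hfun hinv;
  hinvK : cancel hinv hfun;
  hfun_continuous : continuous hfun;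
  hinv_continuous : continuous hinv }.

Section cascades.
Variable X : topologicalType.
Implicit Type s : homeo X X.

Definition hpow s (n : int) : X -> X :=
  match n with
  | Posz k => iter k s
  | Negz k => iter k.+1 (hinv s)
  end.

(* As usual in topological dynamics, the phase space of a minimal cascade is
   nonempty. *)
Definition minimal_cascade s :=
  [set: X] !=set0 /\ forall x, dense (range (fun n : int => hpow s n x)).

Definition no_periodic_points s :=
  forall (n : nat) x, (0 < n)%N -> iter n s x <> x.

Definition proximal s : set (X * X) :=
  [set p | closure (range (fun n : int => (hpow s n p.1, hpow s n p.2)))
           `&` diagonal !=set0].

Definition distal s := proximal s = diagonal.

End cascades.

Definition equivariant (X Y : topologicalType) (s : homeo X X) (t : homeo Y Y)
  (f : X -> Y) := forall x, f (s x) = t (f x).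

Definition topological_embedding (X Y : topologicalType) (f : X -> Y) :=
  injective f /\
  forall U : set X, open U <-> exists2 V : set Y, open V & U = f @^-1` V.

Definition cascade_embeds (X Y : topologicalType) (s : homeo X X)
  (t : homeo Y Y) :=
  exists2 f : X -> Y, topological_embedding f & equivariant s t f.

Definition cascade_isomorphic (X Y : topologicalType) (s : homeo X X)
  (t : homeo Y Y) :=
  exists f : homeo X Y, equivariant s t f.

Section distal_structure.
Variable X : topologicalType.
Implicit Types (s : homeo X X) (E : equiv_rel X).
Local Open Scope quotient_scope.

Definition quotient_space E := quotient_topology {eq_quot E}.

Definition rel_invariant s E := forall x y, E (s x) (s y) = E x y.

Definition quotient_map E (f : X -> X) (q : quotient_space E) :
    quotient_space E :=
  \pi_(quotient_space E) (f (repr q)).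

Lemma quotient_map_pi E (f : X -> X) x :
    (forall x y, E (f x) (f y) = E x y) ->
  quotient_map f (\pi_(quotient_space E) x) = \pi_(quotient_space E) (f x).
Proof.
move=> fE; apply/eqmodP; rewrite fE; apply/eqmodP.
exact: (@reprK _ (quotient_space E)).
Qed.

Lemma quotient_map_continuous E (f : X -> X) :
    continuous f -> (forall x y, E (f x) (f y) = E x y) ->
  continuous (@quotient_map E f).
Proof.
move=> cf fE; apply/quotient_continuous.
have -> : @quotient_map E f \o \pi_(quotient_space E) =
          \pi_(quotient_space E) \o f.
  by apply/funext => x /=; rewrite quotient_map_pi.
by move=> x; apply: continuous_comp; [exact: cf|exact: pi_continuous].
Qed.

Lemma rel_invariantV s E :
  rel_invariant s E -> forall x y, E (hinv s x) (hinv s y) = E x y.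
Proof. by move=> sE x y; rewrite -sE !hinvK. Qed.

Lemma quotient_mapK E (f g : X -> X) :
    cancel f g -> (forall x y, E (f x) (f y) = E x y) ->
    (forall x y, E (g x) (g y) = E x y) ->
  cancel (@quotient_map E f) (@quotient_map E g).
Proof.
move=> fK fE gE q; rewrite [quotient_map f q]/quotient_map.
rewrite quotient_map_pi// fK.
exact: (@reprK _ (quotient_space E)).
Qed.

Definition quotient_cascade s E (sE : rel_invariant s E) :
    homeo (quotient_space E) (quotient_space E) :=
  Homeo (quotient_mapK (@hfunK _ _ s) sE (rel_invariantV sE))
        (quotient_mapK (@hinvK _ _ s) (rel_invariantV sE) sE)
        (quotient_map_continuous (@hfun_continuous _ _ s) sE)
        (quotient_map_continuous (@hinv_continuous _ _ s) (rel_invariantV sE)).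

Definition closed_rel E := closed [set p : X * X | E p.1 p.2].

Definition distal_quotient s E :=
  exists sE : rel_invariant s E, distal (quotient_cascade sE).

Definition distal_structure_relation s (D : equiv_rel X) :=
  [/\ closed_rel D, distal_quotient s D &
      forall E : equiv_rel X, closed_rel E -> distal_quotient s E ->
        forall x y, D x y -> E x y].

End distal_structure.

Record circular_order (T : Type) (R : T -> T -> T -> Prop) : Prop :=
  CircularOrder {
    co_cycle : forall a b c, R a b c -> R b c a;
    co_asym : forall a b c, R a b c -> ~ R a c b;
    co_trans : forall a b c d, R a b c -> R a c d -> R a b d;
    co_total : forall a b c, a <> b -> b <> c -> a <> c ->
      R a b c \/ R a c b }.

Section circular_intervals.
Variables (T : Type) (R : T -> T -> T -> Prop).

Definition oint a b : set T := [set x | R a x b].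

Definition cint a b : set T :=
  [set x | a = b /\ x = a \/ a <> b /\ (R a x b \/ x = a \/ x = b)].

Definition open_intervals : set (set T) :=
  [set U | exists a b, a <> b /\ U = oint a b].

End circular_intervals.

Definition cop (T T' : Type) (R : T -> T -> T -> Prop)
    (R' : T' -> T' -> T' -> Prop) (f : T -> T') :=
  (forall a b c, R a b c -> f a <> f b -> f b <> f c -> f a <> f c ->
     R' (f a) (f b) (f c)) /\
  (forall a c, f a = f c ->
     (forall x y, cint R a c x -> cint R a c y -> f x = f y) \/
     (forall x y, cint R c a x -> cint R c a y -> f x = f y)).

Definition circularly_ordered (X : topologicalType) (s : homeo X X) :=
  exists R : X -> X -> X -> Prop,
    [/\ circular_order R, basis (open_intervals R) &
        forall n : int, cop R R (hpow s n)].

Section linear_to_circular.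
Variables (T : Type) (lt : T -> T -> Prop).
Hypothesis lt_irr : forall x, ~ lt x x.
Hypothesis lt_tr : forall y x z, lt x y -> lt y z -> lt x z.
Hypothesis lt_tot : forall x y, x <> y -> lt x y \/ lt y x.

Definition cyclic_of a b c :=
  [\/ lt a b /\ lt b c, lt b c /\ lt c a | lt c a /\ lt a b].

Lemma cyclic_of_circular : circular_order cyclic_of.
Proof.
have asy x y : lt x y -> lt y x -> False.
  by move=> xy yx; apply: (@lt_irr x); exact: lt_tr yx.
split.
- move=> a b c [[? ?]|[? ?]|[? ?]].
  + by apply: Or33.
  + by apply: Or31.
  + by apply: Or32.
- move=> a b c [[? ?]|[? ?]|[? ?]] [[? ?]|[? ?]|[? ?]];
  by [apply: (asy a b)|apply: (asy b c)|apply: (asy c a)|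
      apply: (asy a c)|apply: (asy b a)|apply: (asy c b)].
- move=> a b c d [[ab bc]|[bc ca]|[ca ab]] [[ac cd]|[cd da]|[da ac]];
  try by case: (asy _ _ ac ca).
  + by apply: Or31; split=> //; exact: lt_tr cd.
  + by case: (asy a c); [exact: lt_tr bc|exact: lt_tr da].
  + by apply: Or33.
  + by apply: Or32; split=> //; apply: lt_tr cd.
  + by apply: Or33.
- move=> a b c /lt_tot ab /lt_tot bc /lt_tot ac.
  case: ab bc ac => [ab|ba] [bc|cb] [ac|ca];
  by [left; apply: Or31|left; apply: Or32|left; apply: Or33|
      right; apply: Or31|right; apply: Or32|right; apply: Or33].
Qed.

End linear_to_circular.

Section interval_base.
Variables (T : Type) (R : T -> T -> T -> Prop).
Hypothesis Rco : circular_order R.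

Lemma circular_order_neq a b c : R a b c -> [/\ a <> b, b <> c & a <> c].
Proof.
have nd x y : ~ R x y y by move=> xyy; exact: (co_asym Rco xyy).
move=> abc; split=> e; subst.
- by have := co_cycle Rco (co_cycle Rco abc); exact: nd.
- exact: (nd _ _ abc).
- by have /nd := co_cycle Rco abc.
Qed.

Lemma open_intervals_cover (u v w : T) : u <> v -> v <> w -> u <> w ->
  \bigcup_(U in open_intervals R) U = setT.
Proof.
move=> uv vw uw; rewrite eqEsubset; split=> // x _.
suff [a [b axb]] : exists a b, R a x b.
  exists (oint R a b) => //; exists a, b; split=> //.
  by case: (circular_order_neq axb).
have tot a b : a <> b -> x <> a -> x <> b -> exists a b, R a x b.
  move=> ab xa xb; case: (co_total Rco xa ab xb) => h.
    by exists b, a; apply: (co_cycle Rco); exact: (co_cycle Rco).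
  by exists a, b; apply: (co_cycle Rco); exact: (co_cycle Rco).
have [xu|xu] := pselect (x = u); first by apply: (tot v w); rewrite ?xu.
have [xv|xv] := pselect (x = v).
  by apply: (tot u w); rewrite ?xv//; exact: nesym.
exact: (tot u v).
Qed.

Lemma open_intervals_meet (U V : set T) t :
    open_intervals R U -> open_intervals R V -> U t -> V t ->
  exists W, [/\ open_intervals R W, W t & W `<=` U `&` V].
Proof.
case: Rco => cyc asy tr tot.
move=> [a [b [_ ->]]] [c [d [_ ->]]]; rewrite /oint /= => atb ctd.
pose lt x y := R t x y.
have ba : lt b a by exact: cyc.
have dc : lt d c by exact: cyc.
have [bt ab] : t <> b /\ a <> b by have [] := circular_order_neq atb.
have [ta tc] : t <> a /\ t <> c.
  by have [/nesym ? _ _] := circular_order_neq atb;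
     have [/nesym ? _ _] := circular_order_neq ctd.
have td : t <> d by have [] := circular_order_neq ctd.
have [m [m_max tm]] : exists m, (m = a \/ lt a m) /\ (m = c \/ lt c m).
  have [<-|ac] := pselect (a = c); first by exists a; split; left.
  by case: (tot _ _ _ ta ac tc) => h; [exists c|exists a]; split;
     [right|left|left|right].
have [n [n_min tn]] : exists n, (n = b \/ lt n b) /\ (n = d \/ lt n d).
  have [<-|bd] := pselect (b = d); first by exists b; split; left.
  by case: (tot _ _ _ bt bd td) => h; [exists b|exists d]; split;
     [left|right|right|left].
have nm : lt n m.
  have na : lt n a by case: n_min => [->//|h]; exact: tr ba.
  by case: m_max => [->//|h]; exact: tr h.
have out p q : lt q p -> forall x, R p x q <-> [\/ x = t, lt x q | lt p x].
  move=> qp x; have tqp : R p t q by apply: (cyc); exact: cyc.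
  split=> [pxq|[->//|tx|tx]].
  - have [px xq _] := circular_order_neq pxq.
    have [->|xt] := pselect (x = t); first exact: Or31.
    have tq : t <> q by have [] := circular_order_neq qp.
    have tp : t <> p by have [] := circular_order_neq qp.
    case: (tot _ _ _ (nesym xt) xq tq) => [|tqx]; first exact: Or32.
    case: (tot _ _ _ tp px (nesym xt)) => [|txp]; first exact: Or33.
    case: (asy _ _ _ pxq); apply: (cyc); apply: (tr) (cyc _ _ _ txp) _.
    by apply: (cyc); exact: cyc.
  - by apply: (cyc); apply: (tr q p t x); [exact: cyc|apply: (cyc); exact: cyc].
  - by apply: (tr p x t q) => //; exact: cyc.
have sub p q : lt q p -> (m = p \/ lt p m) -> (n = q \/ lt n q) ->
    oint R m n `<=` oint R p q.
  move=> qp pm nq x /(out _ _ nm) mxn; apply/(out _ _ qp).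
  case: mxn => [->|xn|mx]; [exact: Or31|apply: Or32|apply: Or33].
    by case: nq => [<-//|nq]; exact: tr nq.
  by case: pm => [<-//|pm]; exact: tr mx.
exists (oint R m n); split.
- exists m, n; split=> //.
  by have [_ /nesym] := circular_order_neq nm.
- by apply: (cyc); exact: cyc.
- by move=> x mxn; split; [exact: (sub a b)|exact: (sub c d)].
Qed.

End interval_base.

Section circle.
Variable R : realType.
Local Open Scope quotient_scope.

Definition int_eqv (x y : R) : bool := (x - y) \is a Num.int.

Lemma int_eqv_equiv : equiv_class_of int_eqv.
Proof.
split=> [x|x y|y x z]; rewrite /int_eqv.
- by rewrite subrr.
- by rewrite -opprB rpredN.
- by move=> xy yz; rewrite -(subrKA y); exact: rpredD.
Qed.

Canonical int_eqv_equiv_rel := EquivRelPack int_eqv_equiv.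

Definition circle := quotient_topology {eq_quot int_eqv}.

HB.instance Definition _ := Topological.on circle.

(* The representative of a point of the circle in [0, 1) *)
Definition circle_coord (t : circle) : R :=
  repr t - (Num.floor (repr t))%:~R.

Lemma circle_coord_inj : injective circle_coord.
Proof.
move=> s t st; rewrite -[s](@reprK _ circle) -[t](@reprK _ circle).
apply/eqmodP; rewrite /= /int_eqv.
have -> : repr s - repr t =
    (Num.floor (repr s))%:~R - (Num.floor (repr t))%:~R.
  by move: st; rewrite /circle_coord; lra.
by rewrite -intrB.
Qed.

Lemma circle_coord_pi (x : R) :
  0 <= x < 1 -> circle_coord (\pi_circle x) = x.
Proof.
move=> x01; rewrite /circle_coord.
set y := repr _.
have /eqmodP : \pi_circle y = \pi_circle x by exact: (@reprK _ circle).
rewrite /= /int_eqv => /intrP[m xym].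
have -> : y = x + m%:~R by rewrite -xym; lra.
have -> : Num.floor (x + m%:~R) = m.
  by apply: floor_def; rewrite intrD; move: x01 => /andP[? ?]; lra.
by rewrite addrK.
Qed.

Definition circle_lt (s t : circle) := circle_coord s < circle_coord t.

Definition circle_order (s t u : circle) : Prop :=
  let x := circle_coord s in let y := circle_coord t in
  let z := circle_coord u in
  (y - x) * (z - y) * (z - x) > 0.

Lemma circle_orderE s t u :
  circle_order s t u <-> cyclic_of circle_lt s t u.
Proof.
rewrite /circle_order /cyclic_of /circle_lt /=.
move: (circle_coord s) (circle_coord t) (circle_coord u) => x y z.
rewrite -mulrA; case: (ltgtP x y) => [xy|yx|->]; last first.
- rewrite subrr mul0r ltxx; split=> // -[] []; lra.
- rewrite nmulr_rgt0 ?subr_lt0//; split=> [h|[] []]; try nra.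
  case: (ltgtP y z) => yz; case: (ltgtP x z) => xz; try nra.
  exact: Or32.
- rewrite pmulr_rgt0 ?subr_gt0//; split=> [h|[] []]; try nra.
  case: (ltgtP y z) => yz; case: (ltgtP x z) => xz; try nra.
  + exact: Or31.
  + exact: Or33.
Qed.

Definition rotation_fun (a : R) : circle -> circle :=
  fun t => \pi_circle (repr t + a).

Lemma rotation_fun_pi a x : rotation_fun a (\pi_circle x) = \pi_circle (x + a).
Proof.
have /eqmodP : \pi_circle (repr (\pi_circle x)) = \pi_circle x.
  exact: (@reprK _ circle).
move=> xx; apply/eqmodP; move: xx.
by rewrite /= /int_eqv opprD addrACA subrr addr0.
Qed.

Lemma rotation_funK a : cancel (rotation_fun a) (rotation_fun (- a)).
Proof.
move=> t; rewrite [rotation_fun a t]/rotation_fun rotation_fun_pi addrK.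
exact: (@reprK _ circle).
Qed.

Lemma rotation_funVK a : cancel (rotation_fun (- a)) (rotation_fun a).
Proof. by move=> t; rewrite -{1}[a]opprK rotation_funK. Qed.

Lemma rotation_fun_continuous a : continuous (rotation_fun a).
Proof.
apply/quotient_continuous.
have -> : rotation_fun a \o \pi_circle = \pi_circle \o (fun x => x + a).
  by apply/funext => x /=; rewrite rotation_fun_pi.
move=> x; apply: continuous_comp; last exact: pi_continuous.
by apply: cvgD; [exact: cvg_id|exact: cvg_cst].
Qed.

Definition rotation (a : R) : homeo circle circle :=
  Homeo (rotation_funK a) (rotation_funVK a)
        (@rotation_fun_continuous a) (@rotation_fun_continuous (- a)).

Lemma circle_coord_itv t : 0 <= circle_coord t < 1.
Proof.
rewrite /circle_coord subr_ge0 floor_le_tmp /= ltrBlDr addrC.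
by have := floorD1_gt (repr t); rewrite intrD.
Qed.

Lemma circle_coord_pi_int (x : R) :
  circle_coord (\pi_circle x) - x \is a Num.int.
Proof.
have /eqmodP : \pi_circle (repr (\pi_circle x)) = \pi_circle x.
  exact: (@reprK _ circle).
move=> h; rewrite /circle_coord addrAC; apply: rpredB;
  [exact: h|exact: intr_int].
Qed.

Lemma circle_coord_rotation a : exists c, forall t,
  circle_coord (rotation_fun a t) = circle_coord t + c \/
  circle_coord (rotation_fun a t) = circle_coord t + c - 1.
Proof.
exists (circle_coord (\pi_circle a)) => t.
have /intrP[m mE] : circle_coord (rotation_fun a t) -
    (circle_coord t + circle_coord (\pi_circle a)) \is a Num.int.
  have h1 := circle_coord_pi_int (repr t + a).
  have h2 := circle_coord_pi_int a.
  have h3 : circle_coord t - repr t \is a Num.int.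
    by rewrite /circle_coord addrAC subrr add0r rpredN; exact: intr_int.
  have := rpredB (rpredB h1 h2) h3.
  by congr (_ \is a Num.int); rewrite /rotation_fun; lra.
have [/andP[? ?] [/andP[? ?] /andP[? ?]]] := (circle_coord_itv t,
  (circle_coord_itv (rotation_fun a t), circle_coord_itv (\pi_circle a))).
have m1 : (m < 1)%R by rewrite -(ltr_int R); lra.
have m2 : (- 2 < m)%R by rewrite -(ltr_int R) rmorphN /=; lra.
have : (m == 0) || (m == -1) by move: m1 m2; clear; case: m => [[|n]|[|[|n]]].
by case/orP => /eqP m0; [left|right]; move: mE; rewrite m0 ?rmorphN /=; lra.
Qed.

Lemma rotation_order a s t u : circle_order s t u ->
  circle_order (rotation_fun a s) (rotation_fun a t) (rotation_fun a u).
Proof.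
move=> /circle_orderE h; apply/circle_orderE; move: h.
have [c cE] := circle_coord_rotation a.
have [/andP[? ?] [/andP[? ?] /andP[? ?]]] := (circle_coord_itv s,
  (circle_coord_itv t, circle_coord_itv u)).
have [/andP[? ?] [/andP[? ?] /andP[? ?]]] :=
  (circle_coord_itv (rotation_fun a s),
  (circle_coord_itv (rotation_fun a t), circle_coord_itv (rotation_fun a u))).
rewrite /cyclic_of /circle_lt.
case: (cE s) (cE t) (cE u) => ? [?|?] [?|?] [] [? ?];
  try (exfalso; lra);
  by [apply: Or31; split; lra|apply: Or32; split; lra|apply: Or33; split; lra].
Qed.

End circle.

Section split.
Variables (R : realType) (A : set (circle R)).
Local Open Scope quotient_scope.

(* A pair (x, false) stands for x if x \notin A and for x^- if x \in A; a pair
   (x, true), allowed only for x \in A, stands for x^+. *)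
Record split_circle := SplitCircle {
  split_val : circle R * bool;
  split_valP : split_val.2 ==> `[< A split_val.1 >] }.

HB.instance Definition _ := [isSub for split_val].
HB.instance Definition _ := [Equality of split_circle by <:].
HB.instance Definition _ := [Choice of split_circle by <:].

Definition split_proj (p : split_circle) : circle R := (split_val p).1.

Definition is_minus (p : split_circle) :=
  A (split_proj p) /\ (split_val p).2 = false.

Definition is_plus (p : split_circle) :=
  A (split_proj p) /\ (split_val p).2 = true.

Definition split_triple (p q u : split_circle) :=
  [/\ is_minus p, is_plus q, split_proj p = split_proj q, u <> p & u <> q].

Definition split_order (p q r : split_circle) : Prop :=
  circle_order (split_proj p) (split_proj q) (split_proj r) \/
  [\/ split_triple p q r, split_triple q r p | split_triple r p q].

Definition split_lt (p q : split_circle) :=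
  circle_lt (split_proj p) (split_proj q) \/
  [/\ split_proj p = split_proj q, is_minus p & is_plus q].

Lemma split_circle_eq (p q : split_circle) :
  split_proj p = split_proj q -> (split_val p).2 = (split_val q).2 -> p = q.
Proof.
move=> pq1 pq2; apply: val_inj.
by rewrite /= [split_val p]surjective_pairing [split_val q]surjective_pairing
  pq2; congr (_, _).
Qed.

Lemma is_plusP p : (split_val p).2 = true -> is_plus p.
Proof.
case: p => -[x b] /= xb bT; split=> //=; move: xb.
by rewrite /split_proj bT /= => /asboolP.
Qed.

Lemma split_lt_irr p : ~ split_lt p p.
Proof.
case=> [|[_ [_ p0] [_]]]; first by rewrite /circle_lt ltxx.
by rewrite p0.
Qed.

Lemma split_lt_trans q p r : split_lt p q -> split_lt q r -> split_lt p r.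
Proof.
case=> [pq|[pq pm qp]] [qr|[qr qm rp]].
- by left; exact: lt_trans qr.
- by left; rewrite -qr.
- by left; rewrite pq.
- by case: qp qm => _ qT [_]; rewrite qT.
Qed.

Lemma split_lt_total p q : p <> q -> split_lt p q \/ split_lt q p.
Proof.
move=> pq; rewrite /split_lt /circle_lt.
case: (ltgtP (circle_coord (split_proj p)) (circle_coord (split_proj q))).
- by left; left.
- by right; left.
move=> /circle_coord_inj e.
case p2 : (split_val p).2; case q2 : (split_val q).2.
- by case: pq; apply: split_circle_eq; rewrite ?p2.
- have [Ap _] := is_plusP p2.
  by right; right; split => //; split=> //; rewrite -e.
- have [Aq _] := is_plusP q2.
  by left; right; split => //; split=> //; rewrite e.
- by case: pq; apply: split_circle_eq; rewrite ?p2.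
Qed.

Lemma split_orderE p q r : split_order p q r <-> cyclic_of split_lt p q r.
Proof.
have fwd a b c : split_triple a b c -> cyclic_of split_lt a b c.
  move=> [am bp ab ca cb]; have a_b : split_lt a b by right.
  have [c_b|] := split_lt_total cb; last by move=> ?; apply: Or31.
  have [|a_c] := split_lt_total ca; first by move=> ?; apply: Or33.
  exfalso; move: a_c c_b; rewrite /split_lt -ab /circle_lt.
  move=> [ac|[<- _ [_ cp]]] [cb'|[ca' [_ cm] _]].
  - by have := lt_trans ac cb'; rewrite ltxx.
  - by move: ac; rewrite ca' ltxx.
  - by move: cb'; rewrite ltxx.
  - by move: cm; rewrite cp.
have bwd a b c : split_lt a b -> split_lt b c -> split_order a b c.
  move=> ab bc; have ac := split_lt_trans ab bc.
  have neq x y : split_lt x y -> x <> y.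
    by move=> xy e; apply: (@split_lt_irr x); rewrite {2}e.
  case: (ab) (bc) => [ab'|[eab am bp]] [bc'|[ebc bm cp]].
  - by left; apply/circle_orderE; apply: Or31.
  - by right; apply: Or32; split=> //; exact: neq.
  - by right; apply: Or31; split=> //; apply: nesym; exact: neq.
  - by case: bp bm => _ bT [_]; rewrite bT.
split=> [[/circle_orderE|[]/fwd]|[[]|[]|[]]].
- by case=> -[? ?]; [apply: Or31|apply: Or32|apply: Or33]; split; left.
- by [].
- by case=> ?; [apply: Or32|apply: Or33|apply: Or31].
- by case=> ?; [apply: Or33|apply: Or31|apply: Or32].
- exact: bwd.
- move=> qr rp; case: (bwd _ _ _ qr rp) => [/circle_orderE h|h].
    left; apply/circle_orderE.
    by case: h => ?; [apply: Or32|apply: Or33|apply: Or31].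
  by right; case: h => ?; [apply: Or32|apply: Or33|apply: Or31].
- move=> rp pq; case: (bwd _ _ _ rp pq) => [/circle_orderE h|h].
    left; apply/circle_orderE.
    by case: h => ?; [apply: Or33|apply: Or31|apply: Or32].
  by right; case: h => ?; [apply: Or33|apply: Or31|apply: Or32].
Qed.

Lemma split_order_circular : circular_order split_order.
Proof.
have -> : split_order = cyclic_of split_lt.
  apply/funext => p; apply/funext => q; apply/funext => r.
  by apply/propext; exact: split_orderE.
apply: cyclic_of_circular; first exact: split_lt_irr.
  exact: split_lt_trans.
exact: split_lt_total.
Qed.

Lemma split_cover : \bigcup_(U in open_intervals split_order) U = setT.
Proof.
pose P (x : R) := @SplitCircle (\pi_(circle R) x, false) isT.
have neq (x y : R) : 0 <= x < 1 -> 0 <= y < 1 -> x < y -> P x <> P y.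
  move=> x01 y01 xy /(congr1 (fun p => circle_coord (split_proj p))).
  by rewrite /split_proj /= !circle_coord_pi// => e; move: xy; rewrite e ltxx.
apply: (open_intervals_cover split_order_circular
          (u := P 0) (v := P 4^-1) (w := P 2^-1)); apply: neq;
  try (apply/andP; split); lra.
Qed.

HB.instance Definition _ := isBaseTopological.Build split_circle
  split_cover
  (fun U V t hU hV tU tV =>
     open_intervals_meet split_order_circular hU hV tU tV).

Lemma split_basis : basis (open_intervals split_order).
Proof.
split=> [U oU|p U]; first by exists [set U]; [move=> _ ->|rewrite bigcup_set1].
move=> /=; rewrite nbhsE => -[V [[D DI <-] [W DW Wp]] VU].
exists W; first by split=> //; exact: DI.
by move=> x Wx; apply: VU; exists W.
Qed.

Section lift.
Variables (f : circle R -> circle R) (fA : forall t, A (f t) = A t).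

Lemma split_lift_subproof (p : split_circle) :
  (f (split_proj p), (split_val p).2).2 ==>
  `[< A (f (split_proj p), (split_val p).2).1 >].
Proof. by rewrite /= fA; exact: split_valP. Qed.

Definition split_lift (p : split_circle) : split_circle :=
  SplitCircle (split_lift_subproof p).

Hypothesis f_inj : injective f.
Hypothesis f_order : forall s t u,
  circle_order s t u -> circle_order (f s) (f t) (f u).

Lemma split_lift_inj : injective split_lift.
Proof.
move=> p q pq; apply: split_circle_eq.
  by apply: f_inj; have := congr1 split_proj pq.
by have := congr1 (fun r => (split_val r).2) pq.
Qed.

Lemma split_lift_order p q r : split_order p q r ->
  split_order (split_lift p) (split_lift q) (split_lift r).
Proof.
have triple a b c : split_triple a b c ->
    split_triple (split_lift a) (split_lift b) (split_lift c).
  move=> [[Aa a0] [Ab b1] ab ca cb].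
  split; [split=> //|split=> //| |by move=> /split_lift_inj..].
  - by rewrite /split_proj /= fA.
  - by rewrite /split_proj /= fA.
  - by rewrite /split_proj /=; congr (f _).
case=> [|[]/triple h]; first by left; exact: f_order.
- by right; apply: Or31.
- by right; apply: Or32.
- by right; apply: Or33.
Qed.

End lift.

Lemma split_lift_continuous f g (fA : forall t, A (f t) = A t)
    (gA : forall t, A (g t) = A t) :
    cancel f g -> cancel g f ->
    (forall s t u, circle_order s t u -> circle_order (f s) (f t) (f u)) ->
    (forall s t u, circle_order s t u -> circle_order (g s) (g t) (g u)) ->
  continuous (split_lift fA).
Proof.
move=> fK gK fO gO.
have FK : cancel (split_lift fA) (split_lift gA).
  by move=> p; apply: split_circle_eq; rewrite /split_proj //= fK.
have GK : cancel (split_lift gA) (split_lift fA).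
  by move=> p; apply: split_circle_eq; rewrite /split_proj //= gK.
apply/continuousP => _ [D DI <-]; rewrite preimage_bigcup.
apply: bigcup_open => U /DI [a [b [ab ->]]].
have [+ _] := split_basis; apply.
exists (split_lift gA a), (split_lift gA b); split.
  by move=> /(can_inj GK).
apply/seteqP; split => x; rewrite /oint /=.
- by move=> /(split_lift_order gA (can_inj gK) gO); rewrite FK.
- by move=> /(split_lift_order fA (can_inj fK) fO); rewrite !GK.
Qed.

Section shift.
Variables (a : R) (hA : rotation a @` A = A).

Lemma rotation_stable t : A (rotation a t) = A t.
Proof.
apply/propext; split; last by rewrite -{2}hA => At; exists t.
by rewrite -{1}hA => -[s As /(can_inj (@rotation_funK R a)) <-].
Qed.

Lemma rotationV_stable t : A (hinv (rotation a) t) = A t.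
Proof. by rewrite -rotation_stable hinvK. Qed.

Lemma split_shiftK :
  cancel (split_lift rotation_stable) (split_lift rotationV_stable).
Proof.
by move=> p; apply: split_circle_eq; rewrite /split_proj //= rotation_funK.
Qed.

Lemma split_shiftVK :
  cancel (split_lift rotationV_stable) (split_lift rotation_stable).
Proof.
by move=> p; apply: split_circle_eq; rewrite /split_proj //= rotation_funVK.
Qed.

Lemma split_shift_continuous : continuous (split_lift rotation_stable).
Proof.
apply: (split_lift_continuous rotationV_stable).
- exact: rotation_funK.
- exact: rotation_funVK.
- exact: rotation_order.
- exact: rotation_order.
Qed.

Lemma split_shiftV_continuous : continuous (split_lift rotationV_stable).
Proof.
apply: (split_lift_continuous rotation_stable).
- exact: rotation_funVK.
- exact: rotation_funK.
- exact: rotation_order.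
- exact: rotation_order.
Qed.

Definition split_cascade : homeo split_circle split_circle :=
  Homeo split_shiftK split_shiftVK
        split_shift_continuous split_shiftV_continuous.

End shift.
End split.

(* Main.v *)
Require Import Defs.
From mathcomp Require Import all_boot all_order all_algebra.
From mathcomp Require Import all_classical all_reals all_analysis.
From mathcomp Require Import ring lra zify.

(** Every condition is compared with the description of X as a split
    rotation.

    An ordered cascade is a split rotation, [ordered_minimal_split]. Take a
    finitely additive invariant mean of X, namely the limiting frequency of
    visits of one orbit along an ultrafilter. By minimality nonempty open
    sets have positive mean, while points have mean zero and small
    neighbourhoods have small mean. Measuring arcs from a base point gives a
    map from X to the circle, continuous and monotone of degree one, which
    semiconjugates the cascade to the rotation by the mean of the arc from
    the base point to its image. It identifies two points only if one of the
    arcs between them is empty; hence fibres have at most two points, the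
    angle is irrational, and X is the rotation split at the two-point fibres
    ([rotation_factor]). These are the jumps of the order, countably many
    when X is second countable.

    The same mean shows that a minimal infinite cascade cannot reverse a
    circular order: reversal changes the sign of the coordinate of arcs
    modulo 1, so the second iterate would fix all fibres
    ([minimal_order_not_reversed]). As a homeomorphism of the circle
    preserves or reverses the orientation ([circle_homeo_orientation]), the
    order of the circle restricts to an invariant order of any embedded
    minimal X ([circle_embedded_ordered]).

    A split rotation embeds in the circle, [split_embeds_circle]. This is the
    construction of Denjoy: insert at the n-th point of A an interval whose
    length is the n-th term of a summable sequence, let the rotation permute
    these intervals, and embed the split circle as the complement of their
    interiors.

    For the proximal relation of a split rotation, [split_distal_structure]:
    the two points over a in A are proximal because their orbit is an
    infinite set of pairs with the same projection, and such pairs accumulate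
    only on the diagonal; points with different projections stay apart
    because rotations are distal. Hence the projection to the circle is the
    quotient by the distal structure relation.

    Conversely, [distal_circle_split], let the proximal relation P accumulate
    only on the diagonal. Then P is closed, and therefore an equivalence
    relation with distal quotient, so that it is the distal structure
    relation. A fibre of X over the circle with two points or more consists
    of one limit from the right and one limit from the left: the proximal
    pairs away from the diagonal are finitely many, so over a small arc next
    to the fibre all points are close to one and the same point of the fibre,
    and no point of X is isolated ([fiber_end]). This yields a circular order
    of X whose jumps are proximal pairs, hence countably many, and
    [ordered_minimal_split] applies.

    Throughout, topologies are compared through one fact: a compact topology
    in which the intervals of a circular order are open is the interval
    topology ([compact_oint_basis]). *)

Set Implicit Arguments.
Unset Strict Implicit.
Unset Printing Implicit Defensive.

Import Order.TTheory GRing.Theory Num.Theory.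
Import numFieldNormedType.Exports.

Local Open Scope classical_set_scope.
Local Open Scope ring_scope.

(** * Circular orders *)

Section circular_order_theory.
Variables (T : Type) (R : T -> T -> T -> Prop).
Hypothesis Rco : circular_order R.

Lemma co_rot a b c : R a b c -> R c a b.
Proof. by move=> /(co_cycle Rco)/(co_cycle Rco). Qed.

Lemma co_excl a x b : R a x b -> R b x a -> False.
Proof. by move=> axb /co_rot; exact: co_asym axb. Qed.

Lemma oint_diag a x : ~ R a x a.
Proof. by move=> /(circular_order_neq Rco)[]. Qed.

Lemma co_cases a b x : a <> b -> [\/ x = a, x = b, R a x b | R b x a].
Proof.
move=> ab; have [->|xa] := pselect (x = a); first exact: Or41.
have [->|xb] := pselect (x = b); first exact: Or42.
case: (co_total Rco (nesym xa) xb ab) => [|/(co_cycle Rco)]; first exact: Or43.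
exact: Or44.
Qed.

(** A point inserted into one of the three arcs of a cyclic triple: its position
    relative to the opposite point follows. *)
Lemma co_left a x b c : R a x b -> R a b c -> R a x c /\ R x b c.
Proof.
move=> axb abc; split; first exact: (co_trans Rco axb abc).
apply: co_rot; apply: (co_trans Rco) (co_cycle Rco abc) _; exact: co_rot.
Qed.

Lemma co_right a b x c : R a b c -> R b x c -> R a x c /\ R a b x.
Proof.
move=> abc bxc; split.
  by apply: (co_cycle Rco); apply: (co_trans Rco) (co_rot abc) (co_rot bxc).
by apply: co_rot; apply: (co_trans Rco) bxc (co_cycle Rco abc).
Qed.

Lemma oint_split a b c x : R a b c ->
  R a x c <-> [\/ R a x b, x = b | R b x c].
Proof.
move=> abc; split=> [axc|[axb|->//|bxc]]; last 2 first.
- by case: (co_left axb abc).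
- by case: (co_right abc bxc).
have [ab bc _] := circular_order_neq Rco abc.
have [xa|->|axb|bxa] := co_cases x ab; [|exact: Or32|exact: Or31|].
  by move: axc; rewrite xa => /(circular_order_neq Rco)[].
have [->|xc|bxc|cxb] := co_cases x bc; [exact: Or32| |exact: Or33|].
  by move: axc; rewrite xc => /(circular_order_neq Rco)[].
by have [_ /co_excl/(_ bxa)] := co_left (co_rot axc) cxb.
Qed.

Lemma co_reflect (T' : Type) (R' : T' -> T' -> T' -> Prop) (f : T -> T') :
    circular_order R' -> injective f ->
    (forall a b c, R a b c -> R' (f a) (f b) (f c)) ->
  forall a b c, R' (f a) (f b) (f c) -> R a b c.
Proof.
move=> R'co fI fR a b c fabc.
have [ab bc ac] := circular_order_neq R'co fabc.
have [] // := @co_total _ _ Rco a b c.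
- by move=> e; apply: ab; rewrite e.
- by move=> e; apply: bc; rewrite e.
- by move=> e; apply: ac; rewrite e.
- by move=> /fR /(co_asym R'co); case.
Qed.

(** Two points have disjoint interval neighbourhoods: if some point lies on each
    side, cut there; if one side is empty, the two points themselves and any
    third one bound the intervals. *)
Lemma oint_separation x z (w : T) : x <> z -> w <> x -> w <> z ->
  exists a b c d, [/\ a <> b, c <> d, R a x b, R c z d &
    forall y, R a y b -> R c y d -> False].
Proof.
have gap u v t : R v t u -> (forall y, ~ R u y v) ->
    exists a b c d, [/\ a <> b, c <> d, R a u b, R c v d &
      forall y, R a y b -> R c y d -> False].
  move=> vtu uv0; have [vt tu vu] := circular_order_neq Rco vtu.
  have tuv : R t u v by exact: (co_cycle Rco).
  exists t, v, u, t; split; [exact: nesym|exact: nesym|by []|exact: co_rot|].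
  move=> y /(oint_split y tuv)[tyu uyt|->|/uv0//].
    exact: co_excl uyt.
  by move=> /(circular_order_neq Rco)[].
move=> xz wx wz.
have [[u xuz]|xz0] := pselect (exists u, R x u z); last first.
  have xz0' y : ~ R x y z by move=> xyz; apply: xz0; exists y.
  case: (co_cases w xz) => [//|//|/xz0'//|zwx]; exact: (gap x z w).
have [[v zvx]|zx0] := pselect (exists u, R z u x); last first.
  have zx0' y : ~ R z y x by move=> xyz; apply: zx0; exists y.
  have [a [b [c [d [ab cd aza cxd abcd]]]]] := gap _ _ _ xuz zx0'.
  by exists c, d, a, b; split=> // y cyd ayb; exact: (abcd y).
have [xuv uzv] := co_left xuz (co_rot zvx).
have uv : u <> v by have [] := circular_order_neq Rco xuv.
exists v, u, u, v; split; [exact: nesym|by []|exact: co_rot|by []|].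
by move=> y vyu; exact: co_excl.
Qed.

End circular_order_theory.

Lemma co_pullback (T T' : Type) (R : T' -> T' -> T' -> Prop) (f : T -> T') :
  circular_order R -> injective f ->
  circular_order (fun a b c => R (f a) (f b) (f c)).
Proof.
move=> Rco fI; split.
- by move=> a b c; exact: co_cycle.
- by move=> a b c; exact: co_asym.
- by move=> a b c d; exact: co_trans.
- by move=> a b c ab bc ac; apply: (co_total Rco) => /fI.
Qed.

Definition flip_order (T : Type) (R : T -> T -> T -> Prop) a b c := R c b a.

Lemma co_flip (T : Type) (R : T -> T -> T -> Prop) :
  circular_order R -> circular_order (flip_order R).
Proof.
move=> Rco; split; rewrite /flip_order.
- by move=> a b c; exact: co_rot.
- by move=> a b c cba /(co_rot Rco)/(co_rot Rco); exact: co_asym cba.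
- move=> a b c d cba dca; exact: (co_right Rco dca cba).1.
- move=> a b c ab bc ac.
  by have [|] := co_total Rco (nesym bc) (nesym ab) (nesym ac) => ?;
    [left|right; exact: co_rot].
Qed.

(** * Compactness and interval topologies *)

(** Compactness as an induction principle: if P failed for K, the sets that miss
    only a P-part of K would form a proper filter with no cluster point in K. *)
Lemma compact_ideal (X : topologicalType) (K : set X) (P : set X -> Prop) :
    compact K -> P set0 -> (forall A B, P A -> P B -> P (A `|` B)) ->
    (forall A B, B `<=` A -> P A -> P B) ->
    (forall x, K x -> exists2 U, nbhs x U & P U) ->
  P K.
Proof.
move=> cK P0 PU PS Ploc; apply: contrapT => nPK.
pose F : set_system X := [set A | P (K `\` A)].
have FF : ProperFilter F.
  split; first by rewrite /F /= setD0.
  split=> [|A B FA FB|A B AB FA]; rewrite /F /=.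
  - by rewrite setDT.
  - by rewrite setDIr; exact: PU.
  - by apply: PS FA; exact: setDS.
have FK : F K by rewrite /F /= setDv.
have [x [Kx clx]] := cK F FF FK.
have [U xU PUU] := Ploc x Kx.
have FU : F (~` U) by rewrite /F /= setDE setCK; apply: PS PUU => y [].
by have [y []] := clx _ _ FU xU.
Qed.

Section interval_topology.
Variables (X : topologicalType) (R : X -> X -> X -> Prop).
Hypothesis Rco : circular_order R.

Lemma basis_oint_open a b : basis (open_intervals R) -> open (oint R a b).
Proof.
move=> [oR _]; have [->|ab] := pselect (a = b).
  have -> : oint R b b = set0.
    by rewrite -subset0 => x; exact: (oint_diag Rco).
  exact: open0.
by apply: oR; exists a, b.
Qed.

Lemma basis_oint_nbhs x V : basis (open_intervals R) -> nbhs x V ->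
  exists a b, [/\ a <> b, R a x b & oint R a b `<=` V].
Proof.
move=> [_ /(_ x) bx] /bx[_ [[a [b [ab ->]]] axb] abV].
by exists a, b.
Qed.

(** A compact topology in which intervals are open is the interval topology:
    the interval topology is Hausdorff, so no compact topology is strictly
    finer. *)
Lemma compact_oint_basis : compact [set: X] ->
    (forall x z : X, exists w, w <> x /\ w <> z) ->
    (forall a b, open (oint R a b)) ->
  basis (open_intervals R).
Proof.
move=> cX third oR; split=> [_ [a [b [_ ->]]]//|x V xV].
have sep z : x <> z -> exists a b c d, [/\ a <> b, c <> d, R a x b, R c z d &
    forall y, R a y b -> R c y d -> False].
  by move=> xz; have [w [wx wz]] := third x z;
    exact: (oint_separation Rco (w := w)).
suff [a [b [ab axb abV]]] : exists a b, [/\ a <> b, R a x b &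
    forall y, setT y -> R a y b -> V y].
  exists (oint R a b); last by move=> y; exact: abV.
  by split => //; exists a, b.
apply: (compact_ideal (P := fun A => exists a b, [/\ a <> b, R a x b &
    forall y, A y -> R a y b -> V y])) cX _ _ _ _.
- have [w [wx _]] := third x x.
  by have [a [b [_ [_ [ab _ axb _ _]]]]] := sep _ (nesym wx); exists a, b.
- move=> A B [a [b [ab axb abV]]] [c [d [cd cxd cdV]]].
  have [||//|//|W [[e [f [ef ->]]] exf efV]] :=
    @open_intervals_meet _ _ Rco (oint R a b) (oint R c d) x.
  + by exists a, b.
  + by exists c, d.
  exists e, f; split=> // y [Ay|By] /efV[ayb cyd]; [exact: abV|exact: cdV].
- by move=> A B BA [a [b [ab axb abV]]]; exists a, b; split=> // y /BA;
  exact: abV.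
- move=> z _; have [<-|xz] := pselect (x = z).
    exists V => //; have [w [wx _]] := third x x.
    by have [a [b [_ [_ [ab _ axb _ _]]]]] := sep _ (nesym wx); exists a, b.
  have [a [b [c [d [ab cd axb czd abcd]]]]] := sep z xz.
  exists (oint R c d); first by apply: open_nbhs_nbhs; split.
  by exists a, b; split=> // y cyd ayb; case: (abcd y).
Qed.

Lemma oint_hausdorff : (forall x z : X, exists w, w <> x /\ w <> z) ->
  (forall a b, open (oint R a b)) -> hausdorff_space X.
Proof.
move=> third oR x z; apply: contraPP => xz clxz; have [w [wx wz]] := third x z.
have [a [b [c [d [ab cd axb czd abcd]]]]] := oint_separation Rco xz wx wz.
have [||y [ayb cyd]] := clxz (oint R a b) (oint R c d).
- by apply: open_nbhs_nbhs; split.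
- by apply: open_nbhs_nbhs; split.
- exact: (abcd y).
Qed.

End interval_topology.

Lemma order_iso_continuous (X Y : topologicalType) (R : X -> X -> X -> Prop)
    (R' : Y -> Y -> Y -> Prop) (f : X -> Y) (g : Y -> X) :
    circular_order R -> circular_order R' ->
    basis (open_intervals R) -> basis (open_intervals R') ->
    cancel f g -> cancel g f ->
    (forall a b c, R a b c -> R' (f a) (f b) (f c)) ->
  continuous f.
Proof.
move=> Rco R'co bR bR' fK gK fR x V /(basis_oint_nbhs bR')[a [b [ab axb abV]]].
have gR' := co_reflect Rco R'co (can_inj fK) fR.
apply: (@filterS _ _ _ (oint R (g a) (g b))).
  by move=> y /fR; rewrite !gK; exact: abV.
apply: open_nbhs_nbhs; split; first exact: basis_oint_open.
by apply: gR'; rewrite !gK.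
Qed.

(** * Iterates and minimality *)

Section iterates.
Variables (X : topologicalType) (s : homeo X X).

Lemma hfun_inj : injective s.
Proof. exact: can_inj (@hfunK _ _ s). Qed.

Lemma hpowSr n x : hpow s (n + 1) x = s (hpow s n x).
Proof.
case: n => [n|[|n]]; first by rewrite -PoszD addn1.
  by rewrite /= hinvK.
have -> : Negz n.+1 + 1 = Negz n by rewrite !NegzE; lia.
by rewrite /= hinvK.
Qed.

Lemma hpowBr n x : hpow s (n - 1) x = hinv s (hpow s n x).
Proof. by rewrite -{2}(subrK 1 n) hpowSr hfunK. Qed.

Lemma hpowD m n x : hpow s (m + n) x = hpow s m (hpow s n x).
Proof.
elim/int_ind: m => [|m IH|m IH]; first by rewrite add0r.
  by rewrite -addn1 PoszD addrAC !hpowSr IH.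
by rewrite -addn1 PoszD opprD addrAC !hpowBr IH.
Qed.

Lemma hpowK n : cancel (hpow s n) (hpow s (- n)).
Proof. by move=> x; rewrite -hpowD addNr. Qed.

Lemma hpow_continuous n : continuous (hpow s n).
Proof.
elim/int_ind: n => [|n IH|n IH] x; first exact: cvg_id.
- have -> : hpow s n.+1 = s \o hpow s n.
    by apply/funext => y; rewrite -addn1 PoszD hpowSr.
  by apply: continuous_comp; [exact: IH|exact: hfun_continuous].
- have -> : hpow s (- n.+1%:Z) = hinv s \o hpow s (- n%:Z).
    by apply/funext => y; rewrite -addn1 PoszD opprD hpowBr.
  by apply: continuous_comp; [exact: IH|exact: hinv_continuous].
Qed.

Lemma hpow_periodic n x : hpow s n x = x -> forall k, hpow s (k * n) x = x.
Proof.
move=> nx; elim/int_ind => [|k IH|k IH]; first by rewrite mul0r.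
  by rewrite -addn1 PoszD mulrDl mul1r hpowD nx IH.
by rewrite -addn1 PoszD opprD mulrDl mulN1r hpowD -[X in hpow s (- n) X]nx
  hpowK.
Qed.

Lemma minimal_visit : minimal_cascade s -> forall x U, open U -> U !=set0 ->
  exists n, U (hpow s n x).
Proof.
move=> [_ sd] x U oU U0; have [y [Uy [n _ ny]]] := sd x _ U0 oU.
by exists n; rewrite ny.
Qed.

Section aperiodic.
Hypotheses (s_min : minimal_cascade s) (X_inf : infinite_set [set: X])
  (X_h : hausdorff_space X).

(** A finite orbit is closed, so by density it would be the whole space. *)
Lemma minimal_aperiodic n x : hpow s n x = x -> n = 0.
Proof.
move=> nx; apply: contrapT => /eqP n0; apply: X_inf.
pose O := (fun k : nat => hpow s k x) @` `I_(`|n|%N).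
have Ofin : finite_set O by apply: finite_image; exact: finite_II.
have Ocl : closed O.
  by apply: compact_closed => //; exact: finite_compact.
suff -> : [set: X] = O by [].
apply/esym/seteqP; split=> // y _; apply: contrapT => Oy.
have [|k] := minimal_visit s_min x (closed_openC Ocl); first by exists y.
apply; exists `|(k %% n)%Z|%N.
  by rewrite /=; have := ltz_mod k n0; have := modz_ge0 k n0; lia.
rewrite gez0_abs ?modz_ge0//.
have -> : (k %% n)%Z = k + (- (k %/ n)%Z) * n by rewrite {2}(divz_eq k n); ring.
by rewrite hpowD hpow_periodic.
Qed.

Lemma hpow_index_inj x : injective (fun n => hpow s n x).
Proof.
move=> m n /= e; apply/eqP; rewrite -subr_eq0; apply/eqP.
by apply: (@minimal_aperiodic _ x); rewrite addrC hpowD e hpowK.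
Qed.

End aperiodic.
End iterates.

Lemma hpow_equivariant (X Y : topologicalType) (s : homeo X X) (t : homeo Y Y)
  (f : X -> Y) n x :
  equivariant s t f -> f (hpow s n x) = hpow t n (f x).
Proof.
move=> sf; elim/int_ind: n => [//|n IH|n IH].
  by rewrite -addn1 PoszD !hpowSr sf IH.
rewrite -addn1 PoszD opprD !hpowBr -IH; apply: (can_inj (@hfunK _ _ t)).
by rewrite -sf !hinvK.
Qed.

(** * Invariant means *)

Lemma ultra_bounded_cvg (R : realType) (U : set_system nat) (u : nat -> R) :
  UltraFilter U -> (forall n, 0 <= u n <= 1) -> exists l : R, u @ U --> l.
Proof.
move=> UU u01; have cI := @segment_compact R 0 1.
have [|l [_ cl]] := cI (u @ U) _.
  by apply: (@filterS _ U _ setT) => [n _|]; [rewrite /= in_itv /=;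
    exact: u01|exact: filterT].
exists l => V lV; have [//|UV] := in_ultra_setVsetC (u @^-1` V) UU.
by have [y []] := cl (~` V) V UV lV.
Qed.

Section invariant_mean.
Variables (R : realType) (X : topologicalType) (s : homeo X X) (z : X).

Definition visit (A : set X) n : R := (`[< A (hpow s (Posz n) z) >])%:R.

Definition visit_freq (A : set X) N : R :=
  (\sum_(n < N.+1) visit A n) / N.+1%:R.

Lemma visit_ge0 A n : 0 <= visit A n. Proof. exact: ler0n. Qed.

Lemma visit_le1 A n : visit A n <= 1.
Proof. by rewrite /visit; case: asboolP => _ //; rewrite ?lexx ?ler01. Qed.

Lemma visit_freq_itv A N : 0 <= visit_freq A N <= 1.
Proof.
rewrite /visit_freq divr_ge0 ?sumr_ge0//= ?ler_pdivrMr//.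
rewrite mul1r -[leRHS]mulr1n -[X in _ <= 1 *+ X]card_ord -sumr_const.
by apply: ler_sum => n _; exact: visit_le1.
Qed.

(** The mean of A is the limit, along an ultrafilter, of the frequency of the
    visits of one orbit to A.  It is invariant because a shift of time changes
    the number of visits by at most one, and it vanishes on points because they
    are visited at most once. *)
Lemma invariant_mean_exists :
    (forall n, hpow s n z = z -> n = 0) ->
  exists m : set X -> R, [/\ m setT = 1, forall A, 0 <= m A,
    forall A B, A `&` B = set0 -> m (A `|` B) = m A + m B,
    forall A, m (s @^-1` A) = m A & forall x, m [set x] = 0].
Proof.
move=> z_aper.
have [U [UU ooU]] := @ultraFilterLemma nat \oo _.
have UF : ProperFilter U by exact: ultra_proper.
have /choice[m mP] : forall A, exists l : R, visit_freq A @ U --> l.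
  by move=> A; apply: (ultra_bounded_cvg UU) => n; exact: visit_freq_itv.
have mE A (u : nat -> R) l : visit_freq A = u -> u @ U --> l -> m A = l.
  move=> Au ul; apply: (@cvg_unique _ (@norm_hausdorff _ _) (u @ U)) => //.
  by rewrite -Au; exact: mP.
have harm : @harmonic R @ U --> (0 : R).
  exact: cvg_trans (cvg_app _ ooU) cvg_harmonic.
exists m; split.
- apply: (mE _ (fun=> 1)); last exact: cvg_cst.
  apply/funext => N; rewrite /visit_freq (eq_bigr (fun=> 1)); last first.
    by move=> n _; rewrite /visit asboolT.
  by rewrite sumr_const card_ord divff// pnatr_eq0.
- move=> A; apply: (cvgr_to_ge (mP A)).
  by apply: (@filterS _ U _ setT) => [n _ /=|];
    [case/andP: (visit_freq_itv A n)|exact: filterT].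
- move=> A B AB; apply: (mE _ (visit_freq A \+ visit_freq B)).
    apply/funext => N /=; rewrite /visit_freq -mulrDl -big_split /=.
    congr (_ / _); apply: eq_bigr => n _; rewrite /visit -natrD; congr (_%:R).
    case: asboolP => [[An|Bn]|nAB].
    + rewrite asboolT// asboolF// => Bn.
      by have : (A `&` B) (hpow s (Posz n) z) by []; rewrite AB.
    + rewrite asboolF ?asboolT// => An.
      by have : (A `&` B) (hpow s (Posz n) z) by []; rewrite AB.
    + by rewrite !asboolF// => ?; apply: nAB; [right|left].
  by apply: cvgD; exact: mP.
- move=> A; pose v := visit A.
  apply: (mE _ (fun N => visit_freq A N + (v N.+1 - v 0%N) * harmonic N)).
    apply/funext => N; rewrite /visit_freq /= -mulrDl; congr (_ / _).
    have -> : \sum_(n < N.+1) visit (s @^-1` A) n = \sum_(n < N.+1) v n.+1.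
      by apply: eq_bigr => n _; rewrite /v /visit /=.
    rewrite [X in _ = X + _]big_ord_recl big_ord_recr /=.
    rewrite (eq_bigr (fun i : 'I_N => v (bump 0 i))) //.
    by rewrite -/(v 0%N) /=; ring.
  rewrite -[m A]addr0; apply: cvgD; first exact: mP.
  apply: (@squeeze_cvgr _ _ _ _ (fun N => - harmonic N) (@harmonic R)).
  + apply: (@filterS _ U _ setT) => [N _ /=|]; last exact: filterT.
    have := visit_ge0 A N.+1; have := visit_le1 A N.+1.
    have := visit_ge0 A 0; have := visit_le1 A 0; rewrite -/v.
    have : 0 <= (N.+1%:R)^-1 :> R by rewrite invr_ge0.
    rewrite /harmonic /=; move: (_^-1) (v N.+1) (v 0%N) => h a b; nra.
  + by rewrite -oppr0; apply: cvgN.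
  + exact: harm.
- move=> x; apply: (mE _ (visit_freq [set x])) => //.
  apply: (@squeeze_cvgr _ _ _ _ (fun=> 0) (@harmonic R)) => //;
    last exact: cvg_cst.
  apply: (@filterS _ U _ setT) => [N _ /=|]; last exact: filterT.
  have /andP[-> _] := visit_freq_itv [set x] N.
  rewrite /visit_freq ler_piMl ?invr_ge0//.
  have [[n0 n0x]|nx] := pselect (exists n : nat, hpow s (Posz n) z = x).
    have vE (n : 'I_N.+1) : visit [set x] n = (n == n0 :> nat)%:R.
      rewrite /visit; congr (nat_of_bool _)%:R; apply/asboolP/eqP => [nx|->//].
      have {}nx : hpow s (Posz n) z = x by [].
      have : hpow s (Posz n - Posz n0) z = z.
        by rewrite addrC hpowD nx -n0x hpowK.
      by move=> /z_aper; lia.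
    rewrite (eq_bigr _ (fun n _ => vE n)).
    have [n0N|Nn0] := ltnP n0 N.+1.
      rewrite (bigD1 (Ordinal n0N)) //= eqxx big1 ?addr0// => i /eqP in0.
      by case: eqP => // e; case: in0; apply: val_inj.
    rewrite big1// => i _; case: eqP => // e.
    by have := ltn_ord i; rewrite e ltnNge Nn0.
  by rewrite big1// => n _; rewrite /visit asboolF//= => nx'; apply: nx;
    exists n.
Qed.

End invariant_mean.

Section mean_theory.
Variables (R : realType) (X : topologicalType) (s : homeo X X).
Variable m : set X -> R.
Hypotheses (mT : m setT = 1) (m_ge0 : forall A, 0 <= m A).
Hypothesis mU : forall A B, A `&` B = set0 -> m (A `|` B) = m A + m B.
Hypothesis m_inv : forall A, m (s @^-1` A) = m A.
Hypothesis m_pt : forall x, m [set x] = 0.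

Lemma mean0 : m set0 = 0.
Proof. by have := @mU set0 set0 (set0I _); rewrite setU0; lra. Qed.

Lemma mean_le A B : A `<=` B -> m A <= m B.
Proof.
move=> AB; rewrite -[X in _ <= m X](setDUK AB).
by rewrite mU ?setDIK//; have := m_ge0 (B `\` A); lra.
Qed.

Lemma mean_leU A B : m (A `|` B) <= m A + m B.
Proof.
have -> : A `|` B = A `|` (B `\` A).
  apply/seteqP; split=> x [?|]; [by left| |by left|by case; right].
  by have [?|?] := pselect (A x); [left|right].
by rewrite mU ?setDIK//; have := @mean_le (B `\` A) B (@subDsetl _ _ _); lra.
Qed.

Lemma mean_hpow n A : m (hpow s n @^-1` A) = m A.
Proof.
elim/int_ind: n A => [//|n IH|n IH] A.
- by rewrite -[RHS]m_inv -[RHS]IH.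
- rewrite -(IH A) -m_inv; congr m; apply/funext => x; rewrite /preimage /mkset.
  have -> : s x = hpow s 1 x by [].
  by rewrite -hpowD; congr (A (hpow s _ x)); lia.
Qed.

Lemma mean_setU1 x A : ~ A x -> m (x |` A) = m A.
Proof. by move=> Ax; rewrite mU ?m_pt ?add0r// -subset0 => y [->]. Qed.

Hypotheses (X_compact : compact [set: X]) (X_haus : hausdorff_space X).
Hypotheses (s_min : minimal_cascade s) (X_inf : infinite_set [set: X]).

(** Finitely many translates of a nonempty open set cover the space. *)
Lemma mean_open_gt0 U : open U -> U !=set0 -> 0 < m U.
Proof.
move=> oU U0; suff [k] : exists k : nat, m setT <= k%:R * m U.
  rewrite mT => kU; rewrite lt_neqAle m_ge0 andbT; apply/eqP => mU0.
  by move: kU; rewrite -mU0 mulr0 ler10.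
apply: (compact_ideal (P := fun A => exists k : nat,
  m A <= k%:R * m U)) X_compact _ _ _ _.
- by exists 0%N; rewrite mean0 mul0r.
- move=> A B [k kA] [l lB]; exists (k + l)%N.
  by rewrite natrD mulrDl; have := mean_leU A B; lra.
- by move=> A B BA [k kA]; exists k; apply: le_trans kA; exact: mean_le.
- move=> x _; have [n Un] := minimal_visit s_min x oU U0.
  exists (hpow s n @^-1` U); last by exists 1%N; rewrite mean_hpow mul1r.
  apply: open_nbhs_nbhs; split => //.
  by apply: open_comp => // y _; exact: hpow_continuous.
Qed.

Lemma mean_not_isolated (x : X) : ~ open [set x].
Proof.
by move=> /mean_open_gt0 x0; have := x0 (ex_intro _ x erefl); rewrite m_pt ltxx.
Qed.

Lemma nonreturning_nbhs (x : X) k : exists2 U, nbhs x U &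
  forall n y, (0 < n < k)%N -> U y -> ~ U (hpow s (Posz n) y).
Proof.
elim: k => [|k [U xU Uk]].
  by exists setT => [|n y]; [exact: filterT|rewrite ltn0 andbF].
have [->|k0] := eqVneq k 0%N.
  by exists setT => [|n y]; [exact: filterT|lia].
have xk : x != hpow s k x.
  apply/eqP => e; have := minimal_aperiodic s_min X_inf X_haus (esym e); lia.
move: X_haus; rewrite open_hausdorff => /(_ _ _ xk)[[A B] /= [xA kB]
  [oA oB AB]].
move: xA kB; rewrite !inE => xA kB.
exists (U `&` (A `&` hpow s k @^-1` B)).
  apply: filterI => //; apply: filterI; first by apply: open_nbhs_nbhs.
  by apply: hpow_continuous; apply: open_nbhs_nbhs.
move=> n y /andP[n0]; rewrite ltnS leq_eqVlt => /orP[/eqP->|nk].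
  move=> [_ [_ By]] [_ [Ay _]]; have : (A `&` B) (hpow s k y) by [].
  by rewrite (eqP AB).
by move=> [Uy _] [Uny _]; apply: (Uk n y) Uy Uny; rewrite n0.
Qed.

(** A neighbourhood that does not return within k steps has k disjoint
    translates, hence mean at most 1 / k. *)
Lemma mean_nbhs_small (x : X) (e : R) : 0 < e -> exists2 U, nbhs x U & m U < e.
Proof.
move=> e0.
have [k ke] : exists k : nat, 1 < k%:R * e.
  exists (Num.bound (e^-1)); rewrite -ltr_pdivrMr// div1r.
  by apply: archi_boundP; rewrite invr_ge0 ltW.
have [U xU Uk] := nonreturning_nbhs x k; exists U => //.
have mV l : (l <= k)%N -> m [set y | exists2 i,
  (i < l)%N & U (hpow s (Posz i) y)] = l%:R * m U.
  elim: l => [|l IH] lk.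
    rewrite mul0r -mean0; congr m; rewrite -subset0 => y [i].
    by rewrite ltn0.
  rewrite -addn1 natrD mulrDl mul1r -IH ?(ltnW lk)// -(mean_hpow l U) -mU.
    congr m; apply/seteqP; split=> [y [i]|y [[i il Ui]|Ul]].
    - rewrite addn1 ltnS leq_eqVlt => /orP[/eqP->|il] Ui; [by right|left].
      by exists i.
    - by exists i => //; rewrite addn1 ltnS ltnW.
    - by exists l; rewrite ?addn1.
  rewrite -subset0 => y [[i il Ui] Ul]; apply: (Uk (l - i)%N _ _ Ui);
    first by lia.
  rewrite -hpowD; suff -> : Posz (l - i) + Posz i = Posz l by [].
  by rewrite -PoszD subnK// ltnW.
have := m_ge0 ([set y | exists2 i, (i < k)%N & U (hpow s (Posz i) y)]).
have := @mean_le [set y | exists2 i,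
  (i < k)%N & U (hpow s (Posz i) y)] setT (@subsetT _ _).
rewrite mT mV// => kU _; have k0 : 0 < k%:R :> R by nra.
by rewrite -(ltr_pM2l k0); exact: le_lt_trans ke.
Qed.

End mean_theory.

(** * The circle *)

Lemma infinite_set_inj (T U : Type) (f : T -> U) :
  injective f -> infinite_set [set: T] -> infinite_set [set: U].
Proof.
move=> fI Tinf Ufin; apply: Tinf.
rewrite -(preimage_setT f); apply: finite_preimage => // x y _ _; exact: fI.
Qed.

Section circle_theory.
Variable R : realType.
Local Open Scope quotient_scope.

Definition circle_pi (x : R) : circle R := \pi_(circle R) x.

Lemma circle_pi_eq x y : circle_pi x = circle_pi y <-> x - y \is a Num.int.
Proof. by split=> [/eqmodP|h]; [|apply/eqmodP]. Qed.

Lemma circle_piDz x (k : int) : circle_pi (x + k%:~R) = circle_pi x.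
Proof. by apply/circle_pi_eq; rewrite addrC addKr intr_int. Qed.

Lemma circle_pi_continuous : continuous circle_pi.
Proof. exact: pi_continuous. Qed.

Lemma circle_pi_lift t x : exists2 y, circle_pi y = t & x <= y < x + 1.
Proof.
pose r := repr t; exists (r - (Num.floor (r - x))%:~R).
  by rewrite -rmorphN circle_piDz; exact: (@reprK _ (circle R)).
have := floor_le_tmp (r - x); have := floorD1_gt (r - x).
by rewrite intrD => ? ?; apply/andP; split; lra.
Qed.

Lemma circle_pi_inj x y : circle_pi x = circle_pi y -> `|x - y| < 1 -> x = y.
Proof.
move=> /circle_pi_eq/intrP[k kE]; rewrite kE -intr_norm ltrz1 => k1.
have k0 : k = 0 by lia.
by move: kE; rewrite k0 => /subr0_eq.
Qed.

Lemma circle_pi_coord t : circle_pi (circle_coord t) = t.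
Proof.
by apply: circle_coord_inj; rewrite circle_coord_pi// circle_coord_itv.
Qed.

Lemma rotation_pi a x : rotation a (circle_pi x) = circle_pi (x + a).
Proof. exact: rotation_fun_pi. Qed.

Lemma hpow_rotation_pi a n x :
  hpow (rotation a) n (circle_pi x) = circle_pi (x + a *~ n).
Proof.
elim/int_ind: n => [|n IH|n IH]; first by rewrite mulr0z addr0.
- by rewrite -addn1 PoszD hpowSr IH rotation_pi mulrzDr mulr1z addrA.
- rewrite -addn1 PoszD opprD hpowBr IH.
  by rewrite [LHS]rotation_fun_pi mulrzDr mulrN1z addrA.
Qed.

Lemma circle_pi_open U : open U -> open (circle_pi @` U).
Proof.
move=> oU; change (open (circle_pi @^-1` (circle_pi @` U))).
have -> : circle_pi @^-1` (circle_pi @` U) =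
    \bigcup_(k : int) (fun x => x + k%:~R) @^-1` U.
  apply/seteqP; split=> x /=.
    move=> [y Uy /circle_pi_eq/intrP[k ky]]; exists k => //=.
    by rewrite -ky subrKC.
  by move=> [k _ Uk]; exists (x + k%:~R) => //; rewrite circle_piDz.
apply: bigcup_open => k _; apply: open_comp => // x _.
by apply: cvgD; [exact: cvg_id|exact: cvg_cst].
Qed.

Lemma circle_order_co : circular_order (@circle_order R).
Proof.
have -> : @circle_order R = cyclic_of (@circle_lt R).
  apply/funext => p; apply/funext => q; apply/funext => r.
  by apply/propext; exact: circle_orderE.
apply: cyclic_of_circular.
- by move=> x; rewrite /circle_lt ltxx.
- by move=> y x z; exact: lt_trans.
- move=> x y xy; rewrite /circle_lt.
  by case: (ltgtP (circle_coord x) (circle_coord y)) =>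
    [|?|/circle_coord_inj//]; [left|right].
Qed.

Lemma circle_order_pi x y z : x < y -> y < z -> z < x + 1 ->
  circle_order (circle_pi x) (circle_pi y) (circle_pi z).
Proof.
move=> xy yz zx.
have xE w : circle_pi w = rotation_fun x (circle_pi (w - x)).
  by rewrite -[RHS]/(rotation x _) rotation_pi subrK.
rewrite (xE x) (xE y) (xE z); apply: rotation_order; apply/circle_orderE.
apply: Or31; rewrite /circle_lt !circle_coord_pi; first by split; lra.
all: by apply/andP; split; lra.
Qed.

Lemma circle_order_lift x t u : circle_order (circle_pi x) t u ->
  exists y z, [/\ t = circle_pi y, u = circle_pi z, x < y, y < z & z < x + 1].
Proof.
have [y <- /andP[xy yx]] := circle_pi_lift t x.
have [z <- /andP[xz zx]] := circle_pi_lift u x => xyz.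
have [nxy nyz nxz] := circular_order_neq circle_order_co xyz.
have {}xy : x < y by rewrite lt_neqAle xy andbT; apply/eqP => e;
  rewrite e in nxy.
have {}xz : x < z by rewrite lt_neqAle xz andbT; apply/eqP => e;
  rewrite e in nxz.
exists y, z; split=> //; rewrite ltNge le_eqVlt; apply/negP => /orP[/eqP e|zy].
  by rewrite e in nyz.
exact: (co_asym circle_order_co xyz (circle_order_pi xz zy yx)).
Qed.

Lemma circle_arcE x y : x < y -> y < x + 1 ->
  oint (@circle_order R) (circle_pi x) (circle_pi y) = circle_pi @` `]x, y[.
Proof.
move=> xy yx; apply/seteqP; split=> [t|_ [u /= + <-]]; last first.
  by rewrite in_itv /= => /andP[xu uy]; exact: circle_order_pi.
move=> /circle_order_lift[u [z [-> yz xu uz zx]]].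
have <- : z = y.
  by apply: circle_pi_inj => //; rewrite ltr_norml; apply/andP; split; lra.
by exists u => //=; rewrite in_itv /= xu uz.
Qed.

Lemma circle_arc_lift a b : a <> b -> exists x y, [/\ a = circle_pi x,
  b = circle_pi y, x < y & y < x + 1].
Proof.
move=> ab; exists (circle_coord a).
have [y yb /andP[xy yx]] := circle_pi_lift b (circle_coord a).
exists y; rewrite yb circle_pi_coord; split=> //.
rewrite lt_neqAle xy andbT; apply/eqP => e; apply: ab.
by rewrite -yb -e circle_pi_coord.
Qed.

Lemma circle_oint_open a b : open (oint (@circle_order R) a b).
Proof.
have [->|/circle_arc_lift[x [y [-> -> xy yx]]]] := pselect (a = b).
  have -> : oint (@circle_order R) b b = set0.
    by rewrite -subset0 => x; exact: (oint_diag circle_order_co).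
  exact: open0.
by rewrite circle_arcE//; apply: circle_pi_open; exact: interval_open.
Qed.

Lemma circle_oint_connected a b : connected (oint (@circle_order R) a b).
Proof.
have [->|/circle_arc_lift[x [y [-> -> xy yx]]]] := pselect (a = b).
  have -> : oint (@circle_order R) b b = set0.
    by rewrite -subset0 => x; exact: (oint_diag circle_order_co).
  exact: connected0.
rewrite circle_arcE//; apply: connected_continuous_connected.
  by apply/connected_intervalP; exact: interval_is_interval.
by apply: continuous_subspaceT; exact: circle_pi_continuous.
Qed.

Lemma circle_oint_neq0 a b : a <> b -> oint (@circle_order R) a b !=set0.
Proof.
move=> /circle_arc_lift[x [y [-> -> xy yx]]].
by exists (circle_pi ((x + y) / 2)); apply: circle_order_pi => //; lra.
Qed.

Lemma circle_third (s t : circle R) : exists u, u <> s /\ u <> t.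
Proof.
have [->|st] := pselect (s = t).
  exists (circle_pi (circle_coord t + 2^-1)); split;
    rewrite -{2}[t]circle_pi_coord.
    by move=> /circle_pi_inj h;
      have := h ltac:(rewrite addrC addKr ger0_norm//; lra); lra.
  by move=> /circle_pi_inj h; have := h ltac:(rewrite addrC addKr ger0_norm//;
    lra); lra.
have [u /(circular_order_neq circle_order_co)[su ut _]] := circle_oint_neq0 st.
by exists u; split; [exact: nesym|].
Qed.

Lemma circle_compact : compact [set: circle R].
Proof.
have -> : [set: circle R] = circle_pi @` `[0, 1].
  apply/seteqP; split=> // t _; exists (circle_coord t);
    last exact: circle_pi_coord.
  by have /andP[t0 t1] := circle_coord_itv t; rewrite /= in_itv /= t0 ltW.
apply: continuous_compact; last exact: segment_compact.
by apply: continuous_subspaceT; exact: circle_pi_continuous.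
Qed.

Lemma circle_basis : basis (open_intervals (@circle_order R)).
Proof.
apply: (compact_oint_basis circle_order_co circle_compact circle_third).
exact: circle_oint_open.
Qed.

Lemma circle_hausdorff : hausdorff_space (circle R).
Proof.
exact: (oint_hausdorff circle_order_co circle_third circle_oint_open).
Qed.

Lemma circle_infinite : infinite_set [set: circle R].
Proof.
apply: (@infinite_set_inj _ _ (fun n : nat => circle_pi (n.+1%:R^-1)));
  last first.
  exact: infinite_nat.
move=> m n /circle_pi_inj h; apply/eqP; rewrite -eqSS -(eqr_nat R).
apply/eqP/invr_inj/h.
have m1 : 0 < (m.+1%:R : R)^-1 <= 1
  by rewrite invr_gt0 ltr0n invf_le1 ?ler1n ?ltr0n.
have n1 : 0 < (n.+1%:R : R)^-1 <= 1
  by rewrite invr_gt0 ltr0n invf_le1 ?ler1n ?ltr0n.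
rewrite ltr_norml; move: (_^-1) (_^-1) m1 n1 => a b /andP[? ?] /andP[? ?].
by apply/andP; split; lra.
Qed.

Lemma circle_second_countable : @second_countable (circle R).
Proof.
pose B (q : rat * rat) : set (circle R) := circle_pi @` `]ratr q.1, ratr q.2[.
exists (range B).
  by apply: sub_countable (card_image_le _ _) _; exact: countableP.
split=> [_ [q _ <-]|t V].
  by apply: circle_pi_open; exact: interval_open.
rewrite -[t in nbhs t]circle_pi_coord => /circle_pi_continuous.
move=> /nbhs_ballP[e /= e0 eV]; pose x := circle_coord t.
have [p] := @rat_in_itvoo R (x - e) x ltac:(lra).
have [q] := @rat_in_itvoo R x (x + e) ltac:(lra).
rewrite !in_itv /= => /andP[xq qx] /andP[px xp].
exists (B (p, q)); first split; first by exists (p, q).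
- by exists x; [rewrite /= in_itv /= xp xq|exact: circle_pi_coord].
- move=> _ [y + <-]; rewrite /= in_itv /= => /andP[py yq]; apply: eV.
  by rewrite -ball_normE /= -/x ltr_norml; apply/andP; split; lra.
Qed.

(** ** Homeomorphisms preserve or reverse the orientation *)

(** A triple remains ordered as long as its lifts move by less than half of
    the smallest gap between them. *)
Lemma circle_order_near (T : topologicalType) (f g h : T -> circle R) x :
    {for x, continuous f} -> {for x, continuous g} -> {for x, continuous h} ->
    circle_order (f x) (g x) (h x) ->
  \forall y \near x, circle_order (f y) (g y) (h y).
Proof.
move=> cf cg ch; rewrite -[f x]circle_pi_coord.
move=> /circle_order_lift[v [w [gv hw uv vw wu]]];
  set u := circle_coord _ in uv wu.
pose e := Num.min (Num.min (v - u) (w - v)) (u + 1 - w) / 2.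
have [e1 e2 e3] : [/\ 2 * e <= v - u, 2 * e <= w - v & 2 * e <= u + 1 - w].
  by rewrite /e mulrC divfK// !ge_min !lexx !orbT.
have e0 : 0 < e by rewrite divr_gt0// !lt_min; apply/andP; split; [apply/andP;
  split|]; lra.
have near_ball (k : T -> circle R) r : {for x,
  continuous k} -> k x = circle_pi r ->
    nbhs x [set y | exists2 r', k y = circle_pi r' & `|r' - r| < e].
  move=> ck kr; apply: (@filterS _ _ _ (k @^-1` (circle_pi @` ball r e))).
    move=> y [r' br r'y]; exists r'; first exact: esym.
    by move: br; rewrite -ball_normE /= distrC.
  apply: ck; rewrite kr; apply: open_nbhs_nbhs; split.
    by apply: circle_pi_open; exact: ball_open.
  by exists r => //; exact: ballxx.
have Nf := near_ball f u cf (esym (circle_pi_coord _)).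
have Ng := near_ball g v cg gv; have Nh := near_ball h w ch hw.
apply: filterS3 Nf Ng Nh => y [u' -> uu'] [v' -> vv'] [w' -> ww'].
move: uu' vv' ww'; rewrite !ltr_norml => /andP[? ?] /andP[? ?] /andP[? ?].
by apply: circle_order_pi; lra.
Qed.

(** Two positively ordered triples of the circle have lifts that are joined by a
    segment of lifts of positively ordered triples; along its image the
    orientation is locally constant. *)
Lemma circle_homeo_orientation (f : homeo (circle R) (circle R)) :
  (forall a b c, circle_order a b c -> circle_order (f a) (f b) (f c)) \/
  (forall a b c, circle_order a b c -> circle_order (f a) (f c) (f b)).
Proof.
suff same a b c a' b' c' : circle_order a b c -> circle_order a' b' c' ->
    circle_order (f a) (f b) (f c) -> circle_order (f a') (f b') (f c').
  have [[a [b [c [abc fabc]]]]|none] := pselect (exists a b c,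
      circle_order a b c /\ circle_order (f a) (f b) (f c)).
    by left=> a' b' c' abc'; exact: (same a b c).
  right=> a b c abc; have [ab bc ac] := circular_order_neq circle_order_co abc.
  have fI := @hfun_inj _ f.
  have [] // := @co_total _ _ circle_order_co (f a) (f b) (f c).
  - by move=> /fI.
  - by move=> /fI.
  - by move=> /fI.
  - by move=> fabc; case: none; exists a, b, c.
rewrite -[a]circle_pi_coord -[a']circle_pi_coord.
set x := circle_coord a; set x' := circle_coord a'.
move=> /circle_order_lift[y [z [-> -> xy yz zx]]].
move=> /circle_order_lift[y' [z' [-> -> xy' yz' zx']]] fxyz.
pose l (p q r : R) := circle_pi (p + r * (q - p)).
have lC p q : continuous (f \o l p q).
  move=> r; apply: continuous_comp; last exact: hfun_continuous.
  apply: continuous_comp; last exact: circle_pi_continuous.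
  apply: cvgD; first exact: cvg_cst.
  by apply: cvgM; [exact: cvg_id|exact: cvg_cst].
pose G := [set r | circle_order (f (l x x' r)) (f (l y y' r)) (f (l z z' r))].
pose G' := [set r | circle_order (f (l x x' r)) (f (l z z' r)) (f (l y y' r))].
have oG : open G.
  by rewrite openE => r; apply: (circle_order_near (f := f \o l x x')
    (g := f \o l y y') (h := f \o l z z')); exact: lC.
have oG' : open G'.
  by rewrite openE => r; apply: (circle_order_near (f := f \o l x x')
    (g := f \o l z z') (h := f \o l y y')); exact: lC.
have l0 p q : l p q 0 = circle_pi p by rewrite /l mul0r addr0.
have l1 p q : l p q 1 = circle_pi q by rewrite /l mul1r subrKC.
have GG' r : r \in `[0, 1] -> ~ G' r -> G r.
  rewrite in_itv /= => /andP[r0 r1] nG'.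
  have lxyz : circle_order (l x x' r) (l y y' r) (l z z' r).
    have segment_lt p q p' q' : p < q -> p' < q' ->
        p + r * (p' - p) < q + r * (q' - q).
      move=> pq pq'; rewrite -subr_gt0.
      have -> : q + r * (q' - q) - (p + r * (p' - p)) =
        (1 - r) * (q - p) + r * (q' - p') by ring.
      have [->|r_neq0] := eqVneq r 0; first by lra.
      apply: ltr_wpDl; first by apply: mulr_ge0; lra.
      by apply: mulr_gt0; [rewrite lt_neqAle eq_sym r_neq0|lra].
    apply: circle_order_pi; [exact: segment_lt|exact: segment_lt|].
    have := segment_lt z (x + 1) z' (x' + 1) zx zx'; rewrite /= => h.
    by apply: lt_le_trans h _; rewrite -subr_ge0 le_eqVlt; apply/orP; left;
      apply/eqP; ring.
  have [ab bc ac] := circular_order_neq circle_order_co lxyz.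
  have fI := @hfun_inj _ f.
  by have [] // := @co_total _ _ circle_order_co
    (f (l x x' r)) (f (l y y' r)) (f (l z z' r)) => /fI.
have GE : `[0, 1]%classic `&` G = `[0, 1]%classic.
  apply: (@segment_connected R 0 1).
  - exists 0; split; first by rewrite /= in_itv /= lexx ler01.
    by rewrite /G /= !l0.
  - by exists G.
  - exists (~` G'); first exact: open_closedC.
    apply/seteqP; split=> r [r01] Gr; split=> //; last exact: GG'.
    exact: (co_asym circle_order_co Gr).
have : (`[0, 1]%classic `&` G) 1 by rewrite GE /= in_itv /= lexx ler01.
by case=> _; rewrite /G /= !l1.
Qed.

End circle_theory.

(** * Circularly ordered minimal cascades *)

Lemma infinite_third (T : Type) : infinite_set [set: T] ->
  forall x z : T, exists w, w <> x /\ w <> z.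
Proof.
move=> Tinf x z; apply: contrapT => none; apply: Tinf.
apply: (@sub_finite_set _ _ ([set x] `|` [set z])); last by rewrite finite_setU.
move=> w _; have [->|wx] := pselect (w = x); first by left.
by have [->|wz] := pselect (w = z); [right|case: none; exists w].
Qed.

Definition adjacent (T : Type) (O : T -> T -> T -> Prop) x y :=
  x <> y /\ forall u, ~ O x u y.

Section ordered_minimal.
Variables (R : realType) (X : topologicalType) (s : homeo X X).
Variable O : X -> X -> X -> Prop.
Hypotheses (Oco : circular_order O) (O_basis : basis (open_intervals O)).
Hypotheses (X_compact : compact [set: X]) (X_haus : hausdorff_space X).
Hypotheses (s_min : minimal_cascade s) (X_inf : infinite_set [set: X]).

Variable m : set X -> R.
Hypotheses (mT : m setT = 1) (m_ge0 : forall A, 0 <= m A).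
Hypothesis mU : forall A B, A `&` B = set0 -> m (A `|` B) = m A + m B.
Hypothesis m_inv : forall A, m (s @^-1` A) = m A.
Hypothesis m_pt : forall x, m [set x] = 0.

Definition arc_mean x y := m (oint O x y).
Local Notation d := arc_mean.

Lemma arc_mean_diag x : d x x = 0.
Proof.
rewrite -(mean0 mU); congr m; rewrite -subset0 => y.
exact: (oint_diag Oco).
Qed.

Lemma arc_mean_ge0 x y : 0 <= d x y. Proof. exact: m_ge0. Qed.

Lemma arc_mean_le1 x y : d x y <= 1.
Proof. by rewrite -mT; apply: (mean_le m_ge0 mU); exact: subsetT. Qed.

Lemma arc_meanD x y z : O x y z -> d x z = d x y + d y z.
Proof.
move=> xyz; rewrite /d.
have -> : oint O x z = oint O x y `|` (y |` oint O y z).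
  apply/seteqP; split=> u; rewrite /oint /=.
    by move=> /(oint_split Oco u xyz)[|->|]; [left|right; left|right; right].
  by move=> h; apply/(oint_split Oco u xyz); case: h => [|[|]];
    [apply: Or31|apply: Or32|apply: Or33].
rewrite mU; last first.
  rewrite -subset0 => u [xuy [uy|yuz]].
    by move: xuy; rewrite uy => /(circular_order_neq Oco)[].
  by have [_ /(co_asym Oco)] := co_right Oco xyz yuz.
by congr (_ + _); apply: mean_setU1 => //;
  rewrite /oint /= => /(circular_order_neq Oco)[].
Qed.

Lemma arc_meanC x y : x <> y -> d x y + d y x = 1.
Proof.
move=> xy; rewrite -mT.
have -> : setT = x |` (y |` (oint O x y `|` oint O y x)).
  apply/esym/seteqP; split=> // u _.
  by case: (co_cases Oco u xy) => h; [left|right; left|right; right;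
    left|right; right; right].
rewrite (mean_setU1 mU m_pt) ?(mean_setU1 mU m_pt) ?mU//.
- by rewrite -subset0 => u [/(co_excl Oco)].
- by move=> [/(circular_order_neq Oco)[]|/(circular_order_neq Oco)[]].
- by move=> [//|[/(circular_order_neq Oco)[]|/(circular_order_neq Oco)[]]].
Qed.

(** The arcs from x to y, from y to z and from z back to x together cover the
    circle a whole number of times. *)
Lemma arc_mean_cocycle x y z : d x y + d y z - d x z \is a Num.int.
Proof.
have [->|xy] := pselect (x = y); first by rewrite arc_mean_diag add0r subrr.
have [->|yz] := pselect (y = z); first by rewrite arc_mean_diag addr0 subrr.
have [->|xz] := pselect (x = z).
  by rewrite arc_mean_diag subr0 addrC arc_meanC// => e; apply: yz.
case: (co_total Oco xy yz xz) => /arc_meanD ->; first by rewrite subrr.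
have -> : d x z + d z y + d y z - d x z = d z y + d y z by ring.
by rewrite arc_meanC// => e; apply: yz.
Qed.

Lemma arc_mean_gt0 x u y : O x u y -> 0 < d x y.
Proof.
move=> xuy; apply: (mean_open_gt0 mT m_ge0 mU m_inv X_compact s_min).
  exact: basis_oint_open.
by exists u.
Qed.

Lemma adjacent_mean x y : adjacent O x y -> d x y = 0.
Proof.
move=> [_ xy]; rewrite -(mean0 mU); congr m.
by rewrite -subset0 => u /xy.
Qed.

Lemma mean_adjacent x y : x <> y -> d x y = 0 -> adjacent O x y.
Proof. by move=> xy d0; split=> // u /arc_mean_gt0; rewrite d0 ltxx. Qed.

(** The middle one of three consecutive points would be isolated, but nonempty
    open sets have positive mean and points have mean zero. *)
Lemma mean_adjacent_chain x y z : adjacent O x y -> adjacent O y z -> False.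
Proof.
move=> [xy xy0] [yz yz0]; have [xz|xz] := pselect (x = z).
  have [w [wx wy]] := infinite_third X_inf x y.
  by case: (co_cases Oco w xy) => // [/xy0//|]; rewrite xz => /yz0.
case: (co_total Oco xy yz xz) => [xyz|/xy0//].
apply: (@mean_not_isolated R X s m mT m_ge0 mU m_inv m_pt X_compact s_min y).
have <- : oint O x z = [set y].
  apply/seteqP; split=> u; rewrite /oint /=; last by move->.
  by move=> /(oint_split Oco u xyz)[/xy0|->|/yz0].
exact: basis_oint_open.
Qed.

Variable x0 : X.

(** The semiconjugacy of Poincare: a point is sent to the mean of the arc that
    leads to it, modulo 1. *)
Definition arc_coord x : circle R := circle_pi (d x0 x).
Local Notation nu := arc_coord.

Lemma arc_coordE x y : nu y = circle_pi (d x0 x + d x y).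
Proof.
by apply/circle_pi_eq; rewrite -opprB rpredN; exact: arc_mean_cocycle.
Qed.

Lemma arc_coord_eq x y : nu x = nu y -> x <> y ->
  adjacent O x y \/ adjacent O y x.
Proof.
move=> nuxy xy; have : d x y \is a Num.int.
  move: nuxy; rewrite (arc_coordE x y) => /circle_pi_eq.
  by rewrite opprD addNKr rpredN.
move=> /intrP[k kE].
have := arc_mean_ge0 x y; have := arc_mean_le1 x y; rewrite kE.
rewrite ler0z lerz1 => k1 k0.
have [k_eq|k_eq] : k = 0 \/ k = 1 by lia.
  by left; apply: mean_adjacent => //; rewrite kE k_eq.
right; apply: mean_adjacent; first exact: nesym.
by have := arc_meanC xy; rewrite kE k_eq; lra.
Qed.

Lemma adjacent_coord x y : adjacent O x y -> nu x = nu y.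
Proof. by move=> /adjacent_mean xy; rewrite (arc_coordE x y) xy addr0. Qed.

Lemma arc_coord_fiber x y z : nu x = nu y -> nu y = nu z ->
  [\/ x = y, y = z | x = z].
Proof.
move=> nuxy nuyz; have nuxz := etrans nuxy nuyz.
have [?|xy] := pselect (x = y); first exact: Or31.
have [?|yz] := pselect (y = z); first exact: Or32.
have [?|xz] := pselect (x = z); first exact: Or33.
exfalso; have [a|a] := arc_coord_eq nuxy xy; have [b|b] := arc_coord_eq nuyz yz;
  have [c|c] := arc_coord_eq nuxz xz;
  by [exact: mean_adjacent_chain a b|exact: mean_adjacent_chain b a|
      exact: mean_adjacent_chain a c|exact: mean_adjacent_chain c a|
      exact: mean_adjacent_chain b c|exact: mean_adjacent_chain c b].
Qed.

(** Otherwise x, its n-th and its 2n-th iterate would lie in the same fibre, but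
    fibres have at most two points and no point is periodic. *)
Lemma arc_coord_no_return n : n <> 0 ->
  ~ forall x, nu (hpow s n x) = nu x.
Proof.
move=> n0 nun; pose x := x0.
have aper k : hpow s k x = x ->
  k = 0 := @minimal_aperiodic _ _ s_min X_inf X_haus k x.
have [e|e|e] := arc_coord_fiber (esym (nun x)) (esym (nun (hpow s n x))).
- exact/n0/aper.
- by apply/n0/aper; apply: (can_inj (hpowK s n)); rewrite -e.
- by have := @aper (n + n); rewrite hpowD -e => /(_ erefl); lia.
Qed.

(** Reversing the orientation turns the means of arcs around, so that the second
    iterate would preserve the rotation coordinate. *)
Lemma mean_not_reversing :
  ~ forall a b c, O a b c -> O (s a) (s c) (s b).
Proof.
move=> srev.
have srev' a b c : O (s a) (s c) (s b) -> O a b c.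
  move=> sacb; have [ac cb ab] := circular_order_neq Oco sacb.
  have [] // := @co_total _ _ Oco a b c.
  - by move=> e; apply: ab; rewrite e.
  - by move=> e; apply: cb; rewrite e.
  - by move=> e; apply: ac; rewrite e.
  - by move=> /srev /(co_asym Oco); case.
have ds x y : d (s x) (s y) = d y x.
  rewrite /d -m_inv; congr m; apply/seteqP; split=> u; rewrite /oint /=.
    by move=> /srev' /(co_cycle Oco).
  by move=> /(co_cycle Oco)/srev/(co_rot Oco).
apply: (@arc_coord_no_return 2) => // x.
rewrite (arc_coordE x) -[hpow s 2 x]/(s (s x)); apply/circle_pi_eq.
rewrite addrAC subrr add0r; have [sx|sx] := pselect (x = s x).
  by rewrite -sx -sx arc_mean_diag.
have := arc_mean_cocycle x (s x) (s (s x)); rewrite ds arc_meanC//.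
by move=> /(rpredB (intr_int R 1)); rewrite opprB addrCA subrr addr0.
Qed.

Section preserving.
Hypothesis s_pres : forall a b c, O a b c -> O (s a) (s b) (s c).

Lemma preservingV a b c : O (s a) (s b) (s c) -> O a b c.
Proof. exact: (co_reflect Oco Oco (@hfun_inj _ s) s_pres). Qed.

Lemma arc_mean_shift x y : d (s x) (s y) = d x y.
Proof.
rewrite /d -m_inv; congr m; apply/seteqP; split=> u; rewrite /oint /=.
  exact: preservingV.
exact: s_pres.
Qed.

Definition rotation_angle := d x0 (s x0).
Local Notation alpha := rotation_angle.

Lemma arc_coord_equivariant : equivariant s (rotation alpha) nu.
Proof.
move=> x; rewrite (arc_coordE (s x0)) -/alpha arc_mean_shift rotation_pi.
by rewrite addrC.
Qed.

Lemma arc_coord_hpow n : nu (hpow s n x0) = circle_pi (alpha *~ n).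
Proof.
rewrite (hpow_equivariant _ _ arc_coord_equivariant) hpow_rotation_pi.
by rewrite arc_mean_diag add0r.
Qed.

Lemma rotation_angle_not_int n : n <> 0 -> alpha *~ n \is a Num.int -> False.
Proof.
move=> n0 an; apply: (arc_coord_no_return n0) => x.
rewrite (hpow_equivariant _ _ arc_coord_equivariant) hpow_rotation_pi.
by apply/circle_pi_eq; rewrite addrC addKr.
Qed.

Lemma rotation_angle_irrational : irrational alpha.
Proof.
move=> [q _ qa]; apply: (@rotation_angle_not_int (denq q)).
  by move=> e; have := denq_gt0 q; rewrite e ltxx.
rewrite -qa -mulrzr /ratr divfK ?intr_int// intr_eq0 gt_eqF//.
Qed.

Lemma arc_coord_continuous : continuous nu.
Proof.
move=> x V /circle_pi_continuous/nbhs_ballP[e /= e0 eV].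
have [U xU mUe] := mean_nbhs_small mT m_ge0 mU m_inv X_haus s_min X_inf x e0.
have [a [b [ab axb abU]]] := basis_oint_nbhs O_basis xU.
apply: (@filterS _ _ _ (oint O a b)); last first.
  by apply: open_nbhs_nbhs; split; [exact: basis_oint_open|].
have sub y z : oint O y z `<=` oint O a b -> d y z < e.
  move=> yz; apply: le_lt_trans mUe; apply: (mean_le m_ge0 mU) => u /yz.
  exact: abU.
move=> y; rewrite /oint /= => /(oint_split Oco y axb)[ayx|->|xyb].
- have yxe : d y x < e.
    apply: sub => u yux; apply/(oint_split Oco _ axb); apply: Or31.
    exact: (co_right Oco ayx yux).1.
  have -> : nu y = circle_pi (d x0 x - d y x).
    apply/circle_pi_eq; have := arc_mean_cocycle x0 y x.
    by congr (_ \is a Num.int); ring.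
  apply: eV; rewrite -ball_normE /= opprB addrC subrK ger0_norm//.
  exact: arc_mean_ge0.
- by apply: eV; exact: ballxx.
- have xye : d x y < e.
    apply: sub => u xuy; apply/(oint_split Oco _ axb); apply: Or33.
    exact: (co_left Oco xuy xyb).1.
  rewrite (arc_coordE x); apply: eV; rewrite -ball_normE /= opprD addNKr.
  by rewrite normrN ger0_norm//; exact: arc_mean_ge0.
Qed.

(** The image is compact and contains the orbit of 0 under an infinite group of
    rotations; a return of the base point close to itself yields an arbitrarily
    small rotation in this group. *)
Lemma arc_coord_surj t : exists x, nu x = t.
Proof.
apply: contrapT => tK; pose K := range nu.
have Kcl : closed K.
  apply: compact_closed; first exact: circle_hausdorff.
  apply: continuous_compact => //.
  by apply: continuous_subspaceT; exact: arc_coord_continuous.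
have [r rt _] := circle_pi_lift t 0.
have : nbhs t (~` K).
  by apply: open_nbhs_nbhs; split; [exact: closed_openC|move=> [x _ xt];
    apply: tK; exists x].
rewrite -rt => /circle_pi_continuous/nbhs_ballP[e /= e0 eK].
suff [n [b [b0 be nb]]] : exists n b, [/\ 0 < b,
  b < e & alpha *~ n - b \is a Num.int].
  (* the multiples of b come within b of r *)
  pose k := Num.floor (r / b).
  apply: (eK (b *~ k)).
    have := floor_le_tmp (r / b); have := floorD1_gt (r / b); rewrite -/k intrD.
    rewrite ler_pdivlMr// ltr_pdivrMr// mulrDl mul1r => h1 h2.
    rewrite -ball_normE /= -mulrzl ltr_norml; apply/andP; split; lra.
  exists (hpow s (n * k) x0) => //; rewrite arc_coord_hpow; apply/circle_pi_eq.
  by rewrite mulrzA -mulrzBl rpredMz.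
suff [n [b [b0 be nb]]] : exists n b, [/\ b != 0,
  `|b| < e & alpha *~ n - b \is a Num.int].
  (* if the return goes backwards, use the inverse iterate *)
  have [b_pos|b_neg] := ltP 0 b.
    by exists n, b; split=> //; rewrite -(gtr0_norm b_pos).
  have {}b_neg : b < 0 by rewrite lt_neqAle b0.
  exists (- n), (- b); split;
    [by rewrite oppr_gt0|by rewrite -(ltr0_norm b_neg)|].
  by rewrite mulrNz -opprD rpredN.
have [U xU mUe] := mean_nbhs_small mT m_ge0 mU m_inv X_haus s_min X_inf x0 e0.
have [a [b [ab axb abU]]] := basis_oint_nbhs O_basis xU.
have oW : open (oint O a b `\ x0).
  rewrite setDE; apply: openI; first exact: basis_oint_open.
  apply: closed_openC;
    exact: (accessible_closed_set1 (hausdorff_accessible X_haus)).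
have [|n [abn nx]] := minimal_visit s_min x0 oW.
  apply: contrapT => /set0P/negP; rewrite negbK => /eqP W0.
  apply: (@mean_not_isolated R X s m mT m_ge0 mU m_inv m_pt X_compact s_min x0).
  have <- : oint O a b = [set x0].
    apply/seteqP; split=> u; rewrite /=; last by move->.
    move=> abu; apply: contrapT => ux.
    by have : (oint O a b `\ x0) u by []; rewrite W0.
  exact: basis_oint_open.
have n0 : n <> 0 by move=> e1; apply: nx; rewrite /= e1.
pose y := hpow s n x0.
have ny : alpha *~ n - d x0 y \is a Num.int.
  by apply/circle_pi_eq; rewrite -arc_coord_hpow.
have small v w : oint O v w `<=` oint O a b -> d v w < e.
  move=> vw; apply: le_lt_trans mUe; apply: (mean_le m_ge0 mU) => u /vw.
  exact: abU.
have nb0 b' : alpha *~ n - b' \is a Num.int -> b' != 0.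
  by move=> nb'; apply/eqP => e1; apply: (rotation_angle_not_int n0);
    rewrite -[alpha *~ n]subr0 -e1.
have [ayx|e1|xyb] := (oint_split Oco y axb).1 abn; last 2 first.
- by case: nx.
- exists n, (d x0 y); split=> //; first exact: nb0.
  rewrite ger0_norm ?arc_mean_ge0//; apply: small => u xuy.
  apply/(oint_split Oco _ axb); apply: Or33.
  exact: (co_left Oco xuy xyb).1.
have ny' : alpha *~ n - - d y x0 \is a Num.int.
  have := rpredD ny (arc_mean_cocycle x0 y x0); rewrite arc_mean_diag.
  by congr (_ \is a Num.int); ring.
exists n, (- d y x0); split; [exact: nb0| |exact: ny'].
rewrite normrN ger0_norm ?arc_mean_ge0//; apply: small => u yux.
apply/(oint_split Oco _ axb); apply: Or31.
exact: (co_right Oco ayx yux).1.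
Qed.

Lemma arc_coord_order x y z : O x y z ->
  nu x <> nu y -> nu y <> nu z -> nu x <> nu z ->
  circle_order (nu x) (nu y) (nu z).
Proof.
move=> xyz nxy nyz nxz; rewrite (arc_coordE x y) (arc_coordE x z).
have lt0 u v : nu u <> nu v -> 0 < d u v.
  move=> nuv; rewrite lt_neqAle arc_mean_ge0 andbT; apply/eqP => e.
  by apply: nuv; rewrite (arc_coordE u v) -e addr0.
have [_ _ xz] := circular_order_neq Oco xyz.
have := lt0 _ _ nxy; have := lt0 _ _ nyz; have := lt0 _ _ (nesym nxz).
have := arc_meanC xz; have := arc_meanD xyz => ? ? ? ? ?.
by apply: circle_order_pi; lra.
Qed.

End preserving.
End ordered_minimal.

(** ** The rotation factor *)

Section rotation_factor.
Variables (R : realType) (X : topologicalType) (s : homeo X X).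
Variable O : X -> X -> X -> Prop.
Hypotheses (Oco : circular_order O) (O_basis : basis (open_intervals O)).
Hypotheses (X_compact : compact [set: X]) (X_haus : hausdorff_space X).
Hypotheses (s_min : minimal_cascade s) (X_inf : infinite_set [set: X]).

Lemma minimal_order_not_reversed : ~ forall a b c,
  O a b c -> O (s a) (s c) (s b).
Proof.
have [[x _] _] := s_min.
have [m [mT m_ge0 mU m_inv m_pt]] := @invariant_mean_exists R X s x
  (fun n => @minimal_aperiodic _ _ s_min X_inf X_haus n x).
exact: (@mean_not_reversing R X s O Oco O_basis X_compact X_haus s_min X_inf
  m mT m_ge0 mU m_inv m_pt x).
Qed.

Lemma minimal_not_isolated (x : X) : ~ open [set x].
Proof.
have [m [mT m_ge0 mU m_inv m_pt]] := @invariant_mean_exists R X s x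
  (fun n => @minimal_aperiodic _ _ s_min X_inf X_haus n x).
exact: (@mean_not_isolated R X s m mT m_ge0 mU m_inv m_pt X_compact s_min x).
Qed.

Lemma minimal_adjacent_chain x y z : adjacent O x y -> adjacent O y z -> False.
Proof.
have [m [mT m_ge0 mU m_inv m_pt]] := @invariant_mean_exists R X s x
  (fun n => @minimal_aperiodic _ _ s_min X_inf X_haus n x).
exact: (@mean_adjacent_chain R X s O Oco O_basis X_compact s_min X_inf
  m mT m_ge0 mU m_inv m_pt x y z).
Qed.

(** The coordinate and its order properties, detached from the mean that
    defines it. *)
Lemma rotation_factor : (forall a b c, O a b c -> O (s a) (s b) (s c)) ->
  exists (alpha : R) (nu : X -> circle R),
  [/\ irrational alpha, equivariant s (rotation alpha) nu,
      forall t, exists x, nu x = t,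
      forall x y, nu x = nu y <-> [\/ x = y, adjacent O x y | adjacent O y x] &
      forall x y z, O x y z -> nu x <> nu y -> nu y <> nu z -> nu x <> nu z ->
        circle_order (nu x) (nu y) (nu z)].
Proof.
move=> s_pres; have [[x _] _] := s_min.
have [m [mT m_ge0 mU m_inv m_pt]] := @invariant_mean_exists R X s x
  (fun n => @minimal_aperiodic _ _ s_min X_inf X_haus n x).
exists (rotation_angle s O m x), (arc_coord O m x); split.
- by apply: rotation_angle_irrational.
- by apply: arc_coord_equivariant.
- by apply: (@arc_coord_surj _ _ s).
- move=> y z; split=> [nyz|[->//|yz|zy]].
  + have [|yz] := pselect (y = z); first exact: Or31.
    have [|] : adjacent O y z \/ adjacent O z y.
      by apply: (@arc_coord_eq _ _ s O Oco O_basis X_compact s_min m mT m_ge0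
        mU m_inv m_pt x).
    * exact: Or32.
    * exact: Or33.
  + exact: (adjacent_coord Oco mT mU m_pt).
  + by apply/esym; exact: (adjacent_coord Oco mT mU m_pt).
- by apply: (@arc_coord_order _ _ O).
Qed.

End rotation_factor.

(** * From circular orders to split circles *)

Section split_iso.
Variables (R : realType) (X : topologicalType) (s : homeo X X).
Variable O : X -> X -> X -> Prop.
Hypotheses (Oco : circular_order O) (O_basis : basis (open_intervals O)).
Hypothesis s_pres : forall a b c, O a b c -> O (s a) (s b) (s c).
Hypothesis chain : forall x y z, adjacent O x y -> adjacent O y z -> False.
Variables (alpha : R) (nu : X -> circle R).
Hypothesis nu_s : equivariant s (rotation alpha) nu.
Hypothesis nu_surj : forall t, exists x, nu x = t.
Hypothesis nu_eq : forall x y,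
  nu x = nu y <-> [\/ x = y, adjacent O x y | adjacent O y x].
Hypothesis nu_order : forall x y z, O x y z ->
  nu x <> nu y -> nu y <> nu z -> nu x <> nu z ->
  circle_order (nu x) (nu y) (nu z).

(** These points become the points a^+ of the split circle. *)
Definition upper y := exists x, adjacent O x y.

Definition split_points : set (circle R) := nu @` upper.
Local Notation A := split_points.

Lemma adjacent_shift x y : adjacent O (s x) (s y) <-> adjacent O x y.
Proof.
split=> -[xy xy0]; split.
- by move=> e; apply: xy; rewrite e.
- by move=> u /s_pres; exact: xy0.
- by move=> /(@hfun_inj _ s).
- move=> u; rewrite -[u](@hinvK _ _ s).
  by move=> /(co_reflect Oco Oco (@hfun_inj _ s) s_pres); exact: xy0.
Qed.

Lemma upper_shift y : upper (s y) <-> upper y.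
Proof.
split=> -[x xy]; last by exists (s x); apply/adjacent_shift.
by exists (hinv s x); apply/adjacent_shift; rewrite hinvK.
Qed.

Lemma split_points_rotation : rotation alpha @` A = A.
Proof.
apply/seteqP; split=> [_ [_ [y uy <-] <-]|_ [y uy <-]].
  by exists (s y); [apply/upper_shift|rewrite nu_s].
exists (nu (hinv s y)); last by rewrite -nu_s hinvK.
by exists (hinv s y) => //; apply/upper_shift; rewrite hinvK.
Qed.

Lemma split_map_subproof x : (nu x, `[< upper x >]).2 ==>
  `[< A (nu x, `[< upper x >]).1 >].
Proof. by apply/implyP => /= /asboolP ux; apply/asboolP; exists x. Qed.

Definition split_map x : split_circle A := SplitCircle (split_map_subproof x).
Local Notation Phi := split_map.

Lemma lower_not_upper x y : adjacent O x y -> upper x -> False.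
Proof. by move=> xy [w wx]; exact: chain wx xy. Qed.

Lemma split_map_inj : injective Phi.
Proof.
move=> x y xy; have nxy : nu x = nu y by have := congr1 (@split_proj _ _) xy.
have uxy : `[< upper x >] = `[< upper y >].
  by have := congr1 (fun p => (split_val p).2) xy.
have {}uxy : upper x <-> upper y by split=> /asboolP;
  [rewrite uxy|rewrite -uxy] => /asboolP.
case/nu_eq: nxy => // adj; exfalso.
- by apply: (lower_not_upper adj); apply/uxy; exists x.
- by apply: (lower_not_upper adj); apply/uxy; exists y.
Qed.

Lemma split_map_surj p : exists x, Phi x = p.
Proof.
have [x xp] := nu_surj (split_proj p).
case p2 : (split_val p).2; last first.
  suff [y yp uy] : exists2 y, nu y = split_proj p & ~ upper y.
    by exists y; apply: split_circle_eq => //=; rewrite p2 asboolF.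
  have [[w wx]|] := pselect (upper x); last by exists x.
  exists w; last exact: (lower_not_upper wx).
  by rewrite -xp; apply/nu_eq; exact: Or32.
have [[y uy yp] _] := is_plusP p2.
by exists y; apply: split_circle_eq => //=; rewrite p2 asboolT.
Qed.

Lemma split_map_triple x y z : adjacent O x y -> z <> x -> z <> y ->
  split_triple (Phi x) (Phi y) (Phi z).
Proof.
move=> xy zx zy; have uy : upper y by exists x.
have nxy : nu x = nu y by apply/nu_eq; exact: Or32.
split=> //; [split=> /=|split=> /=| |].
- by rewrite [split_proj _]nxy; exists y.
- by rewrite asboolF// => ux; exact: (lower_not_upper xy).
- by exists y.
- by rewrite asboolT.
- by move=> /split_map_inj.
- by move=> /split_map_inj.
Qed.

Lemma split_map_order x y z : O x y z -> split_order (Phi x) (Phi y) (Phi z).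
Proof.
move=> xyz; have [xy yz xz] := circular_order_neq Oco xyz.
have [nxy|nxy] := pselect (nu x = nu y).
  right; apply: Or31; apply: split_map_triple; [|exact: nesym|exact: nesym].
  by case/nu_eq: nxy => // -[_ /(_ z)]; case; exact: (co_cycle Oco).
have [nyz|nyz] := pselect (nu y = nu z).
  right; apply: Or32; apply: split_map_triple => //.
  by case/nu_eq: nyz => // -[_ /(_ x)]; case; exact: (co_rot Oco).
have [nxz|nxz] := pselect (nu x = nu z).
  right; apply: Or33; apply: split_map_triple => //; last exact: nesym.
  by case/nu_eq: nxz => // -[_ /(_ y)]; case.
by left; exact: nu_order.
Qed.

Lemma split_map_equivariant (hA : rotation alpha @` A = A) :
  equivariant s (split_cascade hA) Phi.
Proof.
move=> x; apply: split_circle_eq => /=.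
  by rewrite [LHS]nu_s.
have [ux|ux] := pselect (upper x).
  by rewrite !asboolT//; apply/upper_shift.
by rewrite !asboolF// => /upper_shift.
Qed.

Lemma split_map_isomorphic (hA : rotation alpha @` A = A) :
  cascade_isomorphic s (split_cascade hA).
Proof.
have /choice[g gK] := split_map_surj.
have Kg : cancel Phi g by move=> x; apply: split_map_inj; rewrite gK.
have Sco := split_order_circular A; have Sb := split_basis A.
have cPhi : continuous Phi.
  exact: (order_iso_continuous Oco Sco O_basis Sb Kg gK split_map_order).
have cg : continuous g.
  apply: (order_iso_continuous Sco Oco Sb O_basis gK Kg) => p q r.
  rewrite -{1}(gK p) -{1}(gK q) -{1}(gK r).
  exact: (co_reflect Oco Sco split_map_inj split_map_order).
exists (Homeo Kg gK cPhi cg); exact: split_map_equivariant.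
Qed.

End split_iso.

(** The jumps of the order are the two-point fibres of the rotation coordinate,
    so the rotation has to be split at countably many points. *)
Lemma ordered_minimal_split (R : realType) (X : topologicalType)
    (s : homeo X X) (O : X -> X -> X -> Prop) :
    compact [set: X] -> hausdorff_space X -> minimal_cascade s ->
    infinite_set [set: X] -> circular_order O -> basis (open_intervals O) ->
    (forall a b c, O a b c -> O (s a) (s b) (s c)) ->
    countable [set p | adjacent O p.1 p.2] ->
  exists alpha : R, irrational alpha /\
    exists (A : set (circle R)) (hA : rotation alpha @` A = A),
      countable A /\ cascade_isomorphic s (split_cascade hA).
Proof.
move=> cX hX s_min X_inf Oco Ob s_pres cJ.
have chain x y z := @minimal_adjacent_chain R X s O Oco Ob cX hX s_min X_inf x
  y z.
have [alpha [nu [alpha_irr nu_s nu_surj nu_eq nu_order]]] :=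
  @rotation_factor R X s O Oco Ob cX hX s_min X_inf s_pres.
exists alpha; split=> //; exists (split_points O nu).
have hA := split_points_rotation Oco s_pres nu_s.
exists hA; split; last exact: split_map_isomorphic.
have -> : split_points O nu = (nu \o snd) @` [set p | adjacent O p.1 p.2].
  apply/seteqP; split=> [_ [y [x xy] <-]|_ [[x y] /= xy <-]].
    by exists (x, y).
  by exists y => //; exists x.
by apply: sub_countable (card_image_le _ _) cJ.
Qed.

(** Cut the circle at a third point w: basic sets around the two ends of a jump
    from x to y lie before y and after x.  Any other jump between the same two
    sets would therefore contain x or y. *)
Lemma second_countable_jumps (X : topologicalType) (O : X -> X -> X -> Prop) :
    @second_countable X -> infinite_set [set: X] -> circular_order O ->
    basis (open_intervals O) ->
  countable [set p | adjacent O p.1 p.2].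
Proof.
move=> [B cB [oB bB]] X_inf Oco Ob.
have separate (p : X * X) : exists UV : set X * set X, adjacent O p.1 p.2 ->
    [/\ B UV.1, B UV.2, UV.1 p.1, UV.2 p.2 & exists w, [/\ O w p.1 p.2,
      UV.1 `<=` oint O w p.2 & UV.2 `<=` oint O p.1 w]].
  case: p => x y /=; have [xy|] := pselect (adjacent O x y);
    last by exists (set0, set0).
  have [w [wx wy]] := infinite_third X_inf x y.
  have wxy : O w x y.
    by case: (co_cases Oco w xy.1) => // [/xy.2//|]; exact: (co_cycle Oco).
  have /(bB x)[U [BU Ux] Uw] : nbhs x (oint O w y).
    by apply: open_nbhs_nbhs; split=> //; exact: basis_oint_open.
  have /(bB y)[V [BV Vy] Vw] : nbhs y (oint O x w).
    apply: open_nbhs_nbhs; split=> //; first exact: basis_oint_open.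
    exact: (co_cycle Oco).
  by exists (U, V) => _; split=> //; exists w.
have /choice[f fP] := separate.
have fI : {in [set p | adjacent O p.1 p.2] &, injective f}.
  move=> [x y] [x' y']; rewrite !inE /= => xy xy' ff.
  have [_ _ _ _ [w /= [wxy fw1 fw2]]] := fP (x, y) xy.
  have [_ _ fx' fy' _] := fP (x', y') xy'; rewrite -ff /= in fx' fy'.
  have xyw : O x y w by exact: (co_cycle Oco).
  have y'E : y' = y \/ O y y' w.
    by case/(oint_split Oco y' xyw): (fw2 _ fy') => [/xy.2//|->|]; [left|right].
  have x'E : x' = x \/ O w x' x.
    by case/(oint_split Oco x' wxy): (fw1 _ fx') => [|->|/xy.2//]; [right|left].
  have x'x : x' = x.
    case: x'E => // wx'x; exfalso; apply: (xy'.2 x).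
    have wx'y := (co_left Oco wx'x wxy).1;
      have x'xy := (co_left Oco wx'x wxy).2.
    case: y'E => [->//|yy'w].
    have x'yw : O x' y w by exact: (co_cycle Oco).
    exact: (co_left Oco x'xy (co_right Oco x'yw yy'w).2).1.
  rewrite x'x; case: y'E => [->//|yy'w]; exfalso; apply: (xy'.2 y).
  by rewrite x'x; exact: (co_right Oco xyw yy'w).2.
have /countable_injP[g gI] := cB.
apply/countable_injP; exists (fun p => pickle (g (f p).1, g (f p).2)).
move=> p q pJ qJ /(pcan_inj pickleK)[].
have [|Bp1 Bp2 _ _ _] := fP p; first by move: pJ; rewrite inE.
have [|Bq1 Bq2 _ _ _] := fP q; first by move: qJ; rewrite inE.
move=> /gI; rewrite !inE => /(_ Bp1 Bq1) e1 /gI;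
  rewrite !inE => /(_ Bp2 Bq2) e2.
apply: fI => //; move: e1 e2; case: (f p) (f q) => [? ?] [? ?] /= -> ->.
by [].
Qed.

(** * Subsystems of circle homeomorphisms *)

(** A reversing homeomorphism is excluded by the invariant mean, applied to the
    circle itself. *)
Lemma circle_minimal_preserving (R : realType) (psi : homeo (circle R) (circle
  R)) :
  minimal_cascade psi ->
  forall a b c, circle_order a b c -> circle_order (psi a) (psi b) (psi c).
Proof.
move=> psi_min; have [//|rev] := circle_homeo_orientation psi.
by have := minimal_order_not_reversed R (circle_order_co R) (@circle_basis R)
  (@circle_compact R) (@circle_hausdorff R) psi_min (@circle_infinite R) rev.
Qed.

Lemma cop_preserving (T T' : Type) (O : T -> T -> T -> Prop)
    (O' : T' -> T' -> T' -> Prop) (f : T -> T') :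
  injective f -> (forall a b c, O a b c -> O' (f a) (f b) (f c)) -> cop O O' f.
Proof.
move=> fI fO; split=> [a b c /fO//|a c /fI ->]; left => x y.
by move=> [[_ ->]|[]//] [[_ ->]|[]//].
Qed.

Lemma hpow_preserving (X : topologicalType) (s : homeo X X)
    (O : X -> X -> X -> Prop) : circular_order O ->
    (forall a b c, O a b c -> O (s a) (s b) (s c)) ->
  forall n a b c, O a b c -> O (hpow s n a) (hpow s n b) (hpow s n c).
Proof.
move=> Oco sO; elim/int_ind => [//|n IH|n IH] a b c abc.
  by rewrite -addn1 PoszD !hpowSr; exact/sO/IH.
rewrite -addn1 PoszD opprD !hpowBr.
apply: (co_reflect Oco Oco (@hfun_inj _ s) sO).
by rewrite !hinvK; exact: IH.
Qed.

Lemma circle_embedded_ordered (R : realType) (X : topologicalType)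
    (s : homeo X X) (psi : homeo (circle R) (circle R)) :
    compact [set: X] -> hausdorff_space X -> minimal_cascade s ->
    no_periodic_points psi -> cascade_embeds s psi ->
  [/\ infinite_set [set: X], circularly_ordered s & @second_countable X].
Proof.
move=> cX hX s_min psi_aper [f [fI f_open] sf].
have [[x0 _] _] := s_min.
have X_inf : infinite_set [set: X].
  apply: (@infinite_set_inj _ _ (fun n : nat => hpow s n x0));
    last exact: infinite_nat.
  move=> m n /(congr1 f); rewrite !(hpow_equivariant _ _ sf).
  wlog mn : m n / (m < n)%N => [hw|].
    have [mn|nm|//] := ltngtP m n; first exact: hw.
    by move=> e; apply/esym; apply: hw.
  rewrite -(subnK mn) addnS -addSn PoszD hpowD => /esym e.
  by case: (psi_aper (n - m.+1).+1 (hpow psi m (f x0))).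
pose O a b c := circle_order (f a) (f b) (f c).
have Oco : circular_order O by exact: (co_pullback (circle_order_co R) fI).
have Ob : basis (open_intervals O).
  apply: (compact_oint_basis Oco cX (infinite_third X_inf)) => a b.
  apply/f_open; exists (oint (@circle_order R) (f a) (f b)) => //.
  exact: circle_oint_open.
have s_pres a b c : O a b c -> O (s a) (s b) (s c).
  have [pres|rev] := circle_homeo_orientation psi.
    by rewrite /O !sf; exact: pres.
  case: (minimal_order_not_reversed R Oco Ob cX hX s_min X_inf) => a' b' c'.
  by rewrite /O !sf; exact: rev.
split=> //.
  exists O; split=> // n; apply: cop_preserving;
    first exact: can_inj (hpowK s n).
  exact: hpow_preserving.
have [B cB [oB bB]] := circle_second_countable R.
exists [set f @^-1` V | V in B].
  by apply: sub_countable (card_image_le _ _) cB.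
split=> [_ [V BV <-]|x U].
  by apply/f_open; exists V => //; exact: oB.
rewrite nbhsE => -[W [/f_open[V oV ->] /= Vfx] WU].
have [V' [BV' V'fx] V'V] := bB (f x) V (open_nbhs_nbhs (conj oV Vfx)).
exists (f @^-1` V'); first by split=> //; exists V'.
by move=> y /V'V; exact: WU.
Qed.

(** * Proximality *)

(** The pair (a, b) lies in the orbit closure of the pair (x, y). *)
Definition adheres (X : topologicalType) (s : homeo X X) (x y a b : X) :=
  forall U V, nbhs a U -> nbhs b V ->
    exists n, U (hpow s n x) /\ V (hpow s n y).

Section proximal_theory.
Variables (X : topologicalType) (s : homeo X X).

Lemma proximalP x y : proximal s (x, y) <-> exists a, adheres s x y a a.
Proof.
split=> [[[a b] [clab /= ab]]|[a aa]].
  rewrite /diagonal /= in ab; rewrite -ab in clab.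
  exists a => U V aU aV; have [|_ [[n _ <-] [/= Un Vn]]] := clab (U `*` V).
    by exists (U, V).
  by exists n.
exists (a, a); split=> // W [[U V] /= [aU aV] UVW].
have [n [Un Vn]] := aa U V aU aV; exists (hpow s n x, hpow s n y); split.
  by exists n.
exact: UVW.
Qed.

Lemma adheres_id x y : adheres s x y x y.
Proof. by move=> U V /nbhs_singleton ? /nbhs_singleton ?; exists 0. Qed.

Lemma adheres_trans x y a b c d :
  adheres s x y a b -> adheres s a b c d -> adheres s x y c d.
Proof.
move=> xyab abcd U V cU dV.
have [|n [Un Vn]] := abcd U° V° (nbhs_interior cU); first exact: nbhs_interior.
have [||k [Uk Vk]] := xyab (hpow s n @^-1` U) (hpow s n @^-1` V).
- exact: hpow_continuous.
- exact: hpow_continuous.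
by exists (n + k); rewrite !hpowD.
Qed.

Lemma proximal_adheres x y a b :
  adheres s x y a b -> proximal s (a, b) -> proximal s (x, y).
Proof.
move=> xyab /proximalP[c abc]; apply/proximalP; exists c.
exact: adheres_trans abc.
Qed.

Lemma proximal_refl x : proximal s (x, x).
Proof. by apply/proximalP; exists x; exact: adheres_id. Qed.

Lemma proximal_sym x y : proximal s (x, y) -> proximal s (y, x).
Proof.
move=> /proximalP[a aa]; apply/proximalP; exists a => U V aU aV.
by have [n [? ?]] := aa V U aV aU; exists n.
Qed.

Lemma proximal_hpow n x y :
  proximal s (hpow s n x, hpow s n y) <-> proximal s (x, y).
Proof.
have half k u v : proximal s (u, v) -> proximal s (hpow s k u, hpow s k v).
  move=> /proximalP[a aa]; apply/proximalP; exists a => U V aU aV.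
  have [l [Ul Vl]] := aa U V aU aV.
  by exists (l - k); rewrite -!hpowD subrK.
by split=> [/(half (- n))|/half//]; rewrite !hpowK.
Qed.

End proximal_theory.

Section factors.
Variables (X : topologicalType) (s : homeo X X).

Lemma adheres_factor (Y : topologicalType) (t : homeo Y Y) (f : X ->
  Y) x y a b :
  continuous f -> equivariant s t f ->
  adheres s x y a b -> adheres t (f x) (f y) (f a) (f b).
Proof.
move=> cf sf xyab U V aU bV;
  have [n [Un Vn]] := xyab _ _ (cf _ _ aU) (cf _ _ bV).
by exists n; rewrite -!(hpow_equivariant _ _ sf).
Qed.

Lemma proximal_factor (Y : topologicalType) (t : homeo Y Y) (f : X -> Y) x y :
  continuous f -> equivariant s t f ->
  proximal s (x, y) -> proximal t (f x, f y).
Proof.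
move=> cf sf /proximalP[a aa]; apply/proximalP; exists (f a).
exact: adheres_factor.
Qed.

Lemma minimal_factor (Y : topologicalType) (t : homeo Y Y) (f : X -> Y) :
  continuous f -> equivariant s t f -> (forall y, exists x, f x = y) ->
  minimal_cascade s -> minimal_cascade t.
Proof.
move=> cf sf f_surj s_min; have [[x _] _] := s_min; split;
  first by exists (f x).
move=> y U [z Uz] oU; have [x' x'y] := f_surj y.
have ofU : open (f @^-1` U) by apply: open_comp => // u _; exact: cf.
have [|n Un] := minimal_visit s_min x' ofU.
  by have [z' z'z] := f_surj z; exists z'; rewrite /= z'z.
exists (hpow t n y); split; last by exists n.
by rewrite -x'y -(hpow_equivariant _ _ sf).
Qed.

Section compact_proximal.
Hypothesis X_compact : compact [set: X].

Lemma adherence_filter (Y : topologicalType) (u v : int -> Y) (a b : Y) :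
  (forall U V, nbhs a U -> nbhs b V -> exists n, U (u n) /\ V (v n)) ->
  ProperFilter [set N : set int | exists U V, [/\ nbhs a U, nbhs b V &
    forall n, U (u n) -> V (v n) -> N n]].
Proof.
move=> uv; split=> [[U [V [aU bV UV0]]]|].
  by have [n [Un Vn]] := uv U V aU bV; exact: UV0 Un Vn.
split=> [|M N [U [V [aU bV UVM]]]
  [U' [V' [aU' bV' UVN]]]|M N MN [U [V [aU bV UVM]]]].
- by exists setT, setT; split; [exact: filterT|exact: filterT|].
- exists (U `&` U'), (V `&` V'); split; [exact: filterI|exact: filterI|].
  by move=> n [? ?] [? ?]; split; [exact: UVM|exact: UVN].
- by exists U, V; split=> // n ? ?; apply: MN; exact: UVM.
Qed.

(** Compactness along the times at which (x, y) is close to (a, b). *)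
Lemma adheres_third x y a b z : adheres s x y a b ->
  exists c : X, forall U V W, nbhs a U -> nbhs b V -> nbhs c W ->
    exists n, [/\ U (hpow s n x), V (hpow s n y) & W (hpow s n z)].
Proof.
move=> /(@adherence_filter _ (hpow s ^~ x) (hpow s ^~ y)).
set F := (F in ProperFilter F) => FF.
have [|c [_ clc]] := X_compact (fmap_proper_filter (hpow s ^~ z) FF).
  exact: filterT.
exists c => U V W aU bV cW;
  pose N := [set n | U (hpow s n x) /\ V (hpow s n y)].
have FN : F N by exists U, V; split.
have [|_ [[n [Un Vn] <-] Wn]] := clc ((hpow s ^~ z) @` N) W _ cW.
  by apply: filterS FN => n Nn; exists n.
by exists n.
Qed.

(** The preimages of (c, d) arise as cluster points of the orbit of (x, y) along
    the times at which its image is close to (c, d). *)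
Lemma adheres_lift (Y : topologicalType) (t : homeo Y Y) (f : X -> Y) x y c d :
    hausdorff_space Y -> continuous f -> equivariant s t f ->
    adheres t (f x) (f y) c d ->
  exists a b, [/\ f a = c, f b = d & adheres s x y a b].
Proof.
move=> hY cf sf /(@adherence_filter _ (hpow t ^~ (f x)) (hpow t ^~ (f y))).
set F := (F in ProperFilter F) => FF.
have cXX : compact [set: X * X].
  by rewrite -setXTT; exact: compact_setX.
have [|[a b] [_ clab]] := cXX _ (fmap_proper_filter (fun n => (hpow s n x,
  hpow s n y)) FF).
  exact: filterT.
have hit U V N : nbhs a U -> nbhs b V -> F N ->
    exists n, [/\ U (hpow s n x), V (hpow s n y) & N n].
  move=> aU bV FN.
  have [||_ [[n Nn <-] [Un Vn]]] :=
    clab ((fun n => (hpow s n x, hpow s n y)) @` N) (U `*` V).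
  - by apply: filterS FN => n Nn; exists n.
  - by exists (U, V).
  by exists n.
exists a, b; split.
- apply: hY => U V aU cV.
  have [|n [Un _ Vn]] := hit (f @^-1` U) setT [set n | V (hpow t n (f x))]
    (cf _ _ aU) filterT.
    by exists V, setT; split=> //; exact: filterT.
  by exists (f (hpow s n x)); split=> //; rewrite (hpow_equivariant _ _ sf).
- apply: hY => U V bU dV.
  have [|n [_ Un Vn]] := hit setT (f @^-1` U) [set n | V (hpow t n (f y))]
    filterT (cf _ _ bU).
    by exists setT, V; split=> //; exact: filterT.
  by exists (f (hpow s n y)); split=> //; rewrite (hpow_equivariant _ _ sf).
- move=> U V aU bV.
  by have [n [Un Vn _]] := hit U V setT aU bV filterT; exists n.
Qed.

(** When (x, y) collapses to (a, a), the third point clusters at some c with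
    (a, c) both proximal and in the orbit closure of (x, z). *)
Lemma proximal_trans x y z : closed (proximal s) ->
  proximal s (x, y) -> proximal s (y, z) -> proximal s (x, z).
Proof.
move=> Pcl /proximalP[a xya] yzP; have [c xyzc] := adheres_third z xya.
apply: (@proximal_adheres _ _ _ _ a c).
  move=> U W aU cW; have [n [? _ ?]] := xyzc U setT W aU filterT cW.
  by exists n.
apply: Pcl => W [[U V] /= [aU cV] UVW].
have [n [_ Un Vn]] := xyzc setT U V filterT aU cV.
exists (hpow s n y, hpow s n z); split; last exact: UVW.
exact/proximal_hpow.
Qed.

Hypothesis X_haus : hausdorff_space X.

Lemma saturation_closed (E : equiv_rel X) K : closed_rel E -> closed K ->
  closed [set x | exists2 y, K y & E x y].
Proof.
move=> Ecl Kcl; pose C := [set p : X * X | E p.1 p.2] `&` (setT `*` K).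
have -> : [set x | exists2 y, K y & E x y] = fst @` C.
  apply/seteqP; split=> [x [y Ky Exy]|_ [[x y] /= [Exy [_ Ky]] <-]].
    by exists (x, y).
  by exists y.
apply: compact_closed => //; apply: continuous_compact.
  by apply: continuous_subspaceT => p; exact: cvg_fst.
rewrite /C setIC; apply: compact_closedI => //.
by apply: compact_setX => //; exact: subclosed_compact Kcl X_compact _.
Qed.

(** Two classes are disjoint closed sets.  Open sets separating them can be
    shrunk to saturated ones, since saturations of closed sets are closed. *)
Lemma quotient_space_hausdorff (R : realType) (E : equiv_rel X) :
  closed_rel E -> hausdorff_space (quotient_space E).
Proof.
move=> Ecl; pose pi (x : X) : quotient_space E := (\pi_(quotient_space E) x)%qT.
have piE x y : pi x = pi y <-> E x y by split=> [/eqmodP|h]; [|apply/eqmodP].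
move=> q r; apply: contraPP => qr clqr.
pose x := repr q; pose y := repr r.
have xq : pi x = q by exact: (@reprK _ (quotient_space E)).
have yr : pi y = r by exact: (@reprK _ (quotient_space E)).
have nE : ~ E x y by move=> /piE; rewrite xq yr.
pose cl z := [set w | exists2 y, [set z] y & E w y].
have clz z : closed (cl z).
  apply: saturation_closed => //.
  exact: (accessible_closed_set1 (hausdorff_accessible X_haus)).
have [|U [V [oU oV xU yV UV0]]] := (@normal_openP R X).1
    (compact_normal X_haus X_compact) (cl x) (cl y) (clz x) (clz y).
  rewrite -subset0 => w [[_ -> wx] [_ -> wy]]; apply: nE.
  by apply/piE; move/piE: wx => <-; exact/piE.
pose sat W := [set q | exists2 w, (~` W) w & q = pi w].
have osat W : open W -> open (~` sat W).
  move=> oW; change (open (pi @^-1` (~` sat W))).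
  have -> : pi @^-1` (~` sat W) = ~` [set w | exists2 w', (~` W) w' & E w w'].
    apply/seteqP; split=> w /= nw [w' Ww' h]; apply: nw.
      by exists w' => //; apply/piE.
    by exists w' => //; apply/piE.
  apply: closed_openC; apply: saturation_closed => //.
  exact: open_closedC.
have UV_disj : ~` sat U `&` ~` sat V = set0 :> set (quotient_space E).
  rewrite -subset0 => q';
    rewrite -[q'](@reprK _ (quotient_space E)) => -[nU nV].
  have : (U `&` V) (repr q'); last by rewrite UV0.
  by split; apply: contrapT => ?; [apply: nU|apply: nV]; exists (repr q').
have [||q'] := clqr (~` sat U) (~` sat V); last by rewrite UV_disj.
- apply: open_nbhs_nbhs; split; first exact: osat.
  move=> [w Uw]; rewrite -xq => /piE xw; apply/Uw/xU.
  by exists x => //; apply/piE/esym/piE.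
- apply: open_nbhs_nbhs; split; first exact: osat.
  move=> [w Vw]; rewrite -yr => /piE yw; apply/Vw/yV.
  by exists y => //; apply/piE/esym/piE.
Qed.

End compact_proximal.
End factors.

(** * The distal structure relation *)

Section distal_structure_proximal.
Variables (X : topologicalType) (s : homeo X X).

Definition quotient_proj (E : equiv_rel X) (x : X) : quotient_space E :=
  (\pi_(quotient_space E) x)%qT.

Lemma quotient_projP (E : equiv_rel X) x y :
  quotient_proj E x = quotient_proj E y <-> E x y.
Proof. by split=> [/eqmodP|h]; [|apply/eqmodP]. Qed.

Lemma quotient_proj_repr (E : equiv_rel X) (q : quotient_space E) :
  quotient_proj E (repr q) = q.
Proof. exact: (@reprK _ (quotient_space E)). Qed.

Lemma quotient_proj_continuous (E : equiv_rel X) : continuous (quotient_proj E).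
Proof. exact: pi_continuous. Qed.

Lemma quotient_proj_equivariant (E : equiv_rel X) (sE : rel_invariant s E) :
  equivariant s (quotient_cascade sE) (quotient_proj E).
Proof. by move=> x; rewrite /= /quotient_proj quotient_map_pi. Qed.

Lemma proximal_distal_quotient (E : equiv_rel X) x y :
  distal_quotient s E -> proximal s (x, y) -> E x y.
Proof.
move=> [sE dE] xyP; apply/quotient_projP.
suff : proximal (quotient_cascade sE) (quotient_proj E x, quotient_proj E y).
  by rewrite dE.
apply: proximal_factor xyP; first exact: quotient_proj_continuous.
exact: quotient_proj_equivariant.
Qed.

Hypotheses (X_compact : compact [set: X]) (X_haus : hausdorff_space X).

Lemma proximal_closed : limit_point (proximal s) `<=` diagonal ->
  closed (proximal s).
Proof.
move=> P'D [x y] clp; apply: contrapT => np; apply: (np).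
suff : diagonal (x, y) by move=> /diagonalP ->; exact: proximal_refl.
apply: P'D => U pU; have [q [qP qU]] := clp U pU; exists q; split=> //.
by apply/eqP => qp; rewrite qp in qP.
Qed.

Section closed_proximal.
Hypothesis P_closed : closed (proximal s).

Let prox x y := `[<proximal s (x, y)>].

Let prox_equiv : equiv_class_of prox.
Proof.
split=> [x|x y|y x z].
- by apply/asboolP; exact: proximal_refl.
- by apply/asboolP/asboolP; exact: proximal_sym.
- by move=> /asboolP xy /asboolP yz; apply/asboolP; exact: proximal_trans yz.
Qed.

Definition proximal_rel : equiv_rel X := EquivRelPack prox_equiv.

Lemma proximal_relP x y : proximal_rel x y <-> proximal s (x, y).
Proof. by split=> /asboolP. Qed.

Lemma proximal_rel_closed : closed_rel proximal_rel.
Proof.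
rewrite /closed_rel; have ->
  // : [set p : X * X | proximal_rel p.1 p.2] = proximal s.
by apply/seteqP; split=> -[x y] /proximal_relP.
Qed.

(** A proximal pair of classes lifts to a pair (x, y) whose orbit closure
    contains an equivalent, that is a proximal, pair; so (x, y) is proximal. *)
Lemma proximal_rel_distal (R : realType) : distal_quotient s proximal_rel.
Proof.
have sE : rel_invariant s proximal_rel.
  move=> x y; apply/idP/idP => /proximal_relP h; apply/proximal_relP.
    exact: (proj1 (proximal_hpow s 1 x y) h).
  exact: (proj2 (proximal_hpow s 1 x y) h).
exists sE; apply/seteqP; split=> -[q r]; last by move=> /diagonalP ->;
  exact: proximal_refl.
rewrite -[q]quotient_proj_repr -[r]quotient_proj_repr => /proximalP[c].
move=> /(adheres_lift X_compact
  (quotient_space_hausdorff X_compact X_haus R proximal_rel_closed)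
  (@quotient_proj_continuous _) (quotient_proj_equivariant sE))[a [b [ac bc
    ab]]].
apply/quotient_projP/proximal_relP; apply: proximal_adheres ab _.
by apply/proximal_relP/quotient_projP; rewrite ac bc.
Qed.

Lemma distal_structure_proximal (R : realType) (D : equiv_rel X) :
  distal_structure_relation s D -> forall x y, D x y <-> proximal s (x, y).
Proof.
move=> [Dcl Ddist Dmin] x y; split; last exact: proximal_distal_quotient.
move=> /(Dmin _ proximal_rel_closed (proximal_rel_distal R)).
by move=> /proximal_relP.
Qed.

End closed_proximal.
End distal_structure_proximal.

(** * Fibres of a map to the circle *)

Section circle_fibers.
Variables (R : realType) (X : topologicalType) (p : X -> circle R).
Hypotheses (X_compact : compact [set: X]) (X_haus : hausdorff_space X).
Hypotheses (cp : continuous p) (p_surj : forall t, exists x, p x = t).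
Hypothesis no_isolated : forall x : X, ~ open [set x].

Definition kernel_pairs : set (X * X) := [set q | p q.1 = p q.2].
Local Notation K := kernel_pairs.

Hypothesis K_limit : limit_point K `<=` diagonal.

Lemma kernel_pairs_closed : closed K.
Proof.
move=> [x y] clxy; rewrite /K /=; apply: (@circle_hausdorff R) => U V pU pV.
have [|[x' y'] [/= e [Ux Vy]]] := clxy (p @^-1` U `*` p @^-1` V).
  by exists (p @^-1` U, p @^-1` V) => //; split; exact: cp.
by exists (p x'); split=> //; rewrite e.
Qed.

(** The points whose whole fibre lies in U. *)
Lemma full_fiber_open U : open U -> open (~` (p @` (~` U))).
Proof.
move=> oU; apply: closed_openC; apply: compact_closed;
  first exact: circle_hausdorff.
apply: continuous_compact; first exact: continuous_subspaceT.
by apply: (subclosed_compact (open_closedC oU) X_compact).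
Qed.

(** The point x is the limit of the preimages of arcs that shrink to p x from
    one side.  The side is given by the orientation C, so that left ends are
    right ends for the opposite orientation. *)
Definition arc_end (C : circle R -> circle R -> circle R -> Prop) x :=
  forall U, nbhs x U ->
    exists2 w, w <> p x & p @^-1` (oint C (p x) w) `<=` U.

Definition right_end := arc_end (@circle_order R).

Definition left_end := arc_end (flip_order (@circle_order R)).

(** The points of the arc whose fibre lies in U and those whose fibre lies in W
    form a partition of the arc into open sets, and arcs are connected. *)
Lemma arc_preimage_split a b U W : open U -> open W ->
    p @^-1` (oint (@circle_order R) a b) `<=` U `|` W ->
    (forall x y, p x = p y -> oint (@circle_order R) a b (p x) -> U x -> W y ->
       False) ->
  p @^-1` (oint (@circle_order R) a b) `<=` U \/
  p @^-1` (oint (@circle_order R) a b) `<=` W.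
Proof.
move=> oU oW abUW split_UW; set J := oint _ a b in abUW split_UW *.
have over S : open S -> open (~` (p @` (~` S))) := @full_fiber_open S.
have [[t [Jt tU]]|none] := pselect (exists t, J t /\ ~ (p @` (~` U)) t);
  last first.
  right=> x Jx; have [Ux|//] := abUW _ Jx; apply: contrapT => nWx.
  apply: none; exists (p x); split=> // -[y nUy yx].
  have [//|Wy] : (U `|` W) y by apply: abUW; rewrite /= yx.
  exact: (split_UW x y).
left; have JE : J `&` ~` (p @` (~` U)) = J.
  apply: (@circle_oint_connected R a b).
  - by exists t.
  - by exists (~` (p @` (~` U))) => //; exact: over.
  - exists (p @` (~` W)).
      by rewrite -[_ @` _]setCK; apply: open_closedC; exact: over.
    apply/seteqP; split=> u [Ju h]; split=> //.
      have [x xu] := p_surj u; exists x => // Wx.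
      apply: (split_UW x x) => //; first by rewrite xu.
      by apply: contrapT => nUx; apply: h; exists x.
    case: h => x nWx xu [y nUy yu].
    apply: (split_UW x y); rewrite ?xu ?yu//.
      by have [//|//] : (U `|` W) x by apply: abUW; rewrite /= xu.
    by have [//|//] : (U `|` W) y by apply: abUW; rewrite /= yu.
move=> x Jx; apply: contrapT => nUx.
have [_] : (J `&` ~` (p @` (~` U))) (p x) by rewrite JE.
by apply; exists x.
Qed.

Lemma closed_nbhs (x : X) U : nbhs x U ->
  exists M, [/\ nbhs x M, closed M & M `<=` U].
Proof.
move=> xU; have [M xM MU]
  := @compact_regular X x setT X_haus X_compact filterT U xU.
exists (closure M); split=> //.
  by apply: filterS xM; exact: subset_closure.
exact: closed_closure.
Qed.

(** The kernel pairs outside a neighbourhood of the diagonal are finitely many,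
    so that all fibres near that of x lie either close to x or away from it.  By
    connectedness each of the two arcs next to p x is of one of these kinds, and
    not both are away from x since x is not isolated. *)
Lemma fiber_end x y : x <> y -> p x = p y -> right_end x \/ left_end x.
Proof.
move=> xy pxy; apply: contrapT => /not_orP[].
move=> /existsNP[U1 /not_implyP[xU1 badR]] /existsNP[U2 /not_implyP[xU2 badL]].
have [[U3 V3] /= [xU3 yV3] UV3] : nbhs (x, y) [set q | K q -> q = (x, y)].
  apply: contrapT => nK; apply: xy.
  have /diagonalP // : diagonal (x, y).
  apply: K_limit => W xyW; apply: contrapT => none; apply: nK.
  apply: filterS xyW => q Wq Kq; apply: contrapT => qxy; apply: none.
  by exists q; split=> //; apply/eqP.
have fib_x z : p z = p x -> U3 z -> z = x.
  move=> zx U3z; suff [] : (z, y) = (x, y) by [].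
  apply: UV3; last by rewrite /K /= zx.
  by split=> //=; exact: nbhs_singleton.
have [N [xN Ncl NU]] := closed_nbhs (filterI (filterI xU1 xU2) xU3).
have [M [xM Mcl MN]] := closed_nbhs (nbhs_interior xN).
pose C := K `&` (M `*` ~` N°).
have Ccl : closed C.
  apply: closedI; first exact: kernel_pairs_closed.
  apply: (@closedI _ (fst @^-1` M) (snd @^-1` (~` N°))).
    by apply: preimage_closed => // q _; exact: cvg_fst.
  apply: preimage_closed => [q _|]; first exact: cvg_snd.
  by apply: open_closedC; exact: open_interior.
have Cfin : finite_set C.
  rewrite -[C]setIid; apply: (compact_ideal (P :=
    fun A => finite_set (A `&` C))).
  - apply: (subclosed_compact Ccl (B := setT)) => //.
    by rewrite -setXTT; exact: compact_setX.
  - by rewrite set0I.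
  - by move=> A B finA finB; rewrite setIUl finite_setU.
  - by move=> A B BA; apply: sub_finite_set; exact: setSI.
  - move=> [u v] Cuv; have [Kuv [Mu Nv]] := Cuv.
    have nD : ~ diagonal (u, v).
      by move=> /diagonalP uv; apply: Nv; rewrite -uv; exact: MN.
    have [W uvW WK] : exists2 W, nbhs (u, v) W & forall q,
      W q -> K q -> q = (u, v).
      apply: contrapT => none; apply: nD; apply: K_limit => W uvW.
      apply: contrapT => none'; apply: none; exists W => // q Wq Kq.
      by apply: contrapT => quv; apply: none'; exists q; split=> //; apply/eqP.
    exists W => //; apply: (@sub_finite_set _ _ [set (u,
      v)]) => // q [Wq [Kq _]].
    exact: WK.
(* the fibres that meet both U and W below *)
pose Bad := (fun q : X * X => p q.1) @` C.
have Badcl : closed (Bad `\ p x).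
  apply: compact_closed; first exact: circle_hausdorff.
  by apply: finite_compact; apply: finite_setD; exact: finite_image.
pose U := M°; pose W := ~` N.
have oU : open U by exact: open_interior.
have oW : open W by exact: closed_openC.
have UN : U `<=` N by move=> z /interior_subset/MN/interior_subset.
have xUW : p @^-1` [set p x] `<=` U `|` W.
  move=> z /= zx; have [Nz|] := pselect (N z); last by right.
  left; have -> : z = x by apply: fib_x => //; have [] := NU _ Nz.
  exact: nbhs_singleton (nbhs_interior xM).
have : nbhs (p x) (~` (p @` (~` (U `|` W))) `&` ~` (Bad `\ p x)).
  apply: open_nbhs_nbhs; split; last first.
    by split; [move=> [z + zx]; apply; exact: xUW|case=> _; exact].
  apply: openI; last exact: closed_openC.
  by apply: full_fiber_open; exact: openU.
move=> /(basis_oint_nbhs (@circle_basis R))[a [b [ab axb abV]]].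
have Rco := circle_order_co R.
have [ax xb _] := circular_order_neq Rco axb.
have arc c d : oint (@circle_order R) c d `<=` oint (@circle_order R) a b ->
    ~ oint (@circle_order R) c d (p x) ->
  p @^-1` (oint (@circle_order R) c d) `<=` U \/
  p @^-1` (oint (@circle_order R) c d) `<=` W.
  move=> cd ncd; apply: arc_preimage_split => //.
    move=> z /= /cd/abV[nz _]; apply: contrapT => nUW; apply: nz.
    by exists z.
  move=> u v uv cdu Uu Wv; have [_] := abV _ (cd _ cdu); apply; split.
    exists (u, v) => //; split=> //; split; first exact: interior_subset.
    by move=> /interior_subset.
  by move=> e; apply: ncd; rewrite -e.
have UU1 : U `<=` U1 by move=> z /UN/NU[[]].
have UU2 : U `<=` U2 by move=> z /UN/NU[[]].
have [R1|R1] : p @^-1` (oint (@circle_order R) (p x) b) `<=` U \/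
  p @^-1` (oint (@circle_order R) (p x) b) `<=` W.
- apply: arc; last by move=> /(circular_order_neq Rco)[].
  by move=> t xtb; apply/(oint_split Rco _ axb); exact: Or33.
- apply: badR; exists b; first exact: nesym.
  exact: subset_trans UU1.
have [L1|L1] : p @^-1` (oint (@circle_order R) a (p x)) `<=` U \/
  p @^-1` (oint (@circle_order R) a (p x)) `<=` W.
- apply: arc; last by move=> /(circular_order_neq Rco)[].
  by move=> t xtb; apply/(oint_split Rco _ axb); exact: Or31.
- apply: badL; exists a; first by [].
  exact: subset_trans UU2.
apply: (@no_isolated x).
have <- : U `&` p @^-1` (oint (@circle_order R) a b) = [set x].
  apply/seteqP; split=> z; last first.
    by move=> ->; split=> //; exact: nbhs_singleton (nbhs_interior xM).
  move=> [Uz /(oint_split Rco _ axb)[azx|zx|xzb]].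
  - by case: (L1 z azx); exact: UN.
  - by apply: fib_x => //; have [] := NU _ (UN _ Uz).
  - by case: (R1 z xzb); exact: UN.
apply: openI => //; apply: open_comp => [z _|]; first exact: cp.
exact: circle_oint_open.
Qed.

Section arc_ends.
Variable C : circle R -> circle R -> circle R -> Prop.
Hypotheses (Cco : circular_order C).
Hypothesis C_arc : forall a b, a <> b -> oint C a b !=set0.
Hypothesis C_open : forall a b, open (oint C a b).

(** Small arcs on the same side of p x overlap, so their preimages cannot shrink
    to different points. *)
Lemma arc_end_uniq x y : p x = p y -> arc_end C x -> arc_end C y -> x = y.
Proof.
move=> pxy rx ry; apply: X_haus => U V xU yV.
have [w wx wU] := rx U xU; have [w' w'y w'V] := ry V yV.
rewrite -pxy in w'y w'V.
have [v vx [vw vw']] : exists2 v, v <> p x &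
    oint C (p x) v `<=` oint C (p x) w /\ oint C (p x) v `<=` oint C (p x) w'.
  have [->|ww'] := pselect (w = w'); first by exists w'; last split.
  case: (co_total Cco (nesym wx) ww' (nesym w'y)) => h.
    by exists w => //; split=> // t xtw; exact: (co_left Cco xtw h).1.
  by exists w' => //; split=> // t xtw; exact: (co_left Cco xtw h).1.
have [t xtv] := C_arc (nesym vx); have [z zt] := p_surj t.
by exists z; split; [apply: wU|apply: w'V]; rewrite /= zt;
  [exact: vw|exact: vw'].
Qed.

(** An end of a two-point fibre has a neighbourhood on one side of p x: on the
    other side the points are close to the other end. *)
Lemma arc_end_nbhs x y w : arc_end (flip_order C) y -> y <> x -> p y = p x ->
    (forall z, p z = p x -> z = x \/ z = y) -> w <> p x ->
  nbhs x [set z | z = x \/ C (p x) (p z) w].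
Proof.
move=> ly yx pyx fib wx; have /eqP yx' := yx.
move: X_haus; rewrite open_hausdorff => /(_ _ _ yx')[[V U] /= []].
rewrite !inE => Vy Ux [oV oU VU0].
have VU : V `&` U `<=` set0 by rewrite VU0.
have [v vy vV] := ly V (open_nbhs_nbhs (conj oV Vy)); rewrite pyx in vy vV.
have [u [uv uxw]] : exists u, oint C u (p x) `<=` oint C v (p x) /\ C u (p x) w.
  have [vw|vw] := pselect (v = w).
    have [u vux] := C_arc vy; exists u; split.
      by move=> t utx; exact: (co_right Cco vux utx).1.
    by rewrite -vw; exact: (co_cycle Cco).
  case: (co_total Cco vy (nesym wx) vw) => h; first by exists v; split.
  have [u wux] := C_arc wx; exists u; split; last exact: (co_cycle Cco).
  by move=> t utx; apply: (co_right Cco h _).1; exact: (co_right Cco wux utx).1.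
have Npx : nbhs x (p @^-1` (oint C u w)) by apply: cp; apply: open_nbhs_nbhs.
apply: filterS (filterI (open_nbhs_nbhs (conj oU Ux)) Npx) => z [Uz].
move=> /(oint_split Cco _ uxw)[uzx|/fib[|zy]|]; [|by left| |by right].
  by case: (VU z); split=> //; apply: vV; exact: uv.
by case: (VU z); split=> //; rewrite zy.
Qed.

End arc_ends.

(** Two points of a fibre cannot be ends on the same side, so that a nontrivial
    fibre consists of one right and one left end. *)
Lemma fiber_right_or_left x y : x <> y -> p x = p y ->
  (right_end x /\ left_end y) \/ (left_end x /\ right_end y).
Proof.
have flip_arc (a b : circle R) : a <> b ->
  oint (flip_order (@circle_order R)) a b !=set0.
  by move=> /nesym; exact: circle_oint_neq0.
move=> xy pxy; have [rx|lx] := fiber_end xy pxy.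
  have [ry|ly] := fiber_end (nesym xy) (esym pxy); last by left.
  by case: xy; exact: (arc_end_uniq (circle_order_co R) (@circle_oint_neq0 R)).
have [ry|ly] := fiber_end (nesym xy) (esym pxy); first by right.
by case: xy; exact: (arc_end_uniq (co_flip (circle_order_co R)) flip_arc).
Qed.

End circle_fibers.

(** * The circular order of an almost one-to-one extension of the circle *)

Section extension_order.
Variables (R : realType) (X : topologicalType) (p : X -> circle R).
Hypotheses (X_compact : compact [set: X]) (X_haus : hausdorff_space X).
Hypotheses (cp : continuous p) (p_surj : forall t, exists x, p x = t).
Hypothesis no_isolated : forall x : X, ~ open [set x].
Hypothesis K_limit : limit_point (kernel_pairs p) `<=` diagonal.

Let Rco := circle_order_co R.

Let flip_arc (a b : circle R) : a <> b ->
  oint (flip_order (@circle_order R)) a b !=set0.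
Proof. by move=> /nesym; exact: circle_oint_neq0. Qed.

Let flip_open (a b : circle R) : open (oint (flip_order (@circle_order R)) a b).
Proof. exact: circle_oint_open. Qed.

Lemma right_end_uniq x y : p x = p y -> right_end p x -> right_end p y -> x = y.
Proof. exact: (arc_end_uniq X_haus p_surj Rco (@circle_oint_neq0 R)). Qed.

Lemma left_end_uniq x y : p x = p y -> left_end p x -> left_end p y -> x = y.
Proof. exact: (arc_end_uniq X_haus p_surj (co_flip Rco) flip_arc). Qed.

Let fib_ends x y : x <> y -> p x = p y ->
  (right_end p x /\ left_end p y) \/ (left_end p x /\ right_end p y).
Proof. exact: fiber_right_or_left. Qed.

Definition fiber_nontrivial x := exists y, y <> x /\ p y = p x.

Definition nontrivial_values : set (circle R) := p @` fiber_nontrivial.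
Local Notation A := nontrivial_values.

Definition fiber_upper x := right_end p x /\ fiber_nontrivial x.

Lemma upper_other_left x y : y <> x -> p y = p x -> fiber_upper x ->
  left_end p y.
Proof.
move=> yx pyx [rx _]; have [[ry _]|[]//] := fib_ends yx pyx.
by case: yx; exact: right_end_uniq.
Qed.

Lemma upper_fiber x y : y <> x -> p y = p x -> fiber_upper x ->
  forall z, p z = p x -> z = x \/ z = y.
Proof.
move=> yx pyx ux z pzx; have [|zx] := pselect (z = x); first by left.
right; apply: left_end_uniq; first by rewrite pzx.
  exact: upper_other_left ux.
exact: upper_other_left ux.
Qed.

Lemma order_code_subproof x : (p x, `[< fiber_upper x >]).2 ==>
  `[< A (p x, `[< fiber_upper x >]).1 >].
Proof. by apply/implyP => /= /asboolP[_ nx]; apply/asboolP; exists x. Qed.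

(** The right end of a two-point fibre over a is sent to a^+, the left one
    to a^-. *)
Definition order_code x : split_circle A := SplitCircle (order_code_subproof x).
Local Notation Phi := order_code.

Lemma fiber_upper_uniq x y : p x = p y -> fiber_upper x -> fiber_upper y ->
  x = y.
Proof. by move=> pxy [rx _] [ry _]; exact: right_end_uniq. Qed.

Lemma fiber_upper_or x y : x <> y -> p x = p y ->
  fiber_upper x \/ fiber_upper y.
Proof.
move=> xy pxy; have [[rx _]|[_ ry]] := fib_ends xy pxy; [left|right];
  split=> //.
  by exists y; split=> //; exact: nesym.
by exists x.
Qed.

Lemma order_code_inj : injective Phi.
Proof.
move=> x y e; have pxy : p x = p y by have := congr1 (@split_proj _ _) e.
have u : `[< fiber_upper x >] = `[< fiber_upper y >].
  by have := congr1 (fun q => (split_val q).2) e.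
apply: contrapT => xy; have [ux|uy] := fiber_upper_or xy pxy; apply: xy.
  by apply: fiber_upper_uniq => //; apply/asboolP; rewrite -u; exact/asboolP.
by apply: fiber_upper_uniq => //; apply/asboolP; rewrite u; exact/asboolP.
Qed.

Lemma order_code_triple x y z : split_triple (Phi x) (Phi y) (Phi z) <->
  [/\ x <> y, p x = p y, fiber_upper y, z <> x & z <> y].
Proof.
split=> [[[_ /= xm] [_ /= yp] pxy zx zy]|[xy pxy uy zx zy]].
  split.
  - by move=> e; move: xm yp; rewrite e => ->.
  - exact: pxy.
  - exact/asboolP.
  - by move=> e; apply: zx; rewrite e.
  - by move=> e; apply: zy; rewrite e.
split=> //; last 2 first.
- by move/order_code_inj.
- by move/order_code_inj.
- split; first by exists x => //; exists y; split=> //; exact: nesym.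
  by rewrite /= asboolF// => ux; apply: xy; exact: fiber_upper_uniq.
- by split; [exists y => //; case: uy|rewrite /= asboolT].
Qed.

Definition extension_order (a b c : X) := split_order (Phi a) (Phi b) (Phi c).
Local Notation O := extension_order.

Lemma extension_order_co : circular_order O.
Proof. exact: (co_pullback (split_order_circular A) order_code_inj). Qed.

Lemma extension_orderP a b c : O a b c <->
  circle_order (p a) (p b) (p c) \/
  [\/ [/\ a <> b, p a = p b, fiber_upper b, c <> a & c <> b],
      [/\ b <> c, p b = p c, fiber_upper c, a <> b & a <> c] |
      [/\ c <> a, p c = p a, fiber_upper a, b <> c & b <> a]].
Proof.
split=> [[|[]/order_code_triple h]|[|[]/order_code_triple h]]; try by left.
- by right; apply: Or31.
- by right; apply: Or32.
- by right; apply: Or33.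
- by right; apply: Or31.
- by right; apply: Or32.
- by right; apply: Or33.
Qed.

Let preimage_arc_nbhs a b x : circle_order a (p x) b ->
  nbhs x (p @^-1` (oint (@circle_order R) a b)).
Proof.
by move=> axb; apply: cp; apply: open_nbhs_nbhs; split=> //;
  exact: circle_oint_open.
Qed.

Lemma extension_oint_open a b : open (oint O a b).
Proof.
rewrite openE => x /extension_orderP[axb|[[ax pax ux bx ba]|[xb pxb ub ax
  ab]|[ba pba ua xb xa]]].
- apply: filterS (preimage_arc_nbhs axb) => y ayb.
  by apply/extension_orderP; left.
- have fib := upper_fiber ax pax ux.
  have pbx : p b <> p x by move=> /fib[].
  have := arc_end_nbhs X_haus cp Rco (@circle_oint_neq0 R) (@circle_oint_open R)
    (upper_other_left ax pax ux) ax pax fib pbx.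
  apply: filterS => y [->|xyb]; apply/extension_orderP.
    by right; apply: Or31.
  by left; rewrite pax.
- have fib z : p z = p x -> z = x \/ z = b.
    by rewrite pxb => /(upper_fiber xb pxb ub)[]; [right|left].
  have pax : p a <> p x by move=> /fib[].
  have := arc_end_nbhs X_haus cp (co_flip Rco) flip_arc flip_open
    ub.1 (nesym xb) (esym pxb) fib pax.
  apply: filterS => y [->|axy]; apply/extension_orderP.
    by right; apply: Or32.
  by left; rewrite -pxb.
- have fib := upper_fiber ba pba ua.
  have pxa : p x <> p a by move=> /fib[].
  have : nbhs x (p @^-1` (~` [set p a])).
    apply: cp; apply: open_nbhs_nbhs; split=> //; apply: closed_openC.
    exact: (accessible_closed_set1 (hausdorff_accessible (@circle_hausdorff
      R))).
  apply: filterS => y pya; apply/extension_orderP; right; apply: Or33;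
    split=> //.
    by move=> e; apply: pya; rewrite /= e.
  by move=> e; apply: pya; rewrite /= e.
Qed.

Lemma extension_order_adjacent a b : adjacent O a b -> p a = p b.
Proof.
move=> [ab ab0]; apply: contrapT => /circle_oint_neq0[t atb].
by have [z zt] := p_surj t; apply: (ab0 z); apply/extension_orderP; left;
  rewrite zt.
Qed.

Section extension_dynamics.
Variables (s : homeo X X) (psi : homeo (circle R) (circle R)).
Hypothesis sp : equivariant s psi p.
Hypothesis psi_pres : forall a b c,
  circle_order a b c -> circle_order (psi a) (psi b) (psi c).

Lemma fiber_nontrivial_shift x : fiber_nontrivial (s x) <-> fiber_nontrivial x.
Proof.
split=> -[y [yx pyx]].
  exists (hinv s y); split; first by move=> e; apply: yx; rewrite -e hinvK.
  by apply: (@hfun_inj _ psi); rewrite -!sp hinvK.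
by exists (s y); split; [move/(@hfun_inj _ s)|rewrite !sp pyx].
Qed.

Lemma nontrivial_values_stable t : A (psi t) = A t.
Proof.
apply/propext; split=> -[x nx xt].
  exists (hinv s x); first by apply/fiber_nontrivial_shift; rewrite hinvK.
  by apply: (@hfun_inj _ psi); rewrite -sp hinvK.
by exists (s x); [apply/fiber_nontrivial_shift|rewrite sp xt].
Qed.

Lemma right_end_shift x : right_end p (s x) <-> right_end p x.
Proof.
have psi_refl := co_reflect Rco Rco (@hfun_inj _ psi) psi_pres.
split=> rx U xU.
  have [|w wx wU] := rx (hinv s @^-1` U).
    by apply: (@hinv_continuous _ _ s); rewrite hfunK.
  exists (hinv psi w); first by move=> e; apply: wx; rewrite sp -e hinvK.
  move=> z xzw; rewrite -[z](@hfunK _ _ s); apply: wU.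
  by rewrite /oint /= !sp -[w](@hinvK _ _ psi); exact: psi_pres.
have [|w wx wU] := rx (s @^-1` U); first exact: hfun_continuous.
exists (psi w); first by rewrite sp => /(@hfun_inj _ psi).
move=> z; rewrite -[z](@hinvK _ _ s) => xzw; apply: wU.
by apply: psi_refl; rewrite -!sp.
Qed.

Lemma order_code_shift x : Phi (s x) = split_lift nontrivial_values_stable (Phi
  x).
Proof.
apply: split_circle_eq => /=; first exact: sp.
have us : fiber_upper (s x) <-> fiber_upper x.
  by split=> -[rx nx]; split;
    by [apply/right_end_shift|apply/fiber_nontrivial_shift].
by have [ux|ux] := pselect (fiber_upper x); [rewrite !asboolT//;
  apply/us|rewrite !asboolF// => /us].
Qed.

Lemma extension_order_preserved a b c : O a b c -> O (s a) (s b) (s c).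
Proof.
rewrite /O !order_code_shift.
exact: (split_lift_order nontrivial_values_stable (@hfun_inj _ psi) psi_pres).
Qed.

End extension_dynamics.
End extension_order.

(** The distal quotient is the quotient by proximality.  It is a minimal system on
    the circle, and the proximal pairs are the jumps of the order of X. *)
Lemma distal_circle_split (R : realType) (X : topologicalType) (s : homeo X X)
    (D : equiv_rel X) :
    compact [set: X] -> hausdorff_space X -> minimal_cascade s ->
    limit_point (proximal s) `<=` diagonal ->
    countable (proximal s `\` diagonal) ->
    distal_structure_relation s D ->
    homeo (quotient_space D) (circle R) ->
  exists alpha : R, irrational alpha /\
    exists (A : set (circle R)) (hA : rotation alpha @` A = A),
      countable A /\ cascade_isomorphic s (split_cascade hA).
Proof.
move=> cX hX s_min P'D cP Dstr h.
have [_ [sD _] _] := Dstr.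
have DP := distal_structure_proximal cX hX (proximal_closed P'D) R Dstr.
pose p x := h (quotient_proj D x).
pose psi_fun t := h (quotient_cascade sD (hinv h t)).
pose psi_inv t := h (hinv (quotient_cascade sD) (hinv h t)).
have psiK : cancel psi_fun psi_inv by move=> t;
  rewrite /psi_fun /psi_inv !hfunK hinvK.
have psiVK : cancel psi_inv psi_fun by move=> t;
  rewrite /psi_fun /psi_inv hfunK !hinvK.
have conj_cont (g : quotient_space D -> quotient_space D) : continuous g ->
    continuous (fun t => h (g (hinv h t))).
  move=> cg t; apply: continuous_comp; last exact: hfun_continuous.
  by apply: continuous_comp; [exact: hinv_continuous|exact: cg].
pose psi := Homeo psiK psiVK (conj_cont _ (@hfun_continuous _ _
  (quotient_cascade sD)))
  (conj_cont _ (@hinv_continuous _ _ (quotient_cascade sD))).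
have cp : continuous p.
  move=> x; apply: continuous_comp; last exact: hfun_continuous.
  exact: quotient_proj_continuous.
have p_surj t : exists x, p x = t.
  by exists (repr (hinv h t)); rewrite /p quotient_proj_repr hinvK.
have sp : equivariant s psi p.
  by move=> x; rewrite /p (quotient_proj_equivariant sD) /= /psi_fun hfunK.
have pP x y : p x = p y <-> proximal s (x, y).
  split; first by move=> /(can_inj (@hfunK _ _ h))/quotient_projP/DP.
  by move=> /DP/quotient_projP xy; rewrite /p xy.
have X_inf : infinite_set [set: X].
  move=> Xfin; apply: (@circle_infinite R).
  have -> : [set: circle R] = p @` setT.
    by apply/esym/seteqP; split=> // t _; have [x xt] := p_surj t; exists x.
  exact: finite_image.
have psi_pres := circle_minimal_preserving (minimal_factor cp sp p_surj s_min).
have no_isolated := minimal_not_isolated R cX hX s_min X_inf.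
have K_limit : limit_point (kernel_pairs p) `<=` diagonal.
  have -> // : kernel_pairs p = proximal s.
  by apply/seteqP; split=> -[x y] /pP.
pose O := extension_order p.
have Oco := extension_order_co cX hX cp p_surj no_isolated K_limit.
apply: (@ordered_minimal_split R X s O) => //.
- apply: (compact_oint_basis Oco cX (infinite_third X_inf)).
  exact: (extension_oint_open cX hX cp p_surj no_isolated K_limit).
- exact: (extension_order_preserved sp psi_pres).
- apply: sub_countable cP; apply: subset_card_le => -[x y] /= xy.
  split; last by move=> /diagonalP; exact: xy.1.
  by apply/pP; exact: (extension_order_adjacent cX hX cp p_surj no_isolated
    K_limit xy).
Qed.

(** * Proximality in split rotations *)

Lemma infinite_limit_point (X : topologicalType) (S : set X) :
  compact [set: X] -> infinite_set S -> limit_point S !=set0.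
Proof.
move=> cX Sinf; apply: contrapT => none; apply: Sinf; rewrite -[S]setTI.
apply: (compact_ideal (P := fun A => finite_set (A `&` S))) cX _ _ _ _.
- by rewrite set0I.
- by move=> A B finA finB; rewrite setIUl finite_setU.
- by move=> A B BA; apply: sub_finite_set; exact: setSI.
- move=> x _; apply: contrapT => noU; apply: none; exists x => U xU.
  apply: contrapT => Ux; apply: noU; exists U => //.
  apply: (@sub_finite_set _ _ [set x]) => // y [Uy Sy].
  by apply: contrapT => yx; apply: Ux; exists y; split=> //; exact/eqP.
Qed.

(** The arcs from z up to the jump and from the jump up to z are disjoint, and
    any other jump from one to the other would pass over x, y or z. *)
Lemma jump_isolated (T : Type) (O : T -> T -> T -> Prop) x y z u v :
    circular_order O -> adjacent O x y -> O x y z -> O z u y -> O x v z ->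
    [\/ u = v, adjacent O u v | adjacent O v u] -> u = x /\ v = y.
Proof.
move=> Oco xy xyz zuy xvz uv.
have zxy : O z x y by exact: (co_rot Oco).
have [_ yz _] := circular_order_neq Oco xyz.
have uE : u = x \/ O z u x.
  by case/(oint_split Oco u zxy): zuy => [|->|/xy.2//]; [right|left].
have vE : v = y \/ O y v z.
  by case/(oint_split Oco v xyz): xvz => [/xy.2//|->|]; [left|right].
have xv : O x y v \/ v = y.
  by case: vE => [|yvz]; [right|left; exact: (co_right Oco xyz yvz).2].
have vzx : O v z x.
  case: vE => [->|yvz]; first exact: (co_cycle Oco).
  by apply: (co_cycle Oco); exact: (co_right Oco xyz yvz).1.
have vzu : O v z u.
  case: uE => [->//|zux].
  exact: (co_right Oco vzx zux).2.
case: uv => [e|[_ uv0]|[_ vu0]].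
- by move: vzu; rewrite e => /(circular_order_neq Oco)[].
- case: uE => [ux|zux]; last first.
    case: (uv0 x); apply: (co_left Oco zux _).2.
    by apply: (co_cycle Oco).
  by case: xv => [xyv|->//]; case: (uv0 y); rewrite ux.
- by case: (vu0 z).
Qed.

Section kernel_quotient.
Variables (X Y : topologicalType) (p : X -> Y) (D : equiv_rel X).
Hypotheses (X_compact : compact [set: X]) (Y_haus : hausdorff_space Y).
Hypotheses (cp : continuous p) (p_surj : forall t, exists x, p x = t).
Hypothesis Dp : forall x y, D x y <-> p x = p y.

Lemma kernel_quotient_homeo : exists h : homeo (quotient_space D) Y,
  forall x, h (quotient_proj D x) = p x.
Proof.
pose h (q : quotient_space D) := p (repr q).
have hE x : h (quotient_proj D x) = p x.
  by apply/Dp/quotient_projP; rewrite quotient_proj_repr.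
have /choice[g gp] := p_surj.
pose k t := quotient_proj D (g t).
have hK : cancel h k.
  move=> q; rewrite -[RHS]quotient_proj_repr; apply/quotient_projP/Dp.
  exact: gp.
have kK : cancel k h by move=> t; rewrite /k hE gp.
have ch : continuous h.
  apply/quotient_continuous; have -> // : h \o \pi_(quotient_space D)%qT = p.
  by apply/funext => x; exact: hE.
have ck : continuous k.
  apply/continuousP => U oU.
  have -> : k @^-1` U = ~` (p @` (~` (quotient_proj D @^-1` U))).
    apply/seteqP; split=> t.
      move=> Ukt [x nUx xt]; apply: nUx; rewrite /=.
      have <- // : k t = quotient_proj D x.
      by apply/quotient_projP/Dp; rewrite gp.
    by move=> nt; apply: contrapT => nUkt; apply: nt; exists (g t).
  apply: closed_openC; apply: compact_closed => //.
  apply: continuous_compact; first exact: continuous_subspaceT.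
  apply: (subclosed_compact _ X_compact) => //; apply: open_closedC.
  by apply: open_comp => // x _; exact: quotient_proj_continuous.
by exists (Homeo hK kK ch ck).
Qed.

End kernel_quotient.

(** The rotation that takes t to u commutes with the cascade, so it fixes any
    point that the orbits of t and u approach simultaneously. *)
Lemma rotation_distal (R : realType) (a : R) t u :
  proximal (rotation a) (t, u) -> t = u.
Proof.
have [x <- _] := circle_pi_lift t 0; have [y <- _] := circle_pi_lift u 0.
move=> /proximalP[r rr]; have rotE n : hpow (rotation a) n (circle_pi y) =
    rotation (y - x) (hpow (rotation a) n (circle_pi x)).
  by rewrite !hpow_rotation_pi rotation_pi; congr circle_pi; ring.
have : rotation (y - x) r = r.
  apply: (@circle_hausdorff R) => U V rU rV.
  have [n [Un Vn]] := rr _ _ (@hfun_continuous _ _ (rotation (y - x)) _ _ rU)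
    rV.
  by exists (hpow (rotation a) n (circle_pi y)); split; rewrite // rotE.
have [z <- _] := circle_pi_lift r 0; rewrite rotation_pi => /circle_pi_eq.
by rewrite addrC addKr => h; apply/esym/circle_pi_eq.
Qed.

Section split_projection.
Variables (R : realType) (A : set (circle R)).

Definition split_low t : split_circle A := @SplitCircle R A (t, false) isT.

Lemma split_high_subproof t : (t, `[< A t >]).2 ==> `[< A (t, `[< A t >]).1 >].
Proof. by apply/implyP. Qed.

Definition split_high t : split_circle A := SplitCircle (split_high_subproof t).

Lemma split_proj_low t : split_proj (split_low t) = t. Proof. by []. Qed.

Lemma split_proj_arc a b q : a <> b ->
  split_order (split_high a) q (split_low b) <-> circle_order a (split_proj q)
    b.
Proof.
move=> ab; split; last by left.
case=> [//|[[[+ +] _ _ _ _]|[_ [_ //] _ _ _]|[_ _ e _ _]]].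
  by rewrite /split_proj /= => /asboolP ->.
by case: ab; rewrite -(split_proj_low b) e.
Qed.

Lemma split_proj_continuous : continuous (@split_proj R A).
Proof.
move=> q V /(basis_oint_nbhs (@circle_basis R))[a [b [ab aqb abV]]].
apply: (@filterS _ _ _ (oint (@split_order R A) (split_high a) (split_low b))).
  by move=> r /(split_proj_arc _ ab) arb; exact: abV.
apply: open_nbhs_nbhs; split; last exact/(split_proj_arc _ ab).
exact: (basis_oint_open (split_order_circular A) _ _ (split_basis A)).
Qed.

Lemma split_proj_adjacent p q : p <> q -> split_proj p = split_proj q ->
  A (split_proj p) /\
  (adjacent (@split_order R A) p q \/ adjacent (@split_order R A) q p).
Proof.
have jump r t : split_proj r = split_proj t -> (split_val r).2 = false ->
    (split_val t).2 = true ->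
      A (split_proj r) /\ adjacent (@split_order R A) r t.
  move=> rt r0 t1; have tp := is_plusP t1.
  have Ar : A (split_proj r) by rewrite rt; case: tp.
  split=> //; split=> [e|u rut]; first by rewrite e t1 in r0.
  have [ru ut _] := circular_order_neq (split_order_circular A) rut.
  apply: (co_asym (split_order_circular A) rut); right; apply: Or31.
  by split=> //; exact: nesym.
move=> pq epq; case p2 : (split_val p).2; case q2 : (split_val q).2.
- by case: pq; apply: split_circle_eq; rewrite ?p2.
- by have [? ?] := jump _ _ (esym epq) q2 p2; rewrite epq; split; [|right].
- by have [? ?] := jump _ _ epq p2 q2; split; [|left].
- by case: pq; apply: split_circle_eq; rewrite ?p2.
Qed.

End split_projection.

(** Pairs with the same projection accumulate only on the diagonal.  The orbit of
    such a pair is infinite, so it does accumulate there: the pair is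
    proximal. *)
Lemma split_distal_structure (R : realType) (X : topologicalType)
    (s : homeo X X) (alpha : R) (A : set (circle R))
    (hA : rotation alpha @` A = A) :
    compact [set: X] -> hausdorff_space X -> minimal_cascade s ->
    countable A -> cascade_isomorphic s (split_cascade hA) ->
  [/\ limit_point (proximal s) `<=` diagonal,
      countable (proximal s `\` diagonal) &
      exists2 D : equiv_rel X, distal_structure_relation s D &
        inhabited (homeo (quotient_space D) (circle R))].
Proof.
move=> cX hX s_min cA [h hs].
pose p x := split_proj (h x).
have cp : continuous p.
  move=> x; apply: (@continuous_comp _ _ _ h (@split_proj R A)).
    exact: hfun_continuous.
  exact: split_proj_continuous.
have p_surj t : exists x, p x = t.
  by exists (hinv h (split_low A t)); rewrite /p hinvK.
have sp : equivariant s (rotation alpha) p by move=> x; rewrite /p hs.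
have X_inf : infinite_set [set: X].
  move=> Xfin; apply: (@circle_infinite R).
  have -> : [set: circle R] = p @` setT.
    by apply/esym/seteqP; split=> // t _; have [x xt] := p_surj t; exists x.
  exact: finite_image.
pose O a b c := split_order (h a) (h b) (h c).
have hI := can_inj (@hfunK _ _ h).
have Oco : circular_order O := co_pullback (split_order_circular A) hI.
have O_open a b : open (oint O a b).
  apply: (@open_comp _ _ h (oint (@split_order R A) (h a) (h b))).
    by move=> x _; exact: (@hfun_continuous _ _ h).
  exact: (basis_oint_open (split_order_circular A) _ _ (split_basis A)).
have O_adj x y : adjacent (@split_order R A) (h x) (h y) -> adjacent O x y.
  move=> [xy xy0]; split=> [e|u]; first by apply: xy; rewrite e.
  exact: xy0.
have p_adj x y : x <> y -> p x = p y -> adjacent O x y \/ adjacent O y x.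
  move=> xy /(@split_proj_adjacent R A)[|_ [|]]; first by move=> /hI.
  - by move=> /O_adj; left.
  - by move=> /O_adj; right.
have p_kernel x y : p x = p y -> [\/ x = y, adjacent O x y | adjacent O y x].
  have [->|xy] := pselect (x = y); first by move=> _; exact: Or31.
  by move=> /(p_adj _ _ xy)[|]; [exact: Or32|exact: Or33].
have K_limit : limit_point (kernel_pairs p) `<=` diagonal.
  move=> [x y] lxy; apply: contrapT => /diagonalP xy.
  have isolated u v : adjacent O u v -> exists U V, [/\ nbhs u U, nbhs v V &
      forall u' v', U u' -> V v' -> p u' = p v' -> u' = u /\ v' = v].
    move=> uv; have [z [zu zv]] := infinite_third X_inf u v.
    have uvz : O u v z.
      case: (co_cases Oco z uv.1) => // [/uv.2//|]; exact: (co_rot Oco).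
    exists (oint O z v), (oint O u z); split.
    - by apply: open_nbhs_nbhs; split=> //; exact: (co_rot Oco).
    - by apply: open_nbhs_nbhs; split.
    - by move=> u' v' zuv' uvz' /p_kernel; exact: jump_isolated uvz zuv' uvz'.
  have pxy : p x = p y.
    by apply: (@kernel_pairs_closed R X p cp (x, y)); exact: subset_limit_point.
  have [/isolated[U [V [xU yV UV]]]|/isolated[V [U [yV xU UV]]]]
    := p_adj _ _ xy pxy.
    have [|[x' y'] [/eqP nxy Kxy [/= Ux Vy]]] := lxy (U `*` V);
      first by exists (U, V).
    by have [e1 e2] := UV _ _ Ux Vy Kxy; apply: nxy; rewrite e1 e2.
  have [|[x' y'] [/eqP nxy Kxy [/= Ux Vy]]] := lxy (U `*` V);
    first by exists (U, V).
  by have [e1 e2] := UV _ _ Vy Ux (esym Kxy); apply: nxy; rewrite e1 e2.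
have proxP x y : proximal s (x, y) <-> p x = p y.
  split=> [/(proximal_factor cp sp)/rotation_distal//|pxy].
  pose orb := range (fun n : int => (hpow s n x, hpow s n y)).
  have orb_inf : infinite_set orb.
    move=> orb_fin; apply: infinite_nat.
    have -> : [set: nat] = (fun n : nat => (hpow s n x, hpow s n y)) @^-1` orb.
      by apply/esym/seteqP; split=> // n _; exists (Posz n).
    apply: finite_preimage orb_fin => m n _ _ [].
    by move=> /(@hpow_index_inj _ _ s_min X_inf hX x (Posz m) (Posz n))[].
  have cXX : compact [set: X * X] by rewrite -setXTT; exact: compact_setX.
  have [q ql] := infinite_limit_point cXX orb_inf.
  exists q; split; first exact: subset_limit_point.
  apply: K_limit => U /ql[r [rq [n _ nr] Ur]]; exists r; split=> //.
  by rewrite -nr /kernel_pairs /= !(hpow_equivariant _ _ sp) pxy.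
have proxE : proximal s = kernel_pairs p.
  by apply/seteqP; split=> -[x y] /proxP.
split; first by rewrite proxE.
  have /countable_injP[k kI] := cA.
  apply/countable_injP.
  exists (fun q : X * X => pickle (k (p q.1), (split_val (h q.1)).2)).
  move=> [x y] [x' y']; rewrite !inE => -[/proxP pxy /diagonalP xy].
  move=> [/proxP pxy' /diagonalP xy'] /= /(pcan_inj pickleK)[].
  have Apx u v : u <> v -> p u = p v -> p u \in A.
    by move=> uv /(@split_proj_adjacent R A)[|? _]; [move/hI|rewrite inE].
  move=> /(kI _ _ (Apx _ _ xy pxy) (Apx _ _ xy' pxy')) pxx' bxx'.
  have xx' : x = x' by apply: hI; apply: split_circle_eq.
  have bit u v : u <> v -> p u = p v ->
    (split_val (h v)).2 = ~~ (split_val (h u)).2.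
    move=> uv puv; case u2 : (split_val (h u)).2;
      case v2 : (split_val (h v)).2 => //.
      by case: uv; apply: hI; apply: split_circle_eq => //; rewrite u2 v2.
    by case: uv; apply: hI; apply: split_circle_eq => //; rewrite u2 v2.
  have -> : y = y'; last by rewrite xx'.
  apply: hI; apply: split_circle_eq; first by rewrite -[LHS]pxy -[RHS]pxy'.
  by rewrite (bit _ _ xy pxy) (bit _ _ xy' pxy') bxx'.
pose d x y := `[< p x = p y >].
have d_equiv : equiv_class_of d.
  split=> [x|x y|y x z]; first exact/asboolP.
  - by apply/asboolP/asboolP => ->.
  - by move=> /asboolP xy /asboolP yz; apply/asboolP; rewrite xy.
pose D : equiv_rel X := EquivRelPack d_equiv.
have DP x y : D x y <-> p x = p y by split=> /asboolP.
have [g gp] := kernel_quotient_homeo cX (@circle_hausdorff R) cp p_surj DP.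
exists D; last by split.
split.
- rewrite /closed_rel; have -> : [set q : X * X | D q.1 q.2] = kernel_pairs p.
    by apply/seteqP; split=> -[x y] /DP.
  exact: kernel_pairs_closed.
- have sD : rel_invariant s D.
    move=> x y; apply/idP/idP => /DP pxy; apply/DP; last by rewrite !sp pxy.
    by apply: (@hfun_inj _ (rotation alpha)); rewrite -!sp.
  exists sD; apply/seteqP; split=> -[q r]; last by move=> /diagonalP ->;
    exact: proximal_refl.
  have gs : equivariant (quotient_cascade sD) (rotation alpha) g.
    move=> q'; rewrite -[q']quotient_proj_repr -(quotient_proj_equivariant sD)
      !gp.
    exact: sp.
  move=> /(proximal_factor (@hfun_continuous _ _ g) gs)/rotation_distal.
  by move=> /(can_inj (@hfunK _ _ g)) ->.
- move=> E Ecl Edist x y /DP/proxP; exact: proximal_distal_quotient.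
Qed.

(** * Denjoy homeomorphisms *)

Section jump_function.
Variables (R : realType) (A : set (circle R)) (k : circle R -> nat).
Hypothesis kI : {in A &, injective k}.

Definition jump_before (x : R) n :=
  exists a, [/\ A a, k a = n & circle_coord a < x].

Definition jump_partial (x : R) N : R :=
  \sum_(n < N) 2^-1 ^+ n.+1 * (`[< jump_before x n >])%:R.

(** The sum of the weights 2 ^ - (k a + 1) of the points a of A before x. *)
Definition jump_sum (x : R) : R := sup (range (jump_partial x)).
Local Notation S := jump_sum.

Definition jump_weight (t : circle R) : R :=
  if `[< A t >] then 2^-1 ^+ (k t).+1 else 0.
Local Notation w := jump_weight.

Let c n : R := 2^-1 ^+ n.+1.

Let c_gt0 n : 0 < c n. Proof. by rewrite exprn_gt0// invr_gt0. Qed.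

Lemma jump_partial_tail x N j : jump_partial x N <= jump_partial x (N + j)
  <= jump_partial x N + 2^-1 ^+ N - 2^-1 ^+ (N + j).
Proof.
elim: j => [|j /andP[IH1 IH2]]; first by rewrite addn0 addrK lexx.
rewrite addnS /jump_partial big_ord_recr /= -/(jump_partial x (N + j))
  -/(jump_partial x N).
have := c_gt0 (N + j); rewrite /c exprS;
  move: (2^-1 ^+ (N + j)) IH2 => e IH2 e0.
by case: asboolP => _; rewrite ?mulr1 ?mulr0; apply/andP; split; lra.
Qed.

Lemma jump_partial_le x M N : jump_partial x M <= jump_partial x N + 2^-1 ^+ N.
Proof.
have e0 j : 0 < 2^-1 ^+ j :> R by rewrite exprn_gt0// invr_gt0.
have [MN|/ltnW NM] := leqP M N.
  have := jump_partial_tail x M (N - M); rewrite subnKC//.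
  by have := e0 N; lra.
have := jump_partial_tail x N (M - N); rewrite subnKC//.
by have := e0 M; lra.
Qed.

Lemma jump_sum_ub x b : (forall N, jump_partial x N <= b) -> S x <= b.
Proof.
move=> xb; apply: ge_sup; first by exists (jump_partial x 0), 0%N.
by move=> _ [N _ <-].
Qed.

Lemma jump_partial_sum x N : jump_partial x N <= S x.
Proof.
apply: ub_le_sup; last by exists N.
exists (jump_partial x 0 + 2^-1 ^+ 0) => _ [M _ <-].
exact: jump_partial_le.
Qed.

Lemma jump_sum_partial x N : S x <= jump_partial x N + 2^-1 ^+ N.
Proof. by apply: jump_sum_ub => M; exact: jump_partial_le. Qed.

Lemma jump_weight_ge0 t : 0 <= w t.
Proof.
by rewrite /w; case: asboolP => // _; rewrite exprn_ge0// invr_ge0.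
Qed.

Lemma jump_weight_gt0 t : A t -> 0 < w t.
Proof. by move=> At; rewrite /w asboolT// exprn_gt0// invr_gt0. Qed.

Lemma jump_weightE t : A t -> w t = 2^-1 ^+ (k t).+1.
Proof. by move=> At; rewrite /w asboolT. Qed.

Lemma jump_weightN t : ~ A t -> w t = 0.
Proof. by move=> At; rewrite /w asboolF. Qed.

Lemma jump_sum_le x y : x <= y -> S x <= S y.
Proof.
move=> xy; apply: jump_sum_ub => N; apply: le_trans (jump_partial_sum y N).
apply: ler_sum => n _; rewrite ler_pM2l ?exprn_gt0 ?invr_gt0//.
case: asboolP => [[a [Aa ka ax]]|_]; last by rewrite ler0n.
by rewrite asboolT//; exists a; split=> //; exact: lt_le_trans xy.
Qed.

Lemma jump_sum_jump t y : circle_coord t < y -> S (circle_coord t) + w t <= S y.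
Proof.
move=> ty; have [At|At] := pselect (A t); last first.
  by rewrite jump_weightN// addr0; exact/jump_sum_le/ltW.
rewrite -lerBrDr; apply: jump_sum_ub => N; rewrite lerBrDr.
pose M := (N + (k t).+1)%N.
apply: le_trans (jump_partial_sum y M).
have /andP[NM _] := jump_partial_tail (circle_coord t) N (k t).+1.
apply: (@le_trans _ _ (jump_partial (circle_coord t) M + w t));
  first by rewrite lerD2r.
have kM : (k t < M)%N by rewrite /M addnS ltnS leq_addl.
rewrite /jump_partial (bigD1 (Ordinal kM)) //= [leRHS](bigD1 (Ordinal kM)) //=.
rewrite asboolF; last first.
  move=> [a [Aa kat]]; have -> : a = t by apply: kI; rewrite ?inE.
  by rewrite ltxx.
rewrite mulr0 add0r addrC asboolT ?mulr1; last by exists t.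
rewrite jump_weightE// lerD2r; apply: ler_sum => n _.
rewrite ler_pM2l ?exprn_gt0 ?invr_gt0//.
case: asboolP => [[a [Aa ka ax]]|_]; last by rewrite ler0n.
by rewrite asboolT//; exists a; split=> //; exact: lt_trans ty.
Qed.

Lemma half_pow_lt (e : R) : 0 < e -> exists N, 2^-1 ^+ N < e.
Proof.
move=> e0; have : (fun n => 2^-1 ^+ n : R) @ \oo --> 0.
  by apply: cvg_expr; rewrite ger0_norm; lra.
move=> /cvgr0Pnorm_lt/(_ e e0)[N _ /(_ N)] /= h; exists N.
by have := h (leqnn N); rewrite ger0_norm// exprn_ge0// invr_ge0.
Qed.

(** Finitely many points of A carry all of the sum up to e, and y may be taken
    beyond those of them that lie before x. *)
Lemma jump_sum_left x e : 0 < e -> exists2 y, y < x & S x <= S y + e.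
Proof.
move=> /half_pow_lt[N Ne].
suff [y yx Ny] : exists2 y, y < x & forall n,
  (n < N)%N -> jump_before x n -> jump_before y n.
  exists y => //; apply: le_trans (jump_sum_partial x N) _.
  have := jump_partial_sum y N.
  suff : jump_partial x N <= jump_partial y N by lra.
  apply: ler_sum => n _; rewrite ler_pM2l ?exprn_gt0 ?invr_gt0//.
  by case: asboolP => [/(Ny _ (ltn_ord n))/asboolT ->//|_]; rewrite ler0n.
elim: N {Ne} => [|N [y yx IH]]; first by exists (x - 1) => //; lra.
have [[a [Aa ka ax]]|nb] := pselect (jump_before x N); last first.
  by exists y => // n; rewrite ltnS leq_eqVlt => /orP[/eqP->//|]; exact: IH.
exists (Num.max y ((circle_coord a + x) / 2)); first by rewrite gt_max yx /=;
  lra.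
move=> n; rewrite ltnS leq_eqVlt => /orP[/eqP-> _|nN /(IH _ nN)[b [Ab kb yb]]].
  by exists a; split=> //; rewrite lt_max; apply/orP; right; lra.
by exists b; split=> //; rewrite lt_max yb.
Qed.

(** Finitely many points of A carry all of the sum up to e, and y may be taken
    before those of them that lie after t. *)
Lemma jump_sum_right t e : 0 < e ->
  exists2 y, circle_coord t < y & S y <= S (circle_coord t) + w t + e.
Proof.
move=> /half_pow_lt[N Ne]; set x := circle_coord t.
suff [y xy Ny] : exists2 y, x < y & forall n, (n < N)%N -> jump_before y n ->
    jump_before x n \/ A t /\ k t = n.
  exists y => //; apply: le_trans (jump_sum_partial y N) _.
  have := jump_partial_sum x N.
  suff : jump_partial y N <= jump_partial x N + w t by lra.
  have wE : \sum_(n < N) c n * (`[< A t /\ k t = n >])%:R <= w t.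
    have [At|At] := pselect (A t); last first.
      rewrite jump_weightN// big1// => n _.
      by rewrite asboolF ?mulr0// => -[].
    have [tN|Nt] := ltnP (k t) N.
      rewrite (bigD1 (Ordinal tN)) //= big1 ?addr0.
        by rewrite asboolT// mulr1 jump_weightE.
      move=> n nt; rewrite asboolF ?mulr0// => -[_ e1].
      by case/eqP: nt; apply: val_inj.
    rewrite big1 ?jump_weight_ge0// => n _; rewrite asboolF ?mulr0// => -[_ e1].
    by have := ltn_ord n; rewrite -e1 ltnNge Nt.
  suff : jump_partial y N <= jump_partial x N +
      \sum_(n < N) c n * (`[< A t /\ k t = n >])%:R by lra.
  rewrite -big_split /=; apply: ler_sum => n _; rewrite -mulrDr ler_pM2l//.
  case: asboolP => [/(Ny _ (ltn_ord n))[h|h]|_];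
    last by rewrite addr_ge0 ?ler0n.
    by rewrite (asboolT h) lerDl ler0n.
  by rewrite (asboolT h) lerDr ler0n.
elim: N {Ne} => [|N [y xy IH]]; first by exists (x + 1) => //; lra.
have [[a [Aa ka ax]]|nb] := pselect (exists a, [/\ A a,
  k a = N & x < circle_coord a]).
  exists (Num.min y (circle_coord a)); first by rewrite lt_min xy.
  move=> n; rewrite ltnS leq_eqVlt => /orP[/eqP-> [b [Ab kb]]|nN [b [Ab kb]]].
    have -> : b = a by apply: kI; rewrite ?inE// kb.
    by rewrite lt_min ltxx andbF.
  rewrite lt_min => /andP[yb _]; apply: IH => //.
  by exists b.
exists y => // n; rewrite ltnS leq_eqVlt => /orP[/eqP-> [b [Ab kb _]]|];
  last exact: IH.
have [bx|xb|/circle_coord_inj bt] := ltgtP (circle_coord b) x.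
- by left; exists b.
- by case: nb; exists b.
- by right; rewrite -bt.
Qed.

Lemma jump_sum0 : S 0 = 0.
Proof.
have p0 N : jump_partial 0 N = 0.
  rewrite /jump_partial big1// => n _; rewrite asboolF ?mulr0// => -[a [_ _]].
  by have /andP[a0 _] := circle_coord_itv a; rewrite ltNge a0.
apply/le_anti/andP; split; first by apply: jump_sum_ub => N; rewrite p0.
by have := jump_partial_sum 0 0; rewrite p0.
Qed.

(** ** The blown-up circle *)

(** The pairs (t, r) with r in [0, 1], and r = 0 for t outside A, parametrize the
    circle obtained by inserting an interval in place of each point of A. *)
Definition blowup_point (q : circle R * R) :=
  0 <= q.2 <= 1 /\ (A q.1 \/ q.2 = 0).

Definition blowup_lt (q q' : circle R * R) :=
  circle_coord q.1 < circle_coord q'.1 \/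
  circle_coord q.1 = circle_coord q'.1 /\ q.2 < q'.2.

Definition blowup_length := 1 + S 1.
Local Notation L := blowup_length.

Definition blowup_pos (q : circle R * R) :=
  circle_coord q.1 + S (circle_coord q.1) + q.2 * w q.1.

Definition blowup (q : circle R * R) := circle_pi (blowup_pos q / L).

Lemma jump_sum_ge0 x : 0 <= S x.
Proof. by have := jump_partial_sum x 0; rewrite /jump_partial big_ord0. Qed.

Lemma blowup_length_gt0 : 0 < L.
Proof. by have := jump_sum_ge0 1; rewrite /L; lra. Qed.

Lemma blowup_pos_itv q : blowup_point q -> 0 <= blowup_pos q < L.
Proof.
move=> [/andP[r0 r1] _]; have /andP[t0 t1] := circle_coord_itv q.1.
have := jump_sum_jump t1; have := jump_sum_ge0 (circle_coord q.1).
have := jump_weight_ge0 q.1; rewrite /blowup_pos /L => w0 S0 S1.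
have : 0 <= q.2 * w q.1 <= w q.1 by rewrite mulr_ge0//= ler_piMl.
by move=> /andP[? ?]; apply/andP; split; lra.
Qed.

Lemma blowup_pos_lt q q' : blowup_point q -> blowup_point q' ->
  blowup_lt q q' -> blowup_pos q < blowup_pos q'.
Proof.
move=> [/andP[r0 r1] v] [/andP[r0' r1'] v'] [tt'|[/circle_coord_inj tt' rr']].
  have := jump_sum_jump tt'; have := jump_weight_ge0 q.1;
    rewrite /blowup_pos => w0 St.
  have : q.2 * w q.1 <= w q.1 by rewrite ler_piMl.
  have : 0 <= q'.2 * w q'.1 by rewrite mulr_ge0// jump_weight_ge0.
  by lra.
have At : A q'.1 by case: v' => // e; move: rr'; rewrite e; lra.
by rewrite /blowup_pos tt' ltrD2l ltr_pM2r// jump_weight_gt0.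
Qed.

Lemma blowup_coord q : blowup_point q ->
  circle_coord (blowup q) = blowup_pos q / L.
Proof.
move=> /blowup_pos_itv/andP[q0 q1]; apply: circle_coord_pi.
by rewrite divr_ge0 ?(ltW blowup_length_gt0)//= ltr_pdivrMr
  ?blowup_length_gt0// mul1r.
Qed.

Lemma blowup_mono q q' : blowup_point q -> blowup_point q' ->
  blowup_lt q q' -> circle_lt (blowup q) (blowup q').
Proof.
move=> v v' qq'; rewrite /circle_lt !blowup_coord//.
by rewrite ltr_pM2r ?invr_gt0 ?blowup_length_gt0//; exact: blowup_pos_lt.
Qed.

Lemma blowup_lt_total q q' : q <> q' -> blowup_lt q q' \/ blowup_lt q' q.
Proof.
case: q q' => [t r] [t' r'] qq'; rewrite /blowup_lt /=.
have [tt'|tt'|tt'] := ltgtP (circle_coord t) (circle_coord t'); [by left;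
  left|by right; left|].
have [rr'|rr'|rr'] := ltgtP r r'; [by left; right|by right; right|].
by case: qq'; rewrite rr' (circle_coord_inj tt').
Qed.

Lemma blowup_inj q q' : blowup_point q -> blowup_point q' ->
  blowup q = blowup q' -> q = q'.
Proof.
move=> v v' e; apply: contrapT => /blowup_lt_total[] /blowup_mono h.
  by have := h v v'; rewrite /circle_lt e ltxx.
by have := h v' v; rewrite /circle_lt e ltxx.
Qed.

Lemma blowup_reflect q q' : blowup_point q -> blowup_point q' ->
  circle_lt (blowup q) (blowup q') -> blowup_lt q q'.
Proof.
move=> v v' qq'; have [|//|q'q] := @blowup_lt_total q q'.
  by move=> e; move: qq'; rewrite e /circle_lt ltxx.
by have := lt_trans qq' (blowup_mono v' v q'q); rewrite ltxx.
Qed.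

Lemma blowup_order q1 q2 q3 : blowup_point q1 -> blowup_point q2 ->
  blowup_point q3 ->
  circle_order (blowup q1) (blowup q2) (blowup q3) <->
  cyclic_of blowup_lt q1 q2 q3.
Proof.
move=> v1 v2 v3; split=> [/circle_orderE|h]; last apply/circle_orderE;
  last first.
  by case: h => -[h h']; [apply: Or31|apply: Or32|apply: Or33]; split;
    exact: blowup_mono.
by case=> -[h h']; [apply: Or31|apply: Or32|apply: Or33]; split;
  exact: blowup_reflect.
Qed.

(** The position function jumps over no value: at the last x with
    x + S x <= z, its left and right limits enclose z. *)
Lemma blowup_surj d : exists q, blowup_point q /\ blowup q = d.
Proof.
suff [q [vq qz]] : exists q,
  blowup_point q /\ blowup_pos q = circle_coord d * L.
  exists q; split=> //; rewrite /blowup qz mulfK ?gt_eqF ?blowup_length_gt0//.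
  exact: circle_pi_coord.
have /andP[d0 d1] := circle_coord_itv d; set z := _ * L.
have z0 : 0 <= z by rewrite mulr_ge0// (ltW blowup_length_gt0).
have zL : z < 1 + S 1 by rewrite -/L /z gtr_pMl// blowup_length_gt0.
pose E := [set x : R | 0 <= x <= 1 /\ x + S x <= z].
have E0 : E 0 by rewrite /E /= lexx ler01 jump_sum0 addr0.
have supE : has_sup E by split; [exists 0|exists 1 => x [/andP[]]].
pose x := sup E.
have x0 : 0 <= x by apply: ub_le_sup => //; exact: supE.2.
have x1 : x <= 1 by apply: ge_sup; [exists 0|move=> y [/andP[]]].
have xz : x + S x <= z.
  rewrite leNgt; apply/negP => zx; pose e := (x + S x - z) / 3.
  have e0 : 0 < e by rewrite /e; lra.
  have [y yx Sy] := jump_sum_left x e0.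
  have [y' Ey' y'x] := sup_adherent (eps :=
    Num.min (x - y) e) ltac:(by rewrite lt_min subr_gt0 yx e0) supE.
  have m1 : Num.min (x - y) e <= x - y by rewrite ge_min lexx.
  have m2 : Num.min (x - y) e <= e by rewrite ge_min lexx orbT.
  rewrite -/x in y'x; have [_ y'z] := Ey'.
  have yy' : y <= y' by lra.
  have xe : x - e < y' by lra.
  by have := jump_sum_le yy'; rewrite /e in Sy xe; lra.
have x1' : x < 1 by rewrite lt_neqAle x1 andbT; apply/eqP => e; move: xz;
  rewrite e; lra.
pose t := circle_pi x.
have tx : circle_coord t = x by apply: circle_coord_pi; rewrite x0 x1'.
have zx : z <= x + S x + w t.
  rewrite leNgt; apply/negP => xz'; pose e := (z - (x + S x + w t)) / 3.
  have e0 : 0 < e by rewrite /e; lra.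
  have [y] := jump_sum_right t e0; rewrite tx => xy Sy.
  pose y' := Num.min y (Num.min (x + e) 1).
  have xy' : x < y' by rewrite !lt_min xy x1' ltrDl e0.
  have [y'y y'e y'1] : [/\ y' <= y, y' <= x + e & y' <= 1].
    by rewrite /y' !ge_min !lexx !orbT.
  have : y' <= x.
    apply: ub_le_sup; first exact: supE.2.
    split; first by apply/andP; split; lra.
    by have := jump_sum_le y'y; rewrite /e in Sy y'e; lra.
  by lra.
have [At|At] := pselect (A t).
  have wt := jump_weight_gt0 At.
  exists (t, (z - (x + S x)) / w t); split; last first.
    by rewrite /blowup_pos /= tx divfK ?gt_eqF//; ring.
  split; last by left.
  rewrite /= divr_ge0 ?subr_ge0 ?(ltW wt)//= ler_pdivrMr// mul1r; lra.
exists (t, 0); split; first by split; [rewrite /= lexx ler01|right].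
by rewrite /blowup_pos /= tx mul0r addr0; move: zx; rewrite jump_weightN//; lra.
Qed.

End jump_function.

(** ** The Denjoy homeomorphism of a split rotation *)

Lemma irrational_multiple (R : realType) (alpha : R) (n : nat) :
  irrational alpha -> (0 < n)%N -> alpha *~ Posz n \is a Num.int -> False.
Proof.
move=> alpha_irr n0 /intrP[k ak]; apply: alpha_irr.
exists (k%:~R / n%:R) => //; rewrite fmorph_div /= ratr_int ratr_nat -ak.
by rewrite -mulrzr mulfK// pnatr_eq0 -lt0n.
Qed.

Section denjoy.
Variables (R : realType) (A : set (circle R)) (k : circle R -> nat).
Hypothesis kI : {in A &, injective k}.
Local Notation blowup := (blowup A k).
Local Notation blowup_point := (blowup_point A).

Definition blowup_rotate (b : R) (q : circle R * R) := (rotation b q.1, q.2).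

(** A rotation keeps the order of two points, unless exactly the later one wraps
    around. *)
Lemma blowup_rotate_wrap b : exists wrap : circle R * R -> bool, forall q q',
  blowup_lt q q' ->
    blowup_lt (blowup_rotate b q) (blowup_rotate b q') /\ wrap q = wrap q' \/
    [/\ blowup_lt (blowup_rotate b q') (blowup_rotate b q), wrap q = false &
        wrap q' = true].
Proof.
have [c cE] := circle_coord_rotation b.
pose wrap t := `[< circle_coord (rotation_fun b t) = circle_coord t + c - 1 >].
have wrapT t : wrap t = true ->
  circle_coord (rotation_fun b t) = circle_coord t + c - 1.
  by move=> /asboolP.
have wrapF t : wrap t = false ->
  circle_coord (rotation_fun b t) = circle_coord t + c.
  by move=> /negbT/asboolPn; case: (cE t).
exists (fun q => wrap q.1) => -[t r] [t' r'];
  rewrite /blowup_lt /blowup_rotate /=.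
have /andP[] := circle_coord_itv t; have /andP[] := circle_coord_itv t'.
have /andP[] := circle_coord_itv (rotation_fun b t).
have /andP[] := circle_coord_itv (rotation_fun b t').
case wt : (wrap t); case wt' : (wrap t').
- move: (wrapT _ wt) (wrapT _ wt') => -> -> ? ? ? ? ? ? ? ? [?|[? ?]]; left;
  split=> //.
    by left; lra.
  by right; split=> //; lra.
- by move: (wrapT _ wt) (wrapF _ wt') => -> -> ? ? ? ? ? ? ? ? [?|[? ?]];
  exfalso; lra.
- by move: (wrapF _ wt) (wrapT _ wt') => -> -> ? ? ? ? ? ? ? ? [?|[? ?]];
  right; split=> //; left; lra.
- move: (wrapF _ wt) (wrapF _ wt') => -> -> ? ? ? ? ? ? ? ? [?|[? ?]]; left;
  split=> //.
    by left; lra.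
  by right; split=> //; lra.
Qed.

Lemma blowup_rotate_lt b q1 q2 q3 : cyclic_of (@blowup_lt R) q1 q2 q3 ->
  cyclic_of (@blowup_lt R) (blowup_rotate b q1) (blowup_rotate b q2)
    (blowup_rotate b q3).
Proof.
have [wrap wrapP] := blowup_rotate_wrap b.
have sorted p q r : blowup_lt p q -> blowup_lt q r ->
    cyclic_of (@blowup_lt R) (blowup_rotate b p) (blowup_rotate b q)
      (blowup_rotate b r).
  move=> pq qr; have pr : blowup_lt p r.
    move: pq qr; rewrite /blowup_lt => -[?|[? ?]] [?|[? ?]]; try by left; lra.
    by right; split; lra.
  case: (wrapP _ _ pq) => [[? wpq]|[? wp wq]];
    case: (wrapP _ _ qr) => [[? wqr]|[? wq' wr]].
  - exact: Or31.
  - by case: (wrapP _ _ pr) => [[_]|[? _ _]]; [rewrite wpq wq' wr|exact: Or33].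
  - by case: (wrapP _ _ pr) => [[_]|[? _ _]]; [rewrite wp -wqr wq|exact: Or32].
  - by rewrite wq in wq'.
have rot : forall x y z : circle R * R,
  cyclic_of (@blowup_lt R) x y z -> cyclic_of (@blowup_lt R) y z x.
  by move=> x y z [[? ?]|[? ?]|[? ?]]; [exact: Or33|exact: Or31|exact: Or32].
by case=> -[h h']; [exact: sorted|apply/rot/rot/sorted|apply/rot/sorted].
Qed.

Variable alpha : R.
Hypothesis hA : rotation alpha @` A = A.

Definition blowup_inv := projT1 (choice (blowup_surj kI)).
Local Notation rho := blowup_inv.

Lemma blowup_invP d : blowup_point (rho d). Proof.
  exact: (projT2 (choice (blowup_surj kI)) d).1. Qed.

Lemma blowup_invK : cancel rho blowup. Proof.
  by move=> d; exact: (projT2 (choice (blowup_surj kI)) d).2. Qed.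

Lemma blowupK q : blowup_point q -> rho (blowup q) = q.
Proof.
move=> vq; apply: (blowup_inj kI) => //; first exact: blowup_invP.
exact: blowup_invK.
Qed.

Lemma blowup_rotate_point b q : (forall t, A (rotation b t) = A t) ->
  blowup_point q -> blowup_point (blowup_rotate b q).
Proof. by move=> bA [r01 v]; split=> //=; rewrite bA. Qed.

Let stab := rotation_stable hA.

Let stabV t : A (rotation (- alpha) t) = A t.
Proof. exact: rotationV_stable hA t. Qed.

(** The rotation of the base, carried over to the inserted intervals. *)
Definition denjoy_fun b d := blowup (blowup_rotate b (rho d)).

Lemma denjoy_blowup b q : blowup_point q ->
  denjoy_fun b (blowup q) = blowup (blowup_rotate b q).
Proof. by move=> vq; rewrite /denjoy_fun blowupK. Qed.

Lemma denjoyK b : (forall t, A (rotation b t) = A t) ->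
  cancel (denjoy_fun b) (denjoy_fun (- b)).
Proof.
move=> bA d; rewrite /denjoy_fun blowupK;
  last exact/blowup_rotate_point/blowup_invP.
rewrite -[RHS]blowup_invK; congr blowup;
  rewrite /blowup_rotate /= rotation_funK.
by case: (rho d).
Qed.

Lemma denjoy_order b : (forall t, A (rotation b t) = A t) ->
  forall s t u, circle_order s t u ->
    circle_order (denjoy_fun b s) (denjoy_fun b t) (denjoy_fun b u).
Proof.
move=> bA s t u stu; have v d := blowup_invP d.
have v' d : blowup_point (blowup_rotate b (rho d))
  by exact: blowup_rotate_point.
apply/(blowup_order kI) => //; apply: blowup_rotate_lt.
by apply/(blowup_order kI) => //; rewrite !blowup_invK.
Qed.

Lemma denjoyVK : cancel (denjoy_fun (- alpha)) (denjoy_fun alpha).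
Proof. by have := denjoyK stabV; rewrite opprK. Qed.

Lemma denjoy_continuous : continuous (denjoy_fun alpha).
Proof.
exact: (order_iso_continuous (circle_order_co R) (circle_order_co R)
  (@circle_basis R) (@circle_basis R) (denjoyK stab) denjoyVK (denjoy_order
    stab)).
Qed.

Lemma denjoyV_continuous : continuous (denjoy_fun (- alpha)).
Proof.
exact: (order_iso_continuous (circle_order_co R) (circle_order_co R)
  (@circle_basis R) (@circle_basis R) denjoyVK (denjoyK stab) (denjoy_order
    stabV)).
Qed.

Definition denjoy : homeo (circle R) (circle R) :=
  Homeo (denjoyK stab) denjoyVK denjoy_continuous denjoyV_continuous.

Lemma denjoy_aperiodic : irrational alpha -> no_periodic_points denjoy.
Proof.
move=> alpha_irr n d n0; rewrite -[d]blowup_invK; have := blowup_invP d.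
move: (rho d) => q vq.
have it m : iter m denjoy (blowup q) = blowup (hpow (rotation alpha) (Posz m)
  q.1, q.2) /\
    blowup_point (hpow (rotation alpha) (Posz m) q.1, q.2).
  elim: m => [|m [IH1 IH2]]; first by rewrite /=; case: q vq.
  split; last exact: (blowup_rotate_point stab IH2).
  by rewrite iterS IH1 /= denjoy_blowup.
have [-> vn] := it n; move=> /(blowup_inj kI vn vq)/(congr1 fst) /=.
have [x <- _] := circle_pi_lift q.1 0.
rewrite -[iter n _ _]/(hpow (rotation alpha) (Posz n) (circle_pi x)).
rewrite hpow_rotation_pi => /circle_pi_eq; rewrite addrC addKr.
exact: irrational_multiple.
Qed.

(** ** The embedding *)

(** The two points over a in A become the ends of the interval inserted at a. *)
Definition split_code (p : split_circle A) : circle R * R :=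
  (split_proj p, ((split_val p).2)%:R).

Lemma split_code_point p : blowup_point (split_code p).
Proof.
split; rewrite /split_code /=; first by case: (split_val p).2;
  rewrite ?lexx ?ler01.
case p2 : (split_val p).2; last by right.
by left; case: (is_plusP p2).
Qed.

Definition split_embed p := blowup (split_code p).

Lemma split_embed_order p q r : split_order p q r ->
  circle_order (split_embed p) (split_embed q) (split_embed r).
Proof.
have lt u v : split_lt u v -> blowup_lt (split_code u) (split_code v).
  case=> [|[e [_ u0] [_ v1]]]; first by left.
  by right; rewrite /split_code /= e u0 v1 ltr01.
move=> /split_orderE pqr; apply/(blowup_order kI); try exact: split_code_point.
by case: pqr => -[? ?]; [apply: Or31|apply: Or32|apply: Or33]; split; exact: lt.
Qed.

Lemma split_embed_inj : injective split_embed.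
Proof.
move=> p q /(blowup_inj kI (split_code_point p) (split_code_point q)).
move=> [epq b]; apply: split_circle_eq => //; move: b.
by case: (split_val p).2 (split_val q).2 => -[] // /eqP;
  rewrite ?oner_eq0 // eq_sym oner_eq0.
Qed.

Lemma split_embed_equivariant : equivariant (split_cascade hA) denjoy
  split_embed.
Proof.
by move=> p; rewrite /split_embed /= denjoy_blowup//; exact: split_code_point.
Qed.

(** The complement of the image is the union of the open intervals inserted at
    the points of A. *)
Lemma split_embed_closed : closed (range split_embed).
Proof.
rewrite -[range _]setCK; apply: open_closedC; rewrite openE => d nd.
have [vq qd] : blowup_point (rho d) /\ blowup (rho d) = d.
  by split; [exact: blowup_invP|exact: blowup_invK].
move: (rho d) vq qd => [t r] vq qd; have [/andP[r0 r1] v] := vq.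
have r_neq0 : r != 0.
  apply/eqP => e; apply: nd; exists (split_low A t) => //.
  by rewrite -qd e.
have At : A t by case: v => //= e; rewrite e eqxx in r_neq0.
have r_neq1 : r != 1.
  apply/eqP => e; apply: nd; exists (split_high A t) => //.
  by rewrite -qd e /split_embed /split_code /= asboolT.
have {r_neq0}r0 : 0 < r by rewrite lt_neqAle eq_sym r_neq0.
have {r_neq1}r1 : r < 1 by rewrite lt_neqAle r_neq1.
pose lo := split_low A t; pose hi := split_high A t.
have bhi : (split_val hi).2 = true by rewrite /= asboolT.
apply: (@filterS _ _ _ (oint (@circle_order R) (split_embed lo) (split_embed
  hi))).
  move=> _ /[swap] -[p _ <-] /(co_reflect (split_order_circular A)
    (circle_order_co R) split_embed_inj split_embed_order) lph.
  have [lp ph _] := circular_order_neq (split_order_circular A) lph.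
  apply: (co_asym (split_order_circular A) lph); right; apply: Or31.
  by split=> //; exact: nesym.
apply: open_nbhs_nbhs; split; first exact: circle_oint_open.
rewrite -qd; apply/(blowup_order kI) => //; try exact: split_code_point.
by apply: Or31; split; right; rewrite /split_code /lo /hi /= ?asboolT.
Qed.

End denjoy.

(** The pulled back topology is compact because the image is closed, and its
    intervals are open; hence it is the interval topology. *)
Lemma compact_order_embedding (R : realType) (X : topologicalType)
    (O : X -> X -> X -> Prop) (f : X -> circle R) :
    infinite_set [set: X] -> circular_order O -> basis (open_intervals O) ->
    injective f ->
    (forall a b c, O a b c -> circle_order (f a) (f b) (f c)) ->
    closed (range f) ->
  topological_embedding f.
Proof.
move=> X_inf Oco Ob fI fO fcl.
have fO' := co_reflect Oco (circle_order_co R) fI fO.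
have ointE a b : oint O a b = f @^-1` (oint (@circle_order R) (f a) (f b)).
  by apply/seteqP; split=> x; [exact: fO|exact: fO'].
pose W := initial_topology f.
have cW : compact [set: W].
  move=> G GF _.
  have cK : compact (range f)
    by apply: subclosed_compact fcl (@circle_compact R) _.
  have [|_ [[x _ <-] clx]] := cK (fmap f G) (fmap_proper_filter f GF).
    by apply: (@filterS _ G _ setT) => [y _|]; [exists y|exact: filterT].
  exists x; split=> // B V GB [_ [[V' oV' <-] V'x] V'V].
  have [|_ [[y By <-] V'y]]
    := clx (f @` B) V' _ (open_nbhs_nbhs (conj oV' V'x)).
    by apply: (@filterS _ G _ B) GB => y By; exists y.
  by exists y; split=> //; exact: V'V.
have Wb : @basis W (open_intervals O).
  apply: (@compact_oint_basis W O Oco cW (infinite_third X_inf)) => a b.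
  by rewrite ointE; exists (oint (@circle_order R) (f a) (f b)) => //;
    exact: circle_oint_open.
have cf : continuous f.
  move=> x V fxV; have : nbhs (x : W) (f @^-1` V) by exact: initial_continuous.
  move=> /(basis_oint_nbhs Wb)[a [b [ab axb abV]]].
  apply: (filterS abV); apply: open_nbhs_nbhs; split=> //.
  exact: basis_oint_open.
split=> // U; split=> [oU|[V oV ->]]; last by apply: open_comp => // x _;
  exact: cf.
exists (\bigcup_(p in [set p : X * X | oint O p.1 p.2 `<=` U])
  oint (@circle_order R) (f p.1) (f p.2)).
  by apply: bigcup_open => p _; exact: circle_oint_open.
apply/seteqP; split=> [x Ux|x [[a b] /= abU axb]].
  have [a [b [ab axb abU]]] := basis_oint_nbhs Ob (open_nbhs_nbhs (conj oU Ux)).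
  by exists (a, b) => //=; exact: fO.
by apply: abU; exact: fO'.
Qed.

Lemma split_embeds_circle (R : realType) (X : topologicalType)
    (s : homeo X X) (alpha : R) (A : set (circle R))
    (hA : rotation alpha @` A = A) :
    compact [set: X] -> infinite_set [set: X] -> irrational alpha ->
    countable A -> cascade_isomorphic s (split_cascade hA) ->
  exists2 psi : homeo (circle R) (circle R),
    no_periodic_points psi & cascade_embeds s psi.
Proof.
move=> cX X_inf alpha_irr /countable_injP[k kI] [h hs].
exists (denjoy kI hA); first exact: denjoy_aperiodic.
have hI : injective h := can_inj (@hfunK _ _ h).
pose O a b c := split_order (h a) (h b) (h c).
have Oco : circular_order O := co_pullback (split_order_circular A) hI.
have Ob : basis (open_intervals O).
  apply: (compact_oint_basis Oco cX (infinite_third X_inf)) => a b.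
  apply: (@open_comp _ _ h (oint (@split_order R A) (h a) (h b))).
    by move=> x _; exact: (@hfun_continuous _ _ h).
  exact: (basis_oint_open (split_order_circular A) _ _ (split_basis A)).
exists (split_embed k \o h); last first.
  by move=> x /=; rewrite hs split_embed_equivariant.
apply: (compact_order_embedding X_inf Oco Ob).
- by apply: inj_comp => //; exact: split_embed_inj.
- by move=> a b c; exact: split_embed_order.
- have -> : range (split_embed k \o h) = range (@split_embed R A k).
    apply/seteqP; split=> _ [x _ <-]; first by exists (h x).
    by exists (hinv h x) => //=; rewrite hinvK.
  exact: split_embed_closed.
Qed.

(** * The equivalence theorem *)

Theorem theorem6p3 (R : realType) (X : topologicalType) (s : homeo X X)
  (X_compact : compact [set: X]) (X_hausdorff : hausdorff_space X)
  (s_minimal : minimal_cascade s) :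
  [<->
    [/\ infinite_set [set: X], circularly_ordered s, minimal_cascade s &
        @second_countable X];
    exists2 psi : homeo (circle R) (circle R),
      no_periodic_points psi & cascade_embeds s psi;
    [/\ limit_point (proximal s) `<=` diagonal,
        countable (proximal s `\` diagonal) &
        exists2 D : equiv_rel X, distal_structure_relation s D &
          inhabited (homeo (quotient_space D) (circle R))];
    exists alpha : R, irrational alpha /\
      exists (A : set (circle R)) (hA : rotation alpha @` A = A),
        countable A /\ cascade_isomorphic s (split_cascade hA)
  ].
Proof.
have embedded_ordered : (exists2 psi : homeo (circle R) (circle R),
      no_periodic_points psi & cascade_embeds s psi) ->
    [/\ infinite_set [set: X], circularly_ordered s, minimal_cascade s &
      @second_countable X].
  move=> [psi psi_aper emb].
  by have [] := circle_embedded_ordered X_compact X_hausdorff s_minimal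
    psi_aper emb.
have ordered_split : [/\ infinite_set [set: X], circularly_ordered s,
      minimal_cascade s & @second_countable X] ->
    exists alpha : R, irrational alpha /\
      exists (A : set (circle R)) (hA : rotation alpha @` A = A),
        countable A /\ cascade_isomorphic s (split_cascade hA).
  move=> [X_inf [Q [Qco Qb Q_cop]] _ X_sc].
  apply: (ordered_minimal_split R X_compact X_hausdorff s_minimal X_inf Qco Qb).
    move=> a b c abc; have [ab bc ac] := circular_order_neq Qco abc.
    by apply: ((Q_cop 1).1 _ _ _ abc) => /(@hfun_inj _ s).
  exact: second_countable_jumps.
have split_embedded : (exists alpha : R, irrational alpha /\
      exists (A : set (circle R)) (hA : rotation alpha @` A = A),
        countable A /\ cascade_isomorphic s (split_cascade hA)) ->
    exists2 psi : homeo (circle R) (circle R),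
      no_periodic_points psi & cascade_embeds s psi.
  move=> [alpha [alpha_irr [A [hA [cA iso]]]]].
  apply: (split_embeds_circle X_compact _ alpha_irr cA iso).
  have [h _] := iso.
  apply: (@infinite_set_inj _ _ (fun t => hinv h (split_low A t))).
    by move=> t u /(can_inj (@hinvK _ _ h))/(congr1 (@split_proj R A)).
  exact: circle_infinite.
have split_distal : (exists alpha : R, irrational alpha /\
      exists (A : set (circle R)) (hA : rotation alpha @` A = A),
        countable A /\ cascade_isomorphic s (split_cascade hA)) ->
    [/\ limit_point (proximal s) `<=` diagonal,
        countable (proximal s `\` diagonal) &
        exists2 D : equiv_rel X, distal_structure_relation s D &
          inhabited (homeo (quotient_space D) (circle R))].
  move=> [alpha [_ [A [hA [cA iso]]]]].
  exact: split_distal_structure iso.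
tfae.
- by move=> /ordered_split/split_embedded.
- by move=> /embedded_ordered/ordered_split/split_distal.
- move=> [P'D cP [D Dstr [h]]];
  exact: (distal_circle_split X_compact X_hausdorff s_minimal P'D cP Dstr h).
- by move=> /split_embedded/embedded_ordered.
Qed.
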